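(* Let $\mathsf k$ be a local field, $n\ge1$ an integer, $n'=n$ or $n'=n-1$, $\nu=(\nu_1,\dots,\nu_n)\in(\widehat{\mathsf k^\times})^n$, $\nu'=(\nu'_1,\dots,\nu'_{n'})\in(\widehat{\mathsf k^\times})^{n'}$, $f\in I_\nu$, $f'\in I_{\nu'}$ and $\phi\in\mathcal S(\mathsf k^{1\times n})$. Assume that $s\in\mathbb C$ lies in the vertical strip $$\Omega_{\nu,\nu'}:=\left\{s\in\mathbb C\ :\ \begin{array}{l}\mathrm{ex}(\nu_i)+\mathrm{ex}(\nu'_j)+\mathrm{Re}(s)<1\ \text{ whenever } i+j\le n,\\ \mathrm{ex}(\nu_i)+\mathrm{ex}(\nu'_j)+\mathrm{Re}(s)>0\ \text{ whenever } i+j>n\end{array}\right\}$$ (with $1\le i\le n$, $1\le j\le n'$). Then the integral $$\Lambda(s,f,f',\phi)=\int_{G_n}f(z_ng)\,f'\!\left(\begin{bmatrix}z_{n-1}&0\\0&1\end{bmatrix}g\right)\phi(e_ng)|\det g|_{\mathsf k}^s\,dg$$ if $n'=n$, and the integral $$\Lambda(s,f,f')=\int_{G_{n-1}}f\!\left(z_n\begin{bmatrix}h&0\\0&1\end{bmatrix}\right)f'(z_{n-1}h)|\det h|_{\mathsf k}^{s-\frac12}\,dh$$ if $n'=n-1$, is absolutely convergent.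
   Context: $\mathsf k$ is an arbitrary local field with normalized absolute value $|\cdot|_{\mathsf k}$, with the self-dual Haar measure for a fixed nontrivial unitary character $\psi$. $\widehat{\mathsf k^\times}$ is the set of continuous homomorphisms $\mathsf k^\times\to\mathbb C^\times$; for $\omega\in\widehat{\mathsf k^\times}$, $\mathrm{ex}(\omega)\in\mathbb R$ is defined by $|\omega(a)|=|a|_{\mathsf k}^{\mathrm{ex}(\omega)}$ for all $a\in\mathsf k^\times$. $\mathsf k^{k\times l}$ is the space of $k\times l$ matrices, and $\mathcal S(\mathsf k^{k\times l})$ is the space of Schwartz functions (archimedean case) or locally constant compactly supported functions (non-archimedean case). $G_k=\mathrm{GL}_k(\mathsf k)$ ($k\ge 0$; $G_0$ is trivial, of total mass $1$) with Haar measure $|\det g|_{\mathsf k}^{-k}\prod_{i,j}dg_{i,j}$; $\bar B_k$ is the subgroup of lower triangular matrices; $e_k=[0,\dots,0,1]\in\mathsf k^{1\times k}$. $\mu\in(\widehat{\mathsf k^\times})^k$ is viewed as the character $\bar b\mapsto\prod_i\mu_i(\bar b_{i,i})$ of $\bar B_k$. With $\bar\rho_k=(|\cdot|_{\mathsf k}^{\frac{1-k}2},|\cdot|_{\mathsf k}^{\frac{3-k}2},\dots,|\cdot|_{\mathsf k}^{\frac{k-1}2})$, $I_\mu$ is the space of $f\in C^\infty(G_k)$ (smooth, resp. in the non-archimedean case invariant under right translation by some open subgroup) with $f(\bar bx)=\mu(\bar b)\bar\rho_k(\bar b)f(x)$ for all $\bar b\in\bar B_k$, $x\in G_k$. $w_k\in\mathrm{GL}_k(\mathsf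 k)$ is the antidiagonal permutation matrix, ${}^t$ is transpose, $g^\iota={}^tg^{-1}$. $z_0$ is the unique element of $\mathrm{GL}_0(\mathsf k)$, $z_1=[1]$, and for $k\ge2$ $$z_k=\begin{bmatrix}w_{k-1}&0\\0&1\end{bmatrix}\begin{bmatrix}z_{k-2}^\iota&0\\0&1_2\end{bmatrix}\begin{bmatrix}{}^tz_{k-1}w_{k-1}z_{k-1}&{}^te_{k-1}\\0&1\end{bmatrix},$$ where $1_2$ is the $2\times2$ identity matrix. *)

(* Defs.v *)
From HB Require Import structures.
From mathcomp Require Import all_boot all_order all_algebra.
From mathcomp Require Import complex.
From mathcomp Require Import all_classical all_reals all_analysis.

Set Implicit Arguments.
Unset Strict Implicit.
Unset Printing Implicit Defensive.

Import Order.TTheory GRing.Theory Num.Theory.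
Import numFieldTopology.Exports numFieldNormedType.Exports.

Local Open Scope classical_set_scope.
Local Open Scope ring_scope.
Local Open Scope complex_scope.

(* A field with a nontrivial (not necessarily normalized) absolute value. *)
HB.mixin Record hasAbsoluteValue (R : realType) K & GRing.Field K := {
  absv : K -> R ;
  absv_ge0 : forall x, 0 <= absv x ;
  absv_eq0 : forall x, (absv x == 0) = (x == 0) ;
  absvM : forall x y, absv (x * y) = absv x * absv y ;
  absvD : forall x y, absv (x + y) <= absv x + absv y ;
  absv_nontrivial : exists2 x, x != 0 & absv x != 1
}.

#[short(type="absFieldType")]
HB.structure Definition AbsField (R : realType) :=
  { K of GRing.Field K & hasAbsoluteValue R K }.

Section AbsTopology.
Context {R : realType} (K : absFieldType R).

Definition absdist (x y : K) : R := absv (x - y).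

Lemma absv0 : absv (0 : K) = 0.
Proof. by apply/eqP; rewrite absv_eq0. Qed.

Lemma absv1 : absv (1 : K) = 1.
Proof.
have /mulIf : absv (1 : K) != 0 by rewrite absv_eq0 oner_neq0.
by apply; rewrite -absvM !mul1r.
Qed.

Lemma absvN (x : K) : absv (- x) = absv x.
Proof.
apply/eqP; rewrite -(@eqrXn2 _ 2) ?absv_ge0//.
by rewrite !expr2 -!absvM mulrNN.
Qed.

Lemma absdistxx x : absdist x x = 0.
Proof. by rewrite /absdist subrr absv0. Qed.

Lemma absdist_positivity x y : absdist x y = 0 -> x = y.
Proof. by move/eqP; rewrite absv_eq0 subr_eq0 => /eqP. Qed.

Lemma absdist_sym x y : absdist x y = absdist y x.
Proof. by rewrite /absdist -absvN opprB. Qed.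

Lemma absdist_triangle y x z : absdist x z <= absdist x y + absdist y z.
Proof. by rewrite /absdist -(subrKA y) absvD. Qed.

HB.instance Definition _ := isPointed.Build K 0.
HB.instance Definition _ := @isMetric.Build R K absdist
  absdistxx absdist_positivity absdist_sym absdist_triangle.
End AbsTopology.

(* A local field is a field which is locally compact for the topology of a
   nontrivial absolute value.  [absv] is only used to define the topology: the
   normalized absolute value is given by [normalized_abs] below, and may differ
   from [absv] by an exponent (for the complex numbers it is not subadditive). *)
Definition is_local_field (R : realType) (K : absFieldType R) : Prop :=
  locally_compact [set: K].

Definition nonarchimedean (R : realType) (K : absFieldType R) : Prop :=
  forall x y : K, absv (x + y) <= Num.max (absv x) (absv y).

Section ComplexValued.
Context {R : realType}.

(* a^s for a > 0 *)
Definition cpow (a : R) (s : R[i]) : R[i] :=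
  (a `^ complex.Re s)%:C
  * (cos (complex.Im s * ln a) +i* sin (complex.Im s * ln a)).

Definition Cintegral d (T : measurableType d) (mu : {measure set T -> \bar R})
    (g : T -> R[i]) : R[i] :=
  (\int[mu]_x complex.Re (g x)) +i* (\int[mu]_x complex.Im (g x)).

Definition absolutely_convergent d (T : measurableType d)
    (mu : {measure set T -> \bar R}) (D : set T) (g : T -> R[i]) : Prop :=
  [/\ measurable_fun D (fun x => complex.Re (g x)),
      measurable_fun D (fun x => complex.Im (g x)) &
      (\int[mu]_(x in D) (Normc.normc (g x))%:E < +oo)%E].

End ComplexValued.

Section ProductMeasure.
Context d (T : measurableType d) (R : realType).
Local Open Scope ereal_scope.

Definition consp n (x : T * n.-tuple T) : n.+1.-tuple T :=
  [tuple of x.1 :: x.2].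

Lemma measurable_consp n : measurable_fun [set: T * n.-tuple T] (@consp n).
Proof. exact: measurable_cons. Qed.

Section step.
Variables (mu : {sigma_finite_measure set T -> \bar R}) (n : nat).
Variable nu : {sigma_finite_measure set (n.-tuple T) -> \bar R}.

Definition cons_measure : set (n.+1.-tuple T) -> \bar R :=
  pushforward (mu \x nu) (@consp n).

Let pushforward_consp : {measure set (n.+1.-tuple T) -> \bar R} :=
  measure_function_pushforward__canonical__measure_function_Measure
    (mu \x nu) (@measurable_consp n).

HB.instance Definition _ := isMeasure.Build _ _ _ cons_measure
  (measure0 pushforward_consp) (measure_ge0 pushforward_consp)
  (@measure_semi_sigma_additive _ _ _ pushforward_consp).

Lemma cons_measure_sigma_finite : sigma_finite setT cons_measure.
Proof.
have /sigma_finiteP[F [FT ndF Foo]] := sigma_finiteT mu.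
have /sigma_finiteP[G [GT ndG Goo]] := sigma_finiteT nu.
pose hd (t : n.+1.-tuple T) := tnth t ord0.
pose tl (t : n.+1.-tuple T) : n.-tuple T := [tuple of behead t].
exists (fun k => (hd @^-1` F k) `&` (tl @^-1` G k)) => [|k].
  apply/seteqP; split=> // t _.
  have [i _ Fi] : (\bigcup_i F i) (hd t) by rewrite -FT.
  have [j _ Gj] : (\bigcup_i G i) (tl t) by rewrite -GT.
  exists (maxn i j) => //; split.
    by have /subsetPset := ndF _ _ (leq_maxl i j); apply.
  by have /subsetPset := ndG _ _ (leq_maxr i j); apply.
have [mF Fk] := Foo k; have [mG Gk] := Goo k; split.
  apply: measurableI; rewrite -[X in measurable X]setTI.
    exact: measurable_tnth.
  exact: measurable_behead.
rewrite /cons_measure /pushforward.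
rewrite (_ : _ @^-1` _ = F k `*` G k); last first.
  apply/seteqP; split=> -[x t] /= [].
    rewrite /hd /tl tnth0 => Fx.
    by rewrite (_ : [tuple of _] = t)//; apply: val_inj.
  rewrite /hd /tl tnth0 => Fx Gt; split => //.
  by rewrite (_ : [tuple of _] = t)//; apply: val_inj.
by rewrite product_measure1E// lte_mul_pinfty// ge0_fin_numE.
Qed.

HB.instance Definition _ := Measure_isSigmaFinite.Build _ _ _ cons_measure
  cons_measure_sigma_finite.
End step.

Fixpoint power_measure (mu : {sigma_finite_measure set T -> \bar R}) n :
    {sigma_finite_measure set (n.-tuple T) -> \bar R} :=
  match n with
  | 0 => \d_[tuple]
  | m.+1 => cons_measure mu (power_measure mu m)
  end.
End ProductMeasure.

Section LocalField.
Context {R : realType} {K : absFieldType R}.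

Definition borel : measurableType _ := g_sigma_algebraType (@open K).

Definition is_haar (mu : {measure set borel -> \bar R}) : Prop :=
  [/\ forall (a : K) (A : set borel), measurable A ->
        mu [set a + x | x in A] = mu A,
      forall A : set K, compact A -> (mu A < +oo)%E &
      (0 < mu [set: K])%E].

(* The normalized absolute value is the module of the Haar measure,
   d(ax) = |a| dx. *)
Definition normalized_abs (mu : {measure set borel -> \bar R}) (nabs : K -> R)
    : Prop :=
  nabs 0 = 0 /\
  forall a : K, a != 0 -> forall A : set borel, measurable A ->
    mu [set a * x | x in A] = ((nabs a)%:E * mu A)%E.

Definition unitary_character (psi : K -> R[i]) : Prop :=
  [/\ forall x y, psi (x + y) = psi x * psi y,
      forall x, Normc.normc (psi x) = 1 &
      continuous (psi : K -> R[i]^o)].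

Section Smooth.
Variables p q : nat.
Local Notation V := 'M[K]_(p, q).
Implicit Types (iota : R -> K) (f : V -> R[i]) (D : set V).

(* Differentiation on a matrix space over an archimedean local field, seen as a
   real vector space through iota : R -> K. *)
Definition real_derivable iota (v : V) f (x : V) : Prop :=
  derivable (fun t : R => complex.Re (f (x + iota t *: v))) 0 1 /\
  derivable (fun t : R => complex.Im (f (x + iota t *: v))) 0 1.

Definition real_deriv iota (v : V) f : V -> R[i] := fun x =>
  (derive1 (fun t : R => complex.Re (f (x + iota t *: v))) 0) +i*
  (derive1 (fun t : R => complex.Im (f (x + iota t *: v))) 0).

Definition iter_deriv iota (vs : seq V) f : V -> R[i] :=
  foldr (real_deriv iota) f vs.

(* C^oo on the open set D: all iterated directional derivatives exist and are
   continuous. *)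
Definition Coo_on iota D f : Prop :=
  forall (vs : seq V) (x : V), D x ->
    {for x, continuous (iter_deriv iota vs f : V -> R[i]^o)} /\
    forall v, real_derivable iota v (iter_deriv iota vs f) x.

Definition mx_size (x : V) : R := \sum_i \sum_j absv (x i j).

Definition rapidly_decreasing iota f : Prop :=
  forall (vs : seq V) (N : nat), exists C : R, forall x,
    (1 + mx_size x) ^+ N * Normc.normc (iter_deriv iota vs f x) <= C.

Definition locally_constant f : Prop :=
  forall x : V, \forall y \near x, f y = f x.

Definition compactly_supported f : Prop :=
  exists2 A : set V, compact A & forall x, ~ A x -> f x = 0.

Definition schwartz f : Prop :=
  (nonarchimedean K -> locally_constant f /\ compactly_supported f) /\
  (~ nonarchimedean K -> exists iota : {rmorphism R -> K},
     [/\ continuous iota, Coo_on iota setT f & rapidly_decreasing iota f]).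

End Smooth.

(* The Haar measure mu is self-dual for psi: the Fourier inversion formula
   holds without constant. *)
Definition fourier (mu : {measure set borel -> \bar R}) (psi : K -> R[i])
    (phi : K -> R[i]) : K -> R[i] :=
  fun y => Cintegral mu (fun x : borel => phi x * psi (x * y)).

Definition self_dual (mu : {measure set borel -> \bar R}) (psi : K -> R[i])
    : Prop :=
  forall phi : 'M[K]_1 -> R[i], schwartz phi -> forall x : K,
    fourier mu psi (fourier mu psi (fun t : K => phi t%:M)) x = phi (- x)%:M.

(* Continuous homomorphisms K^* -> C^*; the value at 0 is irrelevant. *)
Record quasi_character := QuasiCharacter {
  qchar :> K -> R[i] ;
  qchar_neq0 : forall a, a != 0 -> qchar a != 0 ;
  qcharM : forall a b, a != 0 -> b != 0 -> qchar (a * b) = qchar a * qchar b ;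
  qchar_continuous : forall a, a != 0 ->
    {for a, continuous (qchar : K -> R[i]^o)}
}.

Definition exponent (nabs : K -> R) (omega : quasi_character) : R :=
  get [set r : R | forall a, a != 0 -> Normc.normc (omega a) = nabs a `^ r].

Section LinearGroup.
Variable k : nat.
Implicit Types f : 'M[K]_k -> R[i].

Definition GL : set 'M[K]_k := [set g | g \in unitmx].

Definition open_subgroup (U : set 'M[K]_k) : Prop :=
  [/\ open U, U `<=` GL, U 1%:M,
      forall x y, U x -> U y -> U (x *m y) &
      forall x, U x -> U (invmx x)].

(* Functions on GL_k(K) are represented by functions on matrices, whose values
   outside GL_k(K) are irrelevant. *)
Definition smooth_GL f : Prop :=
  (nonarchimedean K -> exists2 U, open_subgroup U &
     forall x u, GL x -> U u -> f (x *m u) = f x) /\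
  (~ nonarchimedean K -> exists2 iota : {rmorphism R -> K},
     continuous iota & Coo_on iota GL f).

(* The exponents are (1 - k)/2, (3 - k)/2, ..., (k - 1)/2. *)
Definition rho_bar (nabs : K -> R) (b : 'M[K]_k) : R :=
  \prod_(i < k) (nabs (b i i) `^ (((i.*2.+1)%:R - k%:R) / 2)).

(* The space I_mu; [is_trig_mx] means lower triangular. *)
Definition principal_series (nabs : K -> R) (mu : 'I_k -> quasi_character) f
    : Prop :=
  smooth_GL f /\
  forall b x, is_trig_mx b -> GL b -> GL x ->
    f (b *m x) = (\prod_(i < k) mu i (b i i)) * (rho_bar nabs b)%:C * f x.

(* The matrix whose entries are listed by t. *)
Definition mx_of_tuple (t : (k * k).-tuple K) : 'M[K]_k :=
  \matrix_(i, j) tnth t (mxvec_index i j).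

(* Absolute convergence of the integral of F over GL_k(K) for the measure
   |det g|^(-k) prod_(i,j) dg_ij. *)
Definition GL_absolutely_convergent
    (mu : {sigma_finite_measure set borel -> \bar R}) (nabs : K -> R)
    (F : 'M[K]_k -> R[i]) : Prop :=
  absolutely_convergent (power_measure mu (k * k))
    [set t | GL (mx_of_tuple t)]
    (fun t => F (mx_of_tuple t) * (nabs (\det (mx_of_tuple t)) ^- k)%:C).

End LinearGroup.

Definition in_strip (nabs : K -> R) n n' (nu : 'I_n -> quasi_character)
    (nu' : 'I_n' -> quasi_character) (s : R[i]) : Prop :=
  forall (i : 'I_n) (j : 'I_n'),
    ((i.+1 + j.+1 <= n)%N ->
       exponent nabs (nu i) + exponent nabs (nu' j) + complex.Re s < 1) /\
    ((n < i.+1 + j.+1)%N ->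
       0 < exponent nabs (nu i) + exponent nabs (nu' j) + complex.Re s).

End LocalField.

Arguments borel {R} K.
Arguments quasi_character {R} K.

Section ZMatrices.
Variable F : fieldType.

(* [A 0; 0 1] *)
Definition bordered n (A : 'M[F]_n) : 'M[F]_n.+1 :=
  castmx (addn1 n, addn1 n) (block_mx A 0 0 1%:M).

Definition antidiag n : 'M[F]_n := \matrix_(i, j) (j == rev_ord i)%:R.

Definition last_row n : 'rV[F]_n := \row_j (j.+1 == n)%:R.

Definition iota_mx n (A : 'M[F]_n) : 'M[F]_n := (invmx A)^T.

Definition z_step k (z0 : 'M[F]_k) (z1 : 'M[F]_k.+1) : 'M[F]_k.+2 :=
  bordered (antidiag k.+1)
  *m castmx (addn2 k, addn2 k) (block_mx (iota_mx z0) 0 0 1%:M)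
  *m castmx (addn1 k.+1, addn1 k.+1)
       (block_mx (z1^T *m antidiag k.+1 *m z1) (last_row k.+1)^T 0 1%:M).

Fixpoint z_pair k : 'M[F]_k * 'M[F]_k.+1 :=
  match k with
  | 0 => (1%:M, 1%:M)
  | m.+1 => let: (z0, z1) := z_pair m in (z1, z_step z0 z1)
  end.

Definition z_mx k : 'M[F]_k := (z_pair k).1.

Lemma z_mx0 : z_mx 0 = 1%:M. Proof. by []. Qed.

Lemma z_mx1 : z_mx 1 = 1%:M. Proof. by []. Qed.

Lemma z_mxSS k : z_mx k.+2 = z_step (z_mx k) (z_mx k.+1).
Proof. by rewrite /z_mx /=; case: (z_pair k). Qed.

End ZMatrices.

(* Main.v *)
(* Up to constants, a function in the principal series is dominated by the flag
   function prod_i (D_(i+1) / D_i)^(al_i), where D_i is the sum of the absolute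
   values of the minors of the first i rows; it satisfies the same equivariance
   and is bounded on bounded sets (Iwasawa decomposition).  So it suffices to
   integrate products of flag functions.

   Two integral estimates are used.  First, the Godement-Jacquet type integral
   of a flag function times a decaying function on matrices converges when
   al_i > i (induction on the size, splitting off the first row and column).
   Second, a flag function on GL_(n+1) is dominated by its Godement section: an
   integral over GL_n of a decaying function of k^-1 (first n rows of g) times a
   flag function of k.

   Let A(n) be the statement for (n+1, n+1) and B(n) the one for (n+1, n).
   Inserting the Godement section of f' and exchanging the integrals reduces
   A(n) to B(n).  Inserting that of f, exchanging the integrals, and using the
   recursive formula for z together with g |-> g^iota reduces B(n+1) to A(n) for
   the exponents 1/2 - a_i and 1/2 - b_j in reversed order.  At each step the
   inner integral is of Godement-Jacquet type and only needs the positivity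
   conditions involving the last exponent of the expanded function; the
   conditions a_i + b_j < 1 enter through the reversal. *)

From HB Require Import structures.
Require Import Defs.
From mathcomp Require Import all_boot all_order all_algebra perm.
From mathcomp Require Import complex finmap.
From mathcomp Require Import all_classical all_reals all_analysis.
From mathcomp Require Import measurable_realfun.
From mathcomp Require Import ring lra zify.

Set Implicit Arguments.
Unset Strict Implicit.
Unset Printing Implicit Defensive.

Import Order.TTheory GRing.Theory Num.Theory.
Import numFieldTopology.Exports numFieldNormedType.Exports.

Local Open Scope classical_set_scope.
Local Open Scope ring_scope.

(** * Topology of an absolutely valued field and its matrices *)

(** Archimedean and non-archimedean fields are treated at once, without a maximal compact subgroup
    and without Jacobians. Compactness is replaced by bounds on a matrix and its inverse, and every
    estimate holds up to a constant. Haar measures are handled through uniqueness: a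
    translation-invariant measure is determined by the volume of one cube, so a linear substitution
    costs a single constant, and the constants of left multiplications form a positive character of
    GL, which is known once it is known on diagonal matrices.

    All integrands are replaced by nonnegative majorants, so Tonelli applies before any convergence
    is known; Godement's integral is used only as a majorant, finite or not. The order of decay
    cannot be fixed beforehand, because each Godement-Jacquet integral asks for its own: the
    equal-rank statement is existential in [N], which a Schwartz function can afford.

    The numbers 1/2 come from the half sums of roots: the reversed and negated weights of rank n+1
    are those of rank n shifted by 1/2, so the recursion sends a_i + b_j to 1 - (a_i + b_j). *)

Section AbsoluteValue.
Context {R : realType} {K : absFieldType R}.
Implicit Types (x y : K).

Lemma absvV x : absv x^-1 = (absv x)^-1.
Proof.
have [->|x0] := eqVneq x 0; first by rewrite invr0 absv0 invr0.
have ax0 : absv x != 0 by rewrite absv_eq0.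
by apply: (mulfI ax0); rewrite -absvM !divff// absv1.
Qed.

Lemma absv_gt0 x : (0 < absv x) = (x != 0).
Proof. by rewrite lt_neqAle absv_ge0 andbT eq_sym absv_eq0. Qed.

Lemma absvX x n : absv (x ^+ n) = absv x ^+ n.
Proof. by elim: n => [|n IH]; rewrite ?expr0 ?absv1// !exprS absvM IH. Qed.

Lemma absv_sign n : absv ((-1) ^+ n : K) = 1.
Proof. by rewrite absvX absvN absv1 expr1n. Qed.

Lemma absv_sum I (r : seq I) (P : pred I) (f : I -> K) :
  absv (\sum_(i <- r | P i) f i) <= \sum_(i <- r | P i) absv (f i).
Proof.
elim/big_rec2: _ => [|i u v _ IH]; first by rewrite absv0.
by rewrite (le_trans (absvD _ _))// lerD2l.
Qed.

Lemma absv_prod I (r : seq I) (P : pred I) (f : I -> K) :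
  absv (\prod_(i <- r | P i) f i) = \prod_(i <- r | P i) absv (f i).
Proof. by elim/big_rec2: _ => [|i u v _ IH]; rewrite ?absv1// absvM IH. Qed.

Lemma absv_sub x y : `|absv x - absv y| <= absv (x - y).
Proof.
rewrite ler_norml.
have := absvD (x - y) y; rewrite subrK => h1.
have := absvD (y - x) x; rewrite subrK -(absvN (y - x)) opprB => h2.
by apply/andP; split; lra.
Qed.

Lemma exists_absv_gt1 : exists pi : K, 1 < absv pi.
Proof.
have [x x0 x1] := absv_nontrivial (s := K).
have [lt1|] := ltP 1 (absv x); first by exists x.
rewrite le_eqVlt (negbTE x1)/= => lt1; exists x^-1.
by rewrite absvV invf_gt1// absv_gt0.
Qed.

Section Filters.
Context {T : Type} {F : set_system T} {FF : Filter F}.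
Implicit Types (f g : T -> K).

Lemma cvg_absP f (a : K) : f @ F --> a <->
  forall e : R, 0 < e -> \forall t \near F, absv (a - f t) < e.
Proof. exact: cvg_ballP. Qed.

Lemma cvg_absD f g (a b : K) : f @ F --> a -> g @ F --> b ->
  (fun t => f t + g t) @ F --> a + b.
Proof.
move=> /cvg_absP fa /cvg_absP gb; apply/cvg_absP => e e0.
have e20 : 0 < e / 2 by rewrite divr_gt0.
near=> t; rewrite opprD addrACA (le_lt_trans (absvD _ _))// (splitr e) ltrD//.
  by near: t; exact: fa.
by near: t; exact: gb.
Unshelve. all: by end_near. Qed.

Lemma cvg_absN f (a : K) : f @ F --> a -> (fun t => - f t) @ F --> - a.
Proof.
move=> /cvg_absP fa; apply/cvg_absP => e e0.
by apply: filterS (fa _ e0) => t; rewrite -opprD absvN.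
Qed.

Lemma cvg_abs f (a : K) : f @ F --> a -> (fun t => absv (f t)) @ F --> absv a.
Proof.
move=> /cvg_absP fa; apply/cvgrPdist_lt => e e0.
by apply: filterS (fa _ e0) => t; exact/le_lt_trans/absv_sub.
Qed.

Lemma cvg_absM f g (a b : K) : f @ F --> a -> g @ F --> b ->
  (fun t => f t * g t) @ F --> a * b.
Proof.
move=> fa gb; apply/cvg_absP => e e0.
have h : (fun t => absv (a - f t) * absv b + absv (f t) * absv (b - g t)) @ F
    --> absv (a - a) * absv b + absv a * absv (b - b).
  apply: cvgD; apply: cvgM; try exact: cvg_cst; apply: cvg_abs => //.
    by apply: cvg_absD; [exact: cvg_cst|exact: cvg_absN].
  by apply: cvg_absD; [exact: cvg_cst|exact: cvg_absN].
rewrite !subrr !absv0 mul0r mulr0 addr0 in h.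
move/cvgrPdist_lt: h => /(_ _ e0); apply: filterS => t.
rewrite sub0r normrN => /(le_lt_trans _); apply.
have -> : a * b - f t * g t = (a - f t) * b + f t * (b - g t) by ring.
by rewrite (le_trans (absvD _ _))// !absvM ler_norm.
Qed.

Lemma cvg_absV f (a : K) : a != 0 -> f @ F --> a ->
  (fun t => (f t)^-1) @ F --> a^-1.
Proof.
move=> a0 fa; apply/cvg_absP => e e0.
have aa : 0 < absv a by rewrite absv_gt0.
have h : (fun t => absv (a - f t) / absv (f t) / absv a) @ F -->
   absv (a - a) / absv a / absv a.
  apply: cvgM; last exact: cvg_cst; apply: cvgM; last first.
    by apply: cvgV; [rewrite absv_eq0|exact: cvg_abs].
  by apply: cvg_abs; apply: cvg_absD; [exact: cvg_cst|exact: cvg_absN].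
rewrite subrr absv0 !mul0r in h.
move/cvgrPdist_lt: h => /(_ _ e0) h; move/cvg_absP: fa => /(_ _ aa) fa.
near=> t.
have ft0 : f t != 0.
  by apply/eqP => ft0; have : absv (a - f t) < absv a;
    [near: t|rewrite ft0 subr0 ltxx].
have -> : a^-1 - (f t)^-1 = - (a - f t) / f t / a.
  by field; rewrite a0 ft0.
rewrite !absvM !absvV absvN; apply: le_lt_trans (ler_norm _) _.
by rewrite -normrN -sub0r; near: t.
Unshelve. all: by end_near. Qed.

Lemma cvg_abs_sum (I : Type) (r : seq I) (P : pred I) (f : I -> T -> K)
    (a : I -> K) : (forall i, P i -> f i @ F --> a i) ->
  (fun t => \sum_(i <- r | P i) f i t) @ F --> \sum_(i <- r | P i) a i.
Proof.
move=> h; elim: r => [|i r IH].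
  by rewrite big_nil; under eq_fun do rewrite big_nil; exact: cvg_cst.
rewrite big_cons; under eq_fun do rewrite big_cons.
by case: ifP => // Pi; apply: cvg_absD => //; exact: h.
Qed.

Lemma cvg_abs_prod (I : Type) (r : seq I) (P : pred I) (f : I -> T -> K)
    (a : I -> K) : (forall i, P i -> f i @ F --> a i) ->
  (fun t => \prod_(i <- r | P i) f i t) @ F --> \prod_(i <- r | P i) a i.
Proof.
move=> h; elim: r => [|i r IH].
  by rewrite big_nil; under eq_fun do rewrite big_nil; exact: cvg_cst.
rewrite big_cons; under eq_fun do rewrite big_cons.
by case: ifP => // Pi; apply: cvg_absM => //; exact: h.
Qed.

(** Neighbourhoods of a matrix are generated by entrywise boxes; a constraint on one entry is the
    box whose other sides are [setT]. *)
Lemma cvg_mxP p q (f : T -> 'M[K]_(p, q)) (a : 'M[K]_(p, q)) :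
  f @ F --> a <-> forall i j, (fun t => f t i j) @ F --> a i j.
Proof.
split=> [fa i j|fa].
  move=> A aA; apply: (fa [set M | A (M i j)]).
  exists (fun i' j' => if (i' == i) && (j' == j) then A else setT) => [i' j'|M].
    by case: ifP => [/andP[/eqP -> /eqP ->]//|_]; exact: filterT.
  by move=> /(_ i j); rewrite !eqxx.
move=> A [P aP PA]; have : \forall t \near F, forall ij, P ij.1 ij.2 (f t ij.1 ij.2).
  apply: filter_forall => -[i j] /=.
  exact: (fa i j _ (aP i j)).
by apply: filterS => t h; apply: PA => i j; exact: (h (i, j)).
Qed.

Lemma cvg_mulmx p q r (f : T -> 'M[K]_(p, q)) (g : T -> 'M[K]_(q, r))
    (a : 'M[K]_(p, q)) (b : 'M[K]_(q, r)) :
  f @ F --> a -> g @ F --> b -> (fun t => f t *m g t) @ F --> a *m b.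
Proof.
move=> /cvg_mxP fa /cvg_mxP gb; apply/cvg_mxP => i j.
rewrite !mxE; under eq_fun do rewrite mxE.
by apply: cvg_abs_sum => k _; exact: cvg_absM.
Qed.

Lemma cvg_det p (f : T -> 'M[K]_p) (a : 'M[K]_p) : f @ F --> a ->
  (fun t => \det (f t)) @ F --> \det a.
Proof.
move=> /cvg_mxP fa; apply: cvg_abs_sum => s _.
by apply: cvg_absM; [exact: cvg_cst|apply: cvg_abs_prod => i _].
Qed.

End Filters.

Lemma mx_entry_cvg p q (M : 'M[K]_(p, q)) i j :
  (fun N : 'M[K]_(p, q) => N i j) @ M --> M i j.
Proof. by have /cvg_mxP := @cvg_id _ (nbhs M); apply. Qed.

Lemma det_cvg k (x : 'M[K]_k) : (fun y : 'M[K]_k => \det y) @ x --> \det x.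
Proof. exact: (@cvg_det _ (nbhs x) _ k id x cvg_id). Qed.

Lemma open_GL k : open (@GL R K k).
Proof.
rewrite openE => x xG; rewrite /interior /GL.
have dx : \det x != 0 by rewrite -unitfE -unitmxE.
have /cvgrPdist_lt : (fun y : 'M[K]_k => absv (\det y)) @ x --> absv (\det x).
  exact: (cvg_abs (@det_cvg _ x)).
move=> /(_ (absv (\det x))); rewrite absv_gt0 => /(_ dx).
apply: filterS => y; rewrite /= unitmxE unitfE -absv_eq0 => h.
by apply/eqP => y0; move: h; rewrite y0 subr0 ger0_norm ?absv_ge0// ltxx.
Qed.

End AbsoluteValue.

Section Size.
Context {R : realType} {K : absFieldType R}.

Lemma mx_size_ge0 p q (x : 'M[K]_(p, q)) : 0 <= mx_size x.
Proof. by apply: sumr_ge0 => i _; apply: sumr_ge0 => j _; exact: absv_ge0. Qed.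

Lemma absv_le_size p q (x : 'M[K]_(p, q)) i j : absv (x i j) <= mx_size x.
Proof.
rewrite /mx_size (bigD1 i)//= (bigD1 j)//= -addrA lerDl addr_ge0//.
  by apply: sumr_ge0 => ? _; exact: absv_ge0.
by apply: sumr_ge0 => ? _; apply: sumr_ge0 => ? _; exact: absv_ge0.
Qed.

Lemma mx_sizeM p q r (x : 'M[K]_(p, q)) (y : 'M[K]_(q, r)) :
  mx_size (x *m y) <= mx_size x * mx_size y.
Proof.
apply: (@le_trans _ _ (\sum_i \sum_j \sum_k absv (x i k) * absv (y k j))).
  apply: ler_sum => i _; apply: ler_sum => j _; rewrite mxE.
  by apply: le_trans (absv_sum _ _ _) _; apply: ler_sum => k _; rewrite absvM.
rewrite {1}/mx_size mulr_suml; apply: ler_sum => i _.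
rewrite exchange_big mulr_suml; apply: ler_sum => k _; rewrite -mulr_sumr.
apply: ler_wpM2l; first exact: absv_ge0.
rewrite /mx_size (bigD1 k)//= lerDl.
by apply: sumr_ge0 => ? _; apply: sumr_ge0 => ? _; exact: absv_ge0.
Qed.

Lemma mx_sizeD p q (x y : 'M[K]_(p, q)) : mx_size (x + y) <= mx_size x + mx_size y.
Proof.
rewrite /mx_size -big_split; apply: ler_sum => i _ /=.
by rewrite -big_split; apply: ler_sum => j _ /=; rewrite mxE absvD.
Qed.

Lemma mx_sizeN p q (x : 'M[K]_(p, q)) : mx_size (- x) = mx_size x.
Proof. by apply: eq_bigr => i _; apply: eq_bigr => j _; rewrite mxE absvN. Qed.

Lemma mx_sizeT p q (x : 'M[K]_(p, q)) : mx_size x^T = mx_size x.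
Proof.
rewrite /mx_size exchange_big; apply: eq_bigr => i _.
by apply: eq_bigr => j _; rewrite mxE.
Qed.

Lemma mx_sizeZ p q c (x : 'M[K]_(p, q)) : mx_size (c *: x) = absv c * mx_size x.
Proof.
rewrite /mx_size mulr_sumr; apply: eq_bigr => i _.
by rewrite mulr_sumr; apply: eq_bigr => j _; rewrite mxE absvM.
Qed.

Lemma mx_size0 p q : mx_size (0 : 'M[K]_(p, q)) = 0.
Proof. by rewrite /mx_size big1// => i _; rewrite big1// => j _; rewrite mxE absv0. Qed.

Lemma mx_size_row_mx p q r (x : 'M[K]_(p, q)) (y : 'M[K]_(p, r)) :
  mx_size (row_mx x y) = mx_size x + mx_size y.
Proof.
rewrite /mx_size -big_split; apply: eq_bigr => i _ /=.
rewrite big_split_ord /=; congr (_ + _).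
  by apply: eq_bigr => j _; rewrite row_mxEl.
by apply: eq_bigr => j _; rewrite row_mxEr.
Qed.

Lemma mx_size_col_mx p q r (x : 'M[K]_(p, q)) (y : 'M[K]_(r, q)) :
  mx_size (col_mx x y) = mx_size x + mx_size y.
Proof. by rewrite -mx_sizeT tr_col_mx mx_size_row_mx !mx_sizeT. Qed.

Lemma mx_size_block_mx p q r s (x : 'M[K]_(p, q)) (y : 'M[K]_(p, r))
    (z : 'M[K]_(s, q)) (t : 'M[K]_(s, r)) :
  mx_size (block_mx x y z t) = mx_size x + mx_size y + (mx_size z + mx_size t).
Proof. by rewrite /block_mx mx_size_col_mx !mx_size_row_mx. Qed.

Lemma cvg_mx_size p q {T : Type} {F : set_system T} {FF : Filter F}
    (f : T -> 'M[K]_(p, q)) (a : 'M[K]_(p, q)) : f @ F --> a ->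
  (fun t => mx_size (f t)) @ F --> mx_size a.
Proof.
move=> /cvg_mxP fa; rewrite /mx_size.
apply: cvg_big => [|i _]; first exact: add_continuous.
by apply: cvg_big => [|j _]; [exact: add_continuous|exact: cvg_abs].
Qed.

(** Leibniz expansion: the constant is p!, one unit per permutation. *)
Lemma absv_det_le p : exists C : R, forall x : 'M[K]_p,
  absv (\det x) <= C * mx_size x ^+ p.
Proof.
exists (\sum_(s : 'S_p) 1) => x; rewrite /determinant mulr_suml.
apply: le_trans (absv_sum _ _ _) _; apply: ler_sum => s _.
rewrite absvM absv_sign mul1r absv_prod mul1r.
rewrite (_ : mx_size x ^+ p = \prod_(i < p) mx_size x); last first.
  by rewrite prodr_const card_ord.
by apply: ler_prod => i _; rewrite absv_ge0 absv_le_size.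
Qed.

End Size.

Existing Class is_local_field.

(** Bernoulli's inequality in the form n (x - 1) <= x^n. *)
Lemma exp_unbounded (R : realType) (x M : R) : 1 < x -> exists n, M <= x ^+ n.
Proof.
move=> x1; have h n : n%:R * (x - 1) <= x ^+ n.
  elim: n => [|n IH]; first by rewrite mul0r.
  rewrite -natr1 mulrDl mul1r exprS.
  have : 1 <= x ^+ n by rewrite exprn_ege1// ltW.
  have : 0 <= (n%:R : R) by [].
  by nra.
have [M0|M0] := ltP M 0; first by exists 0; rewrite expr0; lra.
have d0 : 0 < x - 1 by lra.
exists (Num.bound (M / (x - 1))); apply: le_trans (h _).
by rewrite -ler_pdivrMr// ltW// archi_boundP// divr_ge0// ltW.
Qed.

(** * Compact disks, bounded sets of matrices, separability *)

Section Compactness.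
Context {R : realType} {K : absFieldType R}.

Lemma absv_cvg (x : K) : absv y @[y --> x] --> absv x.
Proof. exact: (@cvg_abs _ _ _ (nbhs x) _ id x cvg_id). Qed.

Lemma closed_absv_le (M : R) : closed [set x : K | absv x <= M].
Proof.
have : closed [set r : R | r <= M] by exact: closed_le.
move=> /closed_comp; apply => x _; exact: absv_cvg.
Qed.

Lemma mx_size_cvg p q (x : 'M[K]_(p, q)) : mx_size y @[y --> x] --> mx_size x.
Proof. exact: (@cvg_mx_size _ _ _ _ _ (nbhs x) _ id x cvg_id). Qed.

Lemma closed_mx_size_le p q (M : R) : closed [set x : 'M[K]_(p, q) | mx_size x <= M].
Proof.
have : closed [set r : R | r <= M] by exact: closed_le.
move=> /closed_comp; apply => x _; exact: mx_size_cvg.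
Qed.

Lemma compact_bounded_fun (T : topologicalType) (A : set T) (f : T -> R) :
  compact A -> (forall x, A x -> f y @[y --> x] --> f x) ->
  exists2 C, 0 < C & forall x, A x -> `|f x| <= C.
Proof.
move=> cA cf.
have /compact_bounded : compact (f @` A : set R^o).
  apply: (@continuous_compact _ R^o) => //.
  by apply: continuous_in_subspaceT => x /set_mem; exact: cf.
move=> [M [_ h]]; exists (`|M| + 1); first by rewrite ltr_wpDl.
by move=> x Ax; apply: (h (`|M| + 1)); [rewrite ltr_pwDr// ler_norm|exists x].
Qed.

Context {Klocal : is_local_field K}.

(** Local compactness at 0 provides one compact disk; multiplying it by a high power of an element
    of absolute value above 1 covers the disk of radius [M]. *)
Lemma compact_absv_le (M : R) : compact [set x : K | absv x <= M].
Proof.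
have [e e0 ce] : exists2 e : R, 0 < e & compact [set x : K | absv x <= e].
  have [B] := Klocal (I : [set: K] 0).
  rewrite /within/= => /nbhs_ballP[e /= e0 eU] [cB clB].
  exists (e / 2); first by rewrite divr_gt0.
  apply: subclosed_compact cB _; first exact: closed_absv_le.
  move=> x /= xe; apply: eU => //; rewrite /ball/= /absdist sub0r absvN.
  by rewrite (le_lt_trans xe)// ltr_pdivrMr// mulr2n mulrDr mulr1 ltrDl.
have [pi pi1] := exists_absv_gt1 (K := K).
have [n ne] : exists n, M / e <= absv (pi ^+ n).
  by have [n] := exp_unbounded (M / e) pi1; exists n; rewrite absvX.
have pn0 : pi ^+ n != 0.
  by rewrite expf_neq0// -absv_gt0 (lt_trans ltr01 pi1).
apply: (@subclosed_compact _ _ ((fun x => pi ^+ n * x) @` [set x : K | absv x <= e])).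
- exact: closed_absv_le.
- apply: continuous_compact => //; apply: continuous_in_subspaceT => x _.
  exact: (@cvg_absM _ _ _ (nbhs x) _ (cst _) id _ _ (cvg_cst _) cvg_id).
- move=> x /= xM; exists (x / pi ^+ n); last by rewrite mulrC divfK.
  rewrite absvM absvV ler_pdivrMr ?absv_gt0// (le_trans xM)//.
  by rewrite mulrC -ler_pdivrMr.
Qed.

(** Each disk of integer radius has a finite 1/(k+1)-net, and these nets are countably many.
    Separability is what makes open sets of matrices measurable and the unit disk non-null. *)
Lemma dense_sequence : exists D : nat -> K, forall x (e : R), 0 < e ->
  exists n, absv (x - D n) < e.
Proof.
have cov (M k : nat) : exists S : {fset K}, forall x : K, absv x <= M%:R ->
    exists2 y, y \in S & absv (x - y) < k.+1%:R^-1.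
  have : cover_compact [set x : K | absv x <= M%:R].
    by rewrite -compact_cover; exact: compact_absv_le.
  move=> /(_ K setT (fun y => (ball y (k.+1%:R^-1 : R))°)) [i _|x xM|S _ h].
  - exact: open_interior.
  - by exists x => //; exact: nbhsx_ballx.
  exists S => x /h[y /= yS /interior_subset] /= hb; exists y => //.
  by rewrite -absvN opprB.
pose S p := projT1 (cid (cov p.1 p.2)).
pose f (p : nat * nat * nat) := nth 0 (enum_fset (S p.1)) p.2.
(* The sequence runs through the codes of triples (radius, precision, position in the net); an
   integer that codes nothing gives 0. *)
exists (fun n => oapp f 0 (choice.unpickle n)) => x e e0.
have [k ke] : exists k, k.+1%:R^-1 < e by have [k _ /(_ k (leqnn k))] := near_infty_natSinv_lt (PosNum e0); exists k.
have [y yS xy] := projT2 (cid (cov (Num.bound (absv x)) k)) x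
   (ltW (archi_boundP (absv_ge0 x))).
exists (choice.pickle ((Num.bound (absv x), k), index y (enum_fset (S (Num.bound (absv x), k))))).
by rewrite choice.pickleK /= /f /= nth_index// (lt_trans xy).
Qed.

(** The set is closed and lies in the continuous image of a product of [p * q] disks, compact by
    Tychonoff. *)
Lemma compact_mx_size_le p q (M : R) :
  compact [set x : 'M[K]_(p, q) | mx_size x <= M].
Proof.
have : compact [set v : 'rV[K]_(p * q) | forall i, absv (v ord0 i) <= M].
  by apply: (@rV_compact _ _ (fun=> [set x : K | absv x <= M])) => _; exact: compact_absv_le.
pose g (v : 'rV[K]_(p * q)) : 'M[K]_(p, q) := \matrix_(i, j) v 0 (mxvec_index i j).
move=> cA; have cg : compact (g @` [set v : 'rV[K]_(p * q) | forall i, absv (v ord0 i) <= M]).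
  apply: continuous_compact cA; apply: continuous_in_subspaceT => v _.
  apply/(@cvg_mxP _ _ _ (nbhs v)) => i j; rewrite mxE.
  under eq_fun do rewrite mxE.
  exact: mx_entry_cvg.
apply: (subclosed_compact _ cg); first exact: closed_mx_size_le.
move=> x /= xM; exists (mxvec x).
  move=> k; case/mxvec_indexP: k => i j.
  by rewrite mxvecE; exact: le_trans (absv_le_size _ _ _) xM.
by apply/matrixP => i j; rewrite mxE mxvecE.
Qed.
End Compactness.

(** * Homomorphisms from the multiplicative group to the real numbers *)

Section LogHomomorphism.
Context {R : realType} {K : absFieldType R}.

(** The closed annulus meets every orbit of multiplication by powers of [pi]. Allowing [x^-1] in
    place of [x] avoids negative exponents. *)
Lemma absv_annulus (pi x : K) : 1 < absv pi -> x != 0 ->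
  exists y, [/\ y != 0, 1 <= absv y <= absv pi &
    exists n, x = y * pi ^+ n \/ x^-1 = y * pi ^+ n].
Proof.
move=> pi1; have p0 : pi != 0 by rewrite -absv_gt0 (lt_trans ltr01).
wlog x1 : x / 1 <= absv x => [wlg x0|x0].
  have [/wlg/(_ x0)//|x1] := leP 1 (absv x).
  have [||y [y0 yb [n hn]]] := wlg x^-1.
  - by rewrite absvV invf_ge1 ?absv_gt0// ltW.
  - by rewrite invr_eq0.
  by exists y; split => //; exists n; move: hn; rewrite invrK => -[|]; [right|left].
have ex : exists n, absv x < absv pi ^+ n.
  have [n hn] := exp_unbounded (absv x) pi1; exists n.+1.
  by apply: (le_lt_trans hn); rewrite exprS ltr_pMl// exprn_gt0// (lt_trans ltr01).
(* If [n.+1] is minimal with |x| < |pi|^(n+1), then |pi|^n <= |x|, so x / pi^n lies in the annulus;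
   minimality at 0 is excluded by 1 <= |x|. *)
case: (ex_minnP ex) => -[|n] hn mn; first by move: hn; rewrite expr0 ltNge x1.
have pn0 : pi ^+ n != 0 by rewrite expf_neq0.
exists (x / pi ^+ n); split.
- by rewrite mulf_neq0// invr_neq0.
- have pn : 0 < absv pi ^+ n by rewrite -absvX absv_gt0.
  rewrite absvM absvV absvX ler_pdivlMr// ler_pdivrMr// mul1r -exprS.
  by rewrite (ltW hn) andbT leNgt; apply/negP => /mn; rewrite ltnn.
- by exists n; left; rewrite divfK.
Qed.

(* A homomorphism killing pi and bounded on the annulus is bounded on K^*,
   hence trivial. *)
Lemma log_hom_absv (L : K -> R) (pi : K) (B : R) : 1 < absv pi ->
  (forall x y, x != 0 -> y != 0 -> L (x * y) = L x + L y) ->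
  (forall x, 1 <= absv x <= absv pi -> `|L x| <= B) ->
  forall x, x != 0 -> L x = L pi / ln (absv pi) * ln (absv x).
Proof.
move=> pi1 LM Lb; have p0 : pi != 0 by rewrite -absv_gt0 (lt_trans ltr01).
have lpi : 0 < ln (absv pi) by rewrite ln_gt0.
set c := L pi / ln (absv pi); pose d x := L x - c * ln (absv x).
have dM x y : x != 0 -> y != 0 -> d (x * y) = d x + d y.
  by move=> x0 y0; rewrite /d LM// absvM lnM ?posrE ?absv_gt0//; ring.
have dpi : d pi = 0 by rewrite /d /c divfK ?subrr// gt_eqF.
have d1 : d 1 = 0.
  have := dM 1 1 (oner_neq0 _) (oner_neq0 _); rewrite mulr1 => /eqP.
  by rewrite -subr_eq0 opprD addrA subrr sub0r oppr_eq0 => /eqP.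
have dX x n : x != 0 -> d (x ^+ n) = n%:R * d x.
  move=> x0; elim: n => [|n IH]; first by rewrite expr0 d1 mul0r.
  by rewrite exprS dM ?expf_neq0// IH -natr1; ring.
have dV x : x != 0 -> d x^-1 = - d x.
  move=> x0; apply/eqP; rewrite -addr_eq0 -dM ?invr_neq0// mulVf// d1//.
pose B' := B + `|c| * ln (absv pi).
have dB x : x != 0 -> `|d x| <= B'.
  move=> /(absv_annulus pi1)[y [y0 yb [n hn]]].
  have -> : `|d x| = `|d y|.
    case: hn => [->|hn]; first by rewrite dM ?expf_neq0// dX// dpi mulr0 addr0.
    rewrite -[x]invrK hn dV ?mulf_neq0 ?expf_neq0// normrN.
    by rewrite dM ?expf_neq0// dX// dpi mulr0 addr0.
  rewrite (le_trans (ler_normB _ _))// lerD ?Lb// normrM ler_wpM2l//.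
  case/andP: yb => y1 ypi.
  by rewrite ger0_norm ?ln_ge0// ler_ln// ?posrE absv_gt0.
move=> x x0; suff : d x = 0 by rewrite /d => /eqP; rewrite subr_eq0 => /eqP.
apply/eqP; rewrite -normr_le0 leNgt; apply/negP => dx.
have := dB (x ^+ (Num.bound (B' / `|d x|))) (expf_neq0 _ x0).
rewrite dX// normrM ger0_norm//.
have B'0 : 0 <= B' := le_trans (normr_ge0 _) (dB _ x0).
have := archi_boundP (divr_ge0 B'0 (normr_ge0 (d x))).
by rewrite ltr_pdivrMr// => /lt_le_trans h /h; rewrite ltxx.
Qed.

End LogHomomorphism.

Section ComplexModulus.
Context {R : realType}.
Local Open Scope complex_scope.

Lemma normcD_ge (x y : R[i]) :
  `|Normc.normc x - Normc.normc y| <= Normc.normc (x - y).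
Proof.
have D (a b : R[i]) : Normc.normc (a + b) <= Normc.normc a + Normc.normc b.
  exact: le_normcD.
rewrite ler_norml; have := D (x - y) y; rewrite subrK => h1.
have := D (y - x) x; rewrite subrK.
rewrite (_ : Normc.normc (y - x) = Normc.normc (x - y)) => [h2|].
  by apply/andP; split; lra.
by rewrite -[y - x]opprB; exact: (normcN (x - y)).
Qed.

Lemma normc_ge0 (x : R[i]) : 0 <= Normc.normc x.
Proof. by case: x => a b /=; exact: sqrtr_ge0. Qed.

Lemma Re_le_normc (x : R[i]) : `|complex.Re x| <= Normc.normc x.
Proof. by case: x => a b /=; rewrite -sqrtr_sqr ler_wsqrtr// lerDl sqr_ge0. Qed.

Lemma Im_le_normc (x : R[i]) : `|complex.Im x| <= Normc.normc x.
Proof. by case: x => a b /=; rewrite -sqrtr_sqr ler_wsqrtr// lerDr sqr_ge0. Qed.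

Section Filters.
Context {T : Type} {F : set_system T} {FF : Filter F}.
Implicit Types (f : T -> R[i]).

Lemma cvg_normcB f (a : R[i]) : (f : T -> R[i]^o) @ F --> (a : R[i]^o) ->
  forall e : R, 0 < e -> \forall t \near F, Normc.normc (a - f t) < e.
Proof.
move=> /cvgrPdist_lt h e e0; have e0' : (0 : R[i]) < e%:C by rewrite ltcR.
apply: filterS (h _ e0') => t; rewrite normc_def ltcR.
by move: (a - f t) => -[].
Qed.

Lemma cvg_normc f (a : R[i]) : (f : T -> R[i]^o) @ F --> (a : R[i]^o) ->
  Normc.normc (f t) @[t --> F] --> Normc.normc a.
Proof.
move=> /cvg_normcB h; apply/cvgrPdist_lt => e e0.
by apply: filterS (h _ e0) => t; exact/le_lt_trans/normcD_ge.
Qed.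

Lemma cvg_Re f (a : R[i]) : (f : T -> R[i]^o) @ F --> (a : R[i]^o) ->
  complex.Re (f t) @[t --> F] --> complex.Re a.
Proof.
move=> /cvg_normcB h; apply/cvgrPdist_lt => e e0.
apply: filterS (h _ e0) => t; apply/le_lt_trans.
by apply: le_trans (Re_le_normc _); move: a (f t) {h} => [? ?] [].
Qed.

Lemma cvg_Im f (a : R[i]) : (f : T -> R[i]^o) @ F --> (a : R[i]^o) ->
  complex.Im (f t) @[t --> F] --> complex.Im a.
Proof.
move=> /cvg_normcB h; apply/cvgrPdist_lt => e e0.
apply: filterS (h _ e0) => t; apply/le_lt_trans.
by apply: le_trans (Im_le_normc _); move: a (f t) {h} => [? ?] [].
Qed.
End Filters.
End ComplexModulus.

(** * The normalized absolute value and the exponent of a character *)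

Class local_haar (R : realType) (K : absFieldType R)
    (mu : {sigma_finite_measure set (borel K) -> \bar R}) (nabs : K -> R) :=
  LocalHaar {
    haar_local_field : is_local_field K ;
    haar_is_haar : is_haar mu ;
    haar_normalized : normalized_abs mu nabs }.
#[export] Existing Instance haar_local_field.

Section NormalizedAbs.
Context {R : realType} {K : absFieldType R}.
Context {mu : {sigma_finite_measure set (borel K) -> \bar R}} {nabs : K -> R}.
Context {L : local_haar mu nabs}.
Implicit Types x y : K.
Local Notation m := (measure_function_SigmaFiniteMeasure__to__measure_function_Measure mu).

Lemma open_borel (U : set K) : open U -> measurable (U : set (borel K)).
Proof. by move=> oU; exact: sub_sigma_algebra. Qed.

Lemma closed_borel (U : set K) : closed U -> measurable (U : set (borel K)).
Proof.
move=> cU; rewrite -[U]setCK; apply: (@measurableC _ (borel K)).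
by apply: open_borel; exact: closed_openC.
Qed.

Definition disk (r : R) : set (borel K) := [set x : K | absv x <= r].

Lemma measurable_disk r : measurable (disk r).
Proof. by apply: closed_borel; exact: closed_absv_le. Qed.

Lemma mu_disk_lty r : (m (disk r) < +oo)%E.
Proof.
have [_ h _] := @haar_is_haar _ _ _ _ L.
have c : compact [set x : K | absv x <= r] by exact: compact_absv_le.
exact (h _ c).
Qed.

Lemma mu_shift (a : K) (A : set (borel K)) : measurable A ->
  m [set a + x | x in A] = m A.
Proof. by have [h _ _] := @haar_is_haar _ _ _ _ L; exact: h. Qed.

(** Countably many translates of the unit disk, centred on a dense sequence, cover the field: if the
    disk were null, so would be the field. *)
Lemma mu_disk_gt0 : (0 < m (disk 1))%E.
Proof.
rewrite lt_neqAle measure_ge0 andbT eq_sym; apply/negP => /eqP m0.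
have [D hD] := @dense_sequence R K _.
have : (0 < m [set: K])%E by have [_ _ h] := @haar_is_haar _ _ _ _ L; exact h.
suff -> : m [set: K] = 0%E by rewrite ltxx.
apply/negligibleP; first exact: measurableT.
have -> : [set: K] = \bigcup_n [set D n + x | x in disk 1].
  apply/seteqP; split => // x _; have [n hn] := hD x 1 ltr01.
  by exists n => //; exists (x - D n); [exact: ltW|rewrite addrC subrK].
apply: negligible_bigcup => n.
suff mD : measurable ([set D n + x | x in disk 1] : set (borel K)).
  by apply/negligibleP => //; exact (eq_trans (mu_shift _ (measurable_disk 1)) m0).
rewrite (_ : [set D n + x | x in disk 1] = [set x : K | absv (x - D n) <= 1]).
  apply: closed_borel.
  have : closed [set r : R | r <= 1] by exact: closed_le.
  move=> /closed_comp; apply => x _.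
  apply: (@cvg_abs _ _ _ (nbhs x)).
  exact: (@cvg_absD _ _ _ (nbhs x) _ id (cst (- D n)) _ _ cvg_id (cvg_cst _)).
apply/seteqP; split => [_ [x h <-]|x h]; first by rewrite /= addrAC subrr add0r.
by exists (x - D n) => //; rewrite addrC subrK.
Qed.

Definition disk_volume : R := fine (m (disk 1)).

Lemma disk_volumeE : m (disk 1) = disk_volume%:E.
Proof. by rewrite fineK// ge0_fin_numE ?mu_disk_lty. Qed.

Lemma disk_volume_gt0 : 0 < disk_volume.
Proof. by rewrite -lte_fin -disk_volumeE mu_disk_gt0. Qed.

Lemma nabs0 : nabs 0 = 0.
Proof. by have [] := @haar_normalized _ _ _ _ L. Qed.

(** The disk of radius |a| is [a] times the unit disk. This converts comparisons of [absv], which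
    are inclusions of disks, into comparisons of [nabs]. *)
Lemma nabs_disk a : a != 0 -> m (disk (absv a)) = (nabs a * disk_volume)%:E.
Proof.
move=> a0; have [_ h] := @haar_normalized _ _ _ _ L.
rewrite EFinM -disk_volumeE -h//; last exact: measurable_disk.
congr (m _); apply/seteqP; split => [x xa|_ [x x1 <-]].
  exists (x / a); last by rewrite mulrC divfK.
  by rewrite /disk/= absvM absvV ler_pdivrMr ?absv_gt0// mul1r.
by rewrite /disk/= absvM ler_piMr ?absv_ge0.
Qed.

Lemma nabs_ge0 a : 0 <= nabs a.
Proof.
have [->|a0] := eqVneq a 0; first by rewrite nabs0.
by rewrite -(pmulr_lge0 _ disk_volume_gt0) -lee_fin -nabs_disk.
Qed.

Lemma nabs_mono x y : x != 0 -> absv x <= absv y -> nabs x <= nabs y.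
Proof.
move=> x0 xy; have y0 : y != 0 by rewrite -absv_gt0 (lt_le_trans _ xy)// absv_gt0.
rewrite -(ler_pM2r disk_volume_gt0) -lee_fin -!nabs_disk//.
by apply: le_measure; rewrite ?inE; [exact: measurable_disk..|
  rewrite /disk => z /= h; exact: le_trans h xy].
Qed.

Lemma nabs1 : nabs 1 = 1.
Proof.
have := nabs_disk (oner_neq0 _); rewrite absv1 disk_volumeE => -[] /esym/eqP.
by rewrite -subr_eq0 -{2}[disk_volume]mul1r -mulrBl mulf_eq0 subr_eq0
  (gt_eqF disk_volume_gt0) orbF => /eqP.
Qed.

Lemma nabsM x y : nabs (x * y) = nabs x * nabs y.
Proof.
have [->|x0] := eqVneq x 0; first by rewrite mul0r nabs0 mul0r.
have [->|y0] := eqVneq y 0; first by rewrite mulr0 nabs0 mulr0.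
apply: (mulIf (lt0r_neq0 disk_volume_gt0)).
apply: EFin_inj; rewrite -nabs_disk ?mulf_neq0// -mulrA EFinM -nabs_disk//.
have [_ h] := @haar_normalized _ _ _ _ L.
rewrite -h//; last exact: measurable_disk.
congr (m _); apply/seteqP; split => [z zxy|_ [z z1 <-]].
  exists (z / x); last by rewrite mulrC divfK.
  by rewrite /disk/= absvM absvV ler_pdivrMr ?absv_gt0// -absvM mulrC.
by rewrite /disk/= !absvM ler_pM2l ?absv_gt0.
Qed.

Lemma nabs_gt0 x : x != 0 -> 0 < nabs x.
Proof.
move=> x0; rewrite lt_neqAle nabs_ge0 andbT eq_sym; apply/eqP => nx.
by have := nabs1; rewrite -(divff x0) nabsM nx mul0r => /eqP; rewrite eq_sym oner_eq0.
Qed.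

Lemma nabsX x n : nabs (x ^+ n) = nabs x ^+ n.
Proof. by elim: n => [|n IH]; rewrite ?expr0 ?nabs1// !exprS nabsM IH. Qed.

(** Otherwise all disks of radius |x^n| would have at most the volume of the unit disk, whereas a
    large one contains two disjoint translates of it. *)
Lemma nabs_gt1 x : 1 < absv x -> 1 < nabs x.
Proof.
move=> x1; have x0 : x != 0 by rewrite -absv_gt0 (lt_trans ltr01).
have xX n : x ^+ n != 0 by rewrite expf_neq0.
rewrite ltNge; apply/negP => nx.
(* |y| >= 3 makes the unit disks around 0 and [y] disjoint; radius |x^n| >= |y| + 1 then contains
   both. *)
have [q hq] := exp_unbounded 3 x1; set y := x ^+ q.
have [n hn] := exp_unbounded (absv y + 1) x1.
have nX k : nabs (x ^+ k) <= 1 by rewrite nabsX exprn_ile1// nabs_ge0.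
have : (m (disk (absv (x ^+ n)%R)) <= m (disk 1))%E.
  by rewrite nabs_disk// disk_volumeE lee_fin ler_piMl// ltW// disk_volume_gt0.
apply/negP; rewrite -ltNge.
pose yD : set (borel K) := [set z : K | absv (z - y) <= 1].
have yDE : yD = [set y + z | z in disk 1].
  apply/seteqP; split => [z h|_ [z h <-]].
    by exists (z - y) => //; rewrite addrC subrK.
  by rewrite /yD/= addrAC subrr add0r.
have myD : measurable yD.
  apply: closed_borel.
  have : closed [set r : R | r <= 1] by exact: closed_le.
  move=> /closed_comp; apply => z _.
  apply: (@cvg_abs _ _ _ (nbhs z)).
  exact: (@cvg_absD _ _ _ (nbhs z) _ id (cst (- y)) _ _ cvg_id (cvg_cst _)).
have mD := measurable_disk 1.
have : (m (disk 1 `|` yD) <= m (disk (absv (x ^+ n)%R)))%E.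
  apply: le_measure; rewrite ?inE; [exact: measurableU|exact: measurable_disk|].
  move=> z [] /=; rewrite /disk/yD/= => h; rewrite absvX (le_trans _ hn)//.
    by rewrite (le_trans h)// lerDr absv_ge0.
  by rewrite -[z](subrK y) (le_trans (absvD _ _))// addrC lerD2l.
apply: lt_le_trans; rewrite measureU//.
  rewrite [X in (_ + X)%E](_ : _ = disk_volume%:E); last first.
    by rewrite yDE; exact (eq_trans (mu_shift _ mD) disk_volumeE).
  rewrite [X in (X + _)%E](_ : _ = disk_volume%:E); last exact disk_volumeE.
  rewrite disk_volumeE -EFinD lte_fin ltrDl.
  exact: disk_volume_gt0.
apply/seteqP; split => // z [] /=; rewrite /disk/yD/= => h1 h2.
have := absvD (y - z) z; rewrite subrK.
have : absv (z - y) = absv (y - z) by rewrite -absvN opprB.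
have : absv y = absv x ^+ q by rewrite absvX.
by lra.
Qed.

(** The power of [absv] that equals [nabs], read off at one arbitrarily chosen element; [nabsE]
    shows that it is right everywhere. *)
Definition nabs_exponent : R :=
  let pi := projT1 (cid (exists_absv_gt1 (K := K))) in
  ln (nabs pi) / ln (absv pi).

Lemma nabs_exponent_gt0 : 0 < nabs_exponent.
Proof.
rewrite /nabs_exponent; case: cid => pi /= pi1.
by rewrite divr_gt0// ln_gt0// nabs_gt1.
Qed.

(** The logarithm of [nabs] is a homomorphism, bounded on an annulus by monotonicity, hence a
    multiple of the logarithm of [absv]. *)
Lemma nabsE x : nabs x = absv x `^ nabs_exponent.
Proof.
have c0 := nabs_exponent_gt0.
have [->|x0] := eqVneq x 0; first by rewrite nabs0 absv0 powR0// gt_eqF.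
rewrite /nabs_exponent; case: cid => pi /= pi1.
have p0 : pi != 0 by rewrite -absv_gt0 (lt_trans ltr01).
rewrite /powR absv_eq0 (negbTE x0).
rewrite -(@log_hom_absv _ _ (fun z => ln (nabs z)) pi (ln (nabs pi))) => //.
- by rewrite lnK// posrE nabs_gt0.
- by move=> y z y0 z0; rewrite nabsM lnM// posrE nabs_gt0.
- move=> y /andP[y1 ypi]; have y0 : y != 0 by rewrite -absv_gt0 (lt_le_trans ltr01).
  have n1 : 1 <= nabs y by rewrite -nabs1 nabs_mono ?oner_neq0// absv1.
  by rewrite ger0_norm ?ln_ge0// ler_ln ?posrE ?nabs_gt0// nabs_mono.
Qed.

Lemma exponentP (w : quasi_character K) a : a != 0 ->
  Normc.normc (w a) = nabs a `^ exponent nabs w.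
Proof.
move=> a0; suff : [set r : R | forall a, a != 0 ->
    Normc.normc (w a) = nabs a `^ r] (exponent nabs w) by exact.
(* [exponent] is a chosen value, so the work is to exhibit one exponent: ln |w| is a homomorphism,
   bounded on the compact annulus by continuity. *)
apply: getPex; have [pi pi1] := exists_absv_gt1 (K := K).
have p0 : pi != 0 by rewrite -absv_gt0 (lt_trans ltr01).
have wgt0 z : z != 0 -> 0 < Normc.normc (w z).
  move=> z0; rewrite lt_neqAle normc_ge0 andbT eq_sym; apply/eqP => /Normc.eq0_normc.
  by apply/eqP/qchar_neq0.
have wM y z : y != 0 -> z != 0 ->
    ln (Normc.normc (w (y * z))) = ln (Normc.normc (w y)) + ln (Normc.normc (w z)).
  by move=> y0 z0; rewrite qcharM// Normc.normcM lnM ?posrE ?wgt0.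
have [B _ hB] : exists2 B, 0 < B & forall x : K, 1 <= absv x <= absv pi ->
    `|ln (Normc.normc (w x))| <= B.
  have cpi : compact [set x : K | absv x <= absv pi] by exact: compact_absv_le.
  have clA : closed [set x : K | 1 <= absv x <= absv pi].
    rewrite (_ : mkset _ = [set x : K | 1 <= absv x] `&` [set x : K | absv x <= absv pi]); last first.
      by apply/seteqP; split => x /= /andP.
    apply: closedI; last exact: closed_absv_le.
    have : closed [set r : R | 1 <= r] by exact: closed_ge.
    by move=> /closed_comp; apply => x _; exact: absv_cvg.
  have cA : compact [set x : K | 1 <= absv x <= absv pi].
    by apply: (subclosed_compact clA cpi) => x /= /andP[].
  apply: (compact_bounded_fun cA).
  move=> x /= /andP[x1 _]; have x0 : x != 0 by rewrite -absv_gt0 (lt_le_trans ltr01).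
  apply: (@cvg_comp _ _ _ (fun x => Normc.normc (w x)) (@ln R) _ (nbhs (Normc.normc (w x)))).
    apply: (@cvg_normc _ _ (nbhs x)); exact: qchar_continuous.
  exact/continuous_ln/wgt0.
have h := log_hom_absv pi1 wM hB.
exists (ln (Normc.normc (w pi)) / ln (nabs pi)) => z z0.
have lnabs : 0 < ln (nabs pi) by rewrite ln_gt0// nabs_gt1.
rewrite /powR (gt_eqF (nabs_gt0 z0)) -[LHS]lnK ?posrE ?wgt0//; congr expR.
rewrite (h z z0) !nabsE !ln_powR; have c0 := nabs_exponent_gt0.
have lpi : ln (absv pi) != 0 by rewrite gt_eqF// ln_gt0.
by field; rewrite lpi gt_eqF.
Qed.

End NormalizedAbs.

(** * Measurability and Lebesgue measure on matrices *)

Section MatrixSigmaAlgebra.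
Context {R : realType} {K : absFieldType R}.

Definition mxt p q (t : (p * q).-tuple K) : 'M[K]_(p, q) :=
  \matrix_(i, j) tnth t (mxvec_index i j).

(** A copy of the matrix type that carries the sigma-algebra of tuples of Borel entries, while the
    original type keeps its topology. *)
Definition mxb p q : Type := 'M[K]_(p, q).

HB.instance Definition _ p q := Pointed.on (mxb p q).

Definition mxb_measurable p q : set (set (mxb p q)) :=
  [set A | measurable ((@mxt p q) @^-1` A : set ((p * q).-tuple (borel K)))].

Lemma mxb_measurable0 p q : @mxb_measurable p q set0.
Proof. by rewrite /mxb_measurable/= preimage_set0; exact: measurable0. Qed.

Lemma mxb_measurableC p q A : @mxb_measurable p q A -> @mxb_measurable p q (~` A).
Proof. by rewrite /mxb_measurable/= => mA; rewrite preimage_setC; exact: measurableC. Qed.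

Lemma mxb_measurable_bigcup p q (F : (set (mxb p q))^nat) :
  (forall i, mxb_measurable (F i)) -> mxb_measurable (\bigcup_i F i).
Proof.
rewrite /mxb_measurable/= => mF; rewrite preimage_bigcup.
exact: bigcupT_measurable.
Qed.

HB.instance Definition _ p q := @isMeasurable.Build
  (measure_tuple_display (sigma_display (@open K))) (mxb p q) (@mxb_measurable p q)
  (@mxb_measurable0 p q) (@mxb_measurableC p q) (@mxb_measurable_bigcup p q).

Lemma measurable_mxt p q :
  measurable_fun [set: (p * q).-tuple (borel K)] (@mxt p q : _ -> mxb p q).
Proof. by move=> _ A mA; rewrite setTI. Qed.

Lemma measurable_mxbP d (X : measurableType d) p q (f : X -> mxb p q) :
  measurable_fun setT f <->
  forall i j, measurable_fun setT (fun x => f x i j : borel K).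
Proof.
split=> [mf i j|mf].
  have me : measurable_fun [set: mxb p q] (fun x => x i j : borel K).
    move=> _ A mA; rewrite setTI.
    have := @measurable_tnth _ (borel K) (p * q) (mxvec_index i j) measurableT A mA.
    rewrite setTI => h; rewrite /measurable/= /mxb_measurable/=.
    rewrite (_ : _ @^-1` _ = (@tnth _ (borel K))^~ (mxvec_index i j) @^-1` A)//.
    by apply/funext => t; rewrite /preimage/= mxE.
  exact: (measurableT_comp me mf).
pose h x : (p * q).-tuple (borel K) := [tuple mxvec (f x) 0 k | k < p * q].
have mh : measurable_fun setT h.
  apply/measurable_fun_tnthP => k; case/mxvec_indexP: k => i j.
  apply: eq_measurable_fun (mf i j) => x _.
  by rewrite /h /= tnth_mktuple mxvecE.
move=> _ A mA; have := mh measurableT _ mA; rewrite !setTI.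
rewrite (_ : h @^-1` _ = f @^-1` A)//; apply/funext => x; rewrite /preimage/=.
by congr A; apply/matrixP => i j; rewrite mxE tnth_mktuple mxvecE.
Qed.

Lemma measurable_entry p q i j :
  measurable_fun [set: mxb p q] (fun x => x i j : borel K).
Proof. by have /measurable_mxbP := @measurable_id _ (mxb p q) setT; apply. Qed.

Lemma open_absv_lt (a : K) (e : R) : open [set x : K | absv (x - a) < e].
Proof.
have : open [set r : R | r < e] by exact: open_lt.
move=> /open_comp; apply => x _; apply: (@cvg_abs _ _ _ (nbhs x)).
exact: (@cvg_absD _ _ _ (nbhs x) _ id (cst (- a)) _ _ cvg_id (cvg_cst _)).
Qed.

Context {Klocal : is_local_field K}.

(** An open set is the union of the boxes it contains whose centres lie in a dense sequence and
    whose radii are of the form 1/(k+1); there are countably many of them. *)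
Lemma measurable_open_mxb p q (W : set 'M[K]_(p, q)) :
  open W -> measurable (W : set (mxb p q)).
Proof.
move=> oW; have [D hD] := @dense_sequence R K _.
pose box (dk : 'M[nat]_(p, q) * nat) : set (mxb p q) :=
  [set x : 'M[K]_(p, q) | forall i j, absv (x i j - D (dk.1 i j)) < dk.2.+1%:R^-1].
have mbox dk : measurable (box dk).
  rewrite (_ : box dk = \bigcap_(ij in [set: 'I_p * 'I_q])
      [set x : mxb p q | absv (x ij.1 ij.2 - D (dk.1 ij.1 ij.2)) < dk.2.+1%:R^-1]).
    apply: fin_bigcap_measurable => // -[i j] _ /=.
    have oB := @open_absv_lt (D (dk.1 i j)) dk.2.+1%:R^-1.
    have mB : measurable ([set x : K | absv (x - D (dk.1 i j)) < dk.2.+1%:R^-1] : set (borel K)).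
      exact: sub_sigma_algebra.
    by have := @measurable_entry p q i j measurableT _ mB; rewrite setTI.
  by apply/seteqP; split => [x h [i j] _|x h i j]; [exact: h|exact: (h (i, j))].
rewrite (_ : W = \bigcup_dk if `[< box dk `<=` W >] then box dk else set0).
  apply: countable_bigcupT_measurable; first exact: countableP.
  by move=> dk; case: ifP => // _; exact: mbox.
apply/seteqP; split => [x Wx|x [dk _]]; last first.
  by case: ifPn => // /asboolP; exact.
have [P xP PW] : nbhs x W by exact: open_nbhs_nbhs.
(* Twice the radius is reserved because [x] is not the centre: two points of a box are within
   2/(k+1) of each other in each entry. *)
have [k hk] : exists k : nat, forall ij, ball (x ij.1 ij.2) (k.+1%:R^-1 + k.+1%:R^-1) `<=` P ij.1 ij.2.
  have : \forall k \near \oo, forall ij, ball (x ij.1 ij.2) (k.+1%:R^-1 + k.+1%:R^-1 : R) `<=` P ij.1 ij.2.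
    apply: filter_forall => -[i j] /=; have /nbhs_ballP[e /= e0 eP] := xP i j.
    have e20 : 0 < e / 2 by rewrite divr_gt0.
    apply: filterS (near_infty_natSinv_lt (PosNum e20)) => k /= hk.
    by apply: subset_trans eP; apply: le_ball; rewrite (splitr e) lerD// ltW.
  by move=> [k _ /(_ k (leqnn k))]; exists k.
have ex ij : exists n, absv (x ij.1 ij.2 - D n) < k.+1%:R^-1 by apply: hD.
pose d : 'M[nat]_(p, q) := \matrix_(i, j) projT1 (cid (ex (i, j))).
have hd i j : absv (x i j - D (d i j)) < k.+1%:R^-1.
  by rewrite mxE; case: cid.
exists (d, k) => //; case: asboolP => [_|[]]; first by move=> i j; exact: hd.
move=> y by_; apply: PW => i j; apply: (hk (i, j)).
rewrite /ball/= /absdist -(subrKA (D (d i j))) (le_lt_trans (absvD _ _))// ltrD//.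
by rewrite -absvN opprB; exact: by_.
Qed.
End MatrixSigmaAlgebra.

Section MeasurableOperations.
Context {R : realType} {K : absFieldType R} {Klocal : is_local_field K}.

Lemma measurable_fun_borel d (X : measurableType d) (D : set X) (f : X -> borel K) :
  (forall U : set K, open U -> measurable (D `&` f @^-1` U)) -> measurable_fun D f.
Proof.
move=> h; apply: (@measurability _ _ X (borel K) D f (@open K)) => //.
by move=> _ [U oU <-]; exact: h.
Qed.

Lemma measurable_fun_gt d (X : measurableType d) (D : set X) (f : X -> R) :
  (forall r, measurable (D `&` [set x | r < f x])) -> measurable_fun D f.
Proof.
move=> h; apply: (measurability _ (RGenOInfty.measurableE R)) => //.
move=> _ [_ [r ->] <-]; rewrite (_ : _ `&` _ = D `&` [set x | r < f x])//.
by apply/seteqP; split => x [Dx] /=; rewrite in_itv/= andbT.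
Qed.

Lemma measurable_mx_continuous p q (g : 'M[K]_(p, q) -> K) :
  (forall x, g y @[y --> x] --> g x) ->
  measurable_fun [set: mxb p q] (g : mxb p q -> borel K).
Proof.
move=> cg; apply: measurable_fun_borel => U oU; rewrite setTI.
by apply: measurable_open_mxb; apply: open_comp => // x _; exact: cg.
Qed.

Lemma measurable_GL p : measurable (@GL R K p : set (mxb p p)).
Proof. by apply: measurable_open_mxb; exact: open_GL. Qed.

Lemma measurable_GL_continuous p (g : 'M[K]_p -> R) :
  (forall x, GL x -> g y @[y --> x] --> g x) ->
  measurable_fun (@GL R K p : set (mxb p p)) (g : mxb p p -> R).
Proof.
move=> cg; apply: measurable_fun_gt => r; apply: measurable_open_mxb.
rewrite openE => x [xG rx]; apply: filterI.
  by apply: open_nbhs_nbhs; split; [exact: open_GL|exact: xG].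
apply: (cg x xG [set z | r < z]); apply: open_nbhs_nbhs; split => //.
Qed.

Section Pointwise.
Context d (X : measurableType d).
Implicit Types (f g : X -> borel K).

(** The two arguments are packed into a 1 x 2 matrix, where open sets are already known to be
    measurable for the product sigma-algebra. *)
Lemma measurable_abs_pair (h : K * K -> K) f g :
  (forall a b : K, h y @[y --> (a, b)] --> h (a, b)) ->
  measurable_fun setT f -> measurable_fun setT g ->
  measurable_fun setT (fun x => h (f x, g x) : borel K).
Proof.
move=> ch mf mg.
pose m x : mxb 1 2 := \matrix_(i < 1, j < 2) if j == 0 then f x else g x.
have mm : measurable_fun setT m.
  apply/measurable_mxbP => i j; under eq_fun do rewrite mxE.
  by case: (j == 0).
pose e (x : 'M[K]_(1, 2)) := h (x 0 0, x 0 1).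
have me : measurable_fun [set: mxb 1 2] (e : _ -> borel K).
  apply: measurable_mx_continuous => x.
  apply: (@cvg_comp _ _ _ (fun y : 'M[K]_(1, 2) => (y 0 0, y 0 1)) h _ (nbhs (x 0 0, x 0 1))).
    exact: (cvg_pair (@mx_entry_cvg _ _ _ _ x 0 0) (@mx_entry_cvg _ _ _ _ x 0 1)).
  exact: ch.
apply: eq_measurable_fun (measurableT_comp me mm) => x _.
by rewrite /e /m /= !mxE.
Qed.

Lemma measurable_absD f g : measurable_fun setT f -> measurable_fun setT g ->
  measurable_fun setT (fun x => (f x : K) + g x : borel K).
Proof.
apply: (@measurable_abs_pair (fun y => y.1 + y.2)) => a b.
by apply: (@cvg_absD _ _ _ (nbhs (a, b))); [exact: cvg_fst|exact: cvg_snd].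
Qed.

Lemma measurable_absM f g : measurable_fun setT f -> measurable_fun setT g ->
  measurable_fun setT (fun x => (f x : K) * g x : borel K).
Proof.
apply: (@measurable_abs_pair (fun y => y.1 * y.2)) => a b.
by apply: (@cvg_absM _ _ _ (nbhs (a, b))); [exact: cvg_fst|exact: cvg_snd].
Qed.

Lemma measurable_absV f : measurable_fun setT f ->
  measurable_fun setT (fun x => (f x : K)^-1 : borel K).
Proof.
move=> mf; suff mV : measurable_fun setT (fun x : borel K => (x : K)^-1 : borel K).
  exact: (measurableT_comp mV mf).
apply: measurable_fun_borel => U oU; rewrite setTI.
(* Inversion is continuous only away from 0; the point 0, where the inverse is 0 by convention, is
   treated apart. *)
rewrite (_ : _ @^-1` U = [set x : K | x != 0 /\ U x^-1] `|` [set x : K | x = 0 /\ U 0]).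
  apply: (@measurableU _ (borel K)).
    apply: open_borel; rewrite openE => x [x0 Ux]; apply: filterI.
      have : absv y @[y --> x] --> absv x by exact: absv_cvg.
      move=> /cvgrPdist_lt /(_ (absv x)); rewrite absv_gt0 => /(_ x0).
      apply: filterS => y; apply: contraPneq => ->.
      by rewrite absv0 subr0 ger0_norm ?absv_ge0// ltxx.
    have := @cvg_absV _ _ _ (nbhs x) _ id x x0 cvg_id.
    by apply; exact: open_nbhs_nbhs.
  have [U0|U0] := pselect (U 0).
    rewrite (_ : mkset _ = [set x : K | absv x <= 0]); last first.
      apply/seteqP; split => x /=; first by move=> [-> _]; rewrite absv0.
      by move=> h; split => //; apply/eqP; rewrite -absv_eq0 eq_le h absv_ge0.
    by apply: closed_borel; exact: closed_absv_le.
  by rewrite (_ : mkset _ = set0)//; apply/seteqP; split => // x [].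
apply/seteqP; split => [x Ux|x [[]//|[-> U0]]]; last by rewrite /= invr0.
have [x0|x0] := eqVneq (x : K) 0; last by left.
by right; split => //; move: Ux; rewrite /preimage/= x0 invr0.
Qed.

Lemma measurable_absN f : measurable_fun setT f ->
  measurable_fun setT (fun x => - (f x : K) : borel K).
Proof.
move=> mf; have mN := measurable_absM (@measurable_cst _ _ X (borel K) setT (-1 : K)) mf.
by apply: eq_measurable_fun mN => x _; rewrite mulN1r.
Qed.

Lemma measurable_abs_sum I (r : seq I) (P : pred I) (h : I -> X -> borel K) :
  (forall i, measurable_fun setT (h i)) ->
  measurable_fun setT (fun x => \sum_(i <- r | P i) (h i x : K) : borel K).
Proof.
move=> mh; elim: r => [|i r IH].
  by under eq_fun do rewrite big_nil; exact: measurable_cst.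
under eq_fun do rewrite big_cons.
by case: (P i) => //; apply: measurable_absD.
Qed.

Lemma measurable_abs_prod I (r : seq I) (P : pred I) (h : I -> X -> borel K) :
  (forall i, measurable_fun setT (h i)) ->
  measurable_fun setT (fun x => \prod_(i <- r | P i) (h i x : K) : borel K).
Proof.
move=> mh; elim: r => [|i r IH].
  by under eq_fun do rewrite big_nil; exact: measurable_cst.
under eq_fun do rewrite big_cons.
by case: (P i) => //; apply: measurable_absM.
Qed.

Lemma measurable_absv f : measurable_fun setT f ->
  measurable_fun setT (fun x => absv (f x : K)).
Proof.
move=> mf; suff mA : measurable_fun [set: borel K] (fun x : borel K => absv (x : K)).
  exact: (measurableT_comp mA mf).
apply: measurable_fun_gt => r; rewrite setTI; apply: open_borel.
have : open [set y : R | r < y] by exact: open_gt.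
by move=> /open_comp; apply => x _; exact: absv_cvg.
Qed.

Lemma measurable_entries p q (f : X -> mxb p q) i j : measurable_fun setT f ->
  measurable_fun setT (fun x => f x i j : borel K).
Proof. by move/measurable_mxbP; apply. Qed.

Lemma measurable_mulmx p q r (f : X -> mxb p q) (g : X -> mxb q r) :
  measurable_fun setT f -> measurable_fun setT g ->
  measurable_fun setT (fun x => (f x : 'M[K]_(p, q)) *m (g x : 'M[K]_(q, r)) : mxb p r).
Proof.
move=> mf mg; apply/measurable_mxbP => i j; under eq_fun do rewrite mxE.
apply: measurable_abs_sum => k.
by apply: measurable_absM; exact: measurable_entries.
Qed.

Lemma measurable_addmx p q (f g : X -> mxb p q) :
  measurable_fun setT f -> measurable_fun setT g ->
  measurable_fun setT (fun x => (f x : 'M[K]_(p, q)) + (g x : 'M[K]_(p, q)) : mxb p q).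
Proof.
move=> mf mg; apply/measurable_mxbP => i j; under eq_fun do rewrite mxE.
by apply: measurable_absD; exact: measurable_entries.
Qed.

Lemma measurable_det p (f : X -> mxb p p) : measurable_fun setT f ->
  measurable_fun setT (fun x => \det (f x : 'M[K]_p) : borel K).
Proof.
move=> mf; apply: measurable_abs_sum => s; apply: measurable_absM.
  exact: measurable_cst.
by apply: measurable_abs_prod => i; exact: measurable_entries.
Qed.

Lemma measurable_trmx p q (f : X -> mxb p q) : measurable_fun setT f ->
  measurable_fun setT (fun x => (f x : 'M[K]_(p, q))^T : mxb q p).
Proof.
move=> mf; apply/measurable_mxbP => i j; under eq_fun do rewrite mxE.
exact: measurable_entries.
Qed.

Lemma measurable_mxsub p q r s (u : 'I_r -> 'I_p) (v : 'I_s -> 'I_q) (f : X -> mxb p q) :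
  measurable_fun setT f ->
  measurable_fun setT (fun x => mxsub u v (f x : 'M[K]_(p, q)) : mxb r s).
Proof.
move=> mf; apply/measurable_mxbP => i j; under eq_fun do rewrite mxE.
exact: measurable_entries.
Qed.

Lemma measurable_invmx p (f : X -> mxb p p) : measurable_fun setT f ->
  measurable_fun setT (fun x => invmx (f x : 'M[K]_p) : mxb p p).
Proof.
move=> mf.
have mD : measurable (f @^-1` (@GL R K p : set (mxb p p))).
  by rewrite -[X in measurable X]setTI; apply: mf => //; exact: measurable_GL.
apply/measurable_mxbP => i j.
pose h x : borel K := (\det (f x : 'M[K]_p))^-1 * cofactor (f x) j i.
(* Cramer's formula on invertible matrices; on singular ones [invmx] returns its argument. *)
rewrite (_ : (fun x => _) = (fun x => if f x \in unitmx then h x else f x i j)).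
  apply: measurable_fun_if => //.
  - apply: (@measurable_fun_bool _ _ _ _ true); rewrite setTI; exact: mD.
  - apply: measurable_funTS; apply: measurable_absM.
      by apply: measurable_absV; exact: measurable_det.
    apply: measurable_absM; first exact: measurable_cst.
    apply: (@measurable_det _ (fun x => row' j (col' i (f x : 'M[K]_p)))).
    apply/measurable_mxbP => k l; under eq_fun do rewrite !mxE.
    exact: measurable_entries.
  - by apply: measurable_funTS; exact: measurable_entries.
apply/funext => x; rewrite /h /invmx; case: ifP => // _.
by rewrite !mxE.
Qed.

Lemma measurable_mx_size p q (f : X -> mxb p q) : measurable_fun setT f ->
  measurable_fun setT (fun x => mx_size (f x : 'M[K]_(p, q))).
Proof.
move=> mf; rewrite /mx_size; apply: measurable_sum => i.
by apply: measurable_sum => j; apply: measurable_absv; exact: measurable_entries.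
Qed.

End Pointwise.
End MeasurableOperations.

Section MeasurableNabs.
Context {R : realType} {K : absFieldType R}.
Context {mu : {sigma_finite_measure set (borel K) -> \bar R}} {nabs : K -> R}.
Context {L : local_haar mu nabs}.

Lemma measurable_nabs d (X : measurableType d) (f : X -> borel K) :
  measurable_fun setT f -> measurable_fun setT (fun x => nabs (f x)).
Proof.
move=> mf.
have h := measurableT_comp (measurable_powR (@nabs_exponent R K nabs)) (measurable_absv mf).
by apply: eq_measurable_fun h => x _; rewrite nabsE.
Qed.
End MeasurableNabs.

Lemma ge0_integralT_pushforward d1 d2 (X : measurableType d1) (Y : measurableType d2)
    (R : realType) (phi : X -> Y) (mphi : measurable_fun setT phi)
    (mu : {measure set X -> \bar R}) (f : Y -> \bar R) :
  measurable_fun setT f -> (forall y, 0 <= f y)%E ->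
  (\int[pushforward mu phi]_y f y = \int[mu]_x f (phi x))%E.
Proof.
by move=> mf f0; rewrite (ge0_integral_pushforward mphi)// preimage_setT.
Qed.

Section MatrixMeasure.
Context {R : realType} {K : absFieldType R}.
Variable mu : {sigma_finite_measure set (borel K) -> \bar R}.
Local Open Scope ereal_scope.

(** Additive Haar measure on matrices, the product of copies of [mu] over the entries. *)
Definition lam p q : set (mxb p q) -> \bar R :=
  pushforward (power_measure mu (p * q))
    (@mxt R K p q : (p * q).-tuple (borel K) -> mxb p q).

Let pushforward_lam p q : {measure set (mxb (K := K) p q) -> \bar R} :=
  measure_function_pushforward__canonical__measure_function_Measure
    (power_measure mu (p * q)) (@measurable_mxt R K p q).

HB.instance Definition _ p q := isMeasure.Build _ _ _ (@lam p q)
  (measure0 (pushforward_lam p q)) (measure_ge0 (pushforward_lam p q))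
  (@measure_semi_sigma_additive _ _ _ (pushforward_lam p q)).

Lemma mxtK p q (t : (p * q).-tuple K) : [tuple mxvec (mxt t) 0%R k | k < p * q] = t.
Proof.
apply: eq_from_tnth => k; rewrite tnth_mktuple.
by case/mxvec_indexP: k => i j; rewrite mxvecE mxE.
Qed.

Lemma measurable_mx_tuple p q :
  measurable_fun [set: mxb p q]
    (fun x : 'M[K]_(p, q) => [tuple mxvec x 0%R k | k < p * q] : (p * q).-tuple (borel K)).
Proof.
apply/measurable_fun_tnthP => k; case/mxvec_indexP: k => i j.
apply: eq_measurable_fun (@measurable_entry _ _ p q i j) => x _.
by rewrite /= tnth_mktuple mxvecE.
Qed.

Lemma lam_sigma_finite p q : sigma_finite setT (@lam p q).
Proof.
have /sigma_finiteP[F [FT ndF Foo]] := sigma_finiteT (power_measure mu (p * q)).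
pose g (x : mxb p q) : (p * q).-tuple (borel K) := [tuple mxvec (x : 'M[K]_(p, q)) 0%R k | k < p * q].
exists (fun k => g @^-1` F k) => [|k].
  apply/seteqP; split => // x _.
  have [i _ Fi] : (\bigcup_i F i) (g x) by rewrite -FT.
  by exists i.
have [mF Fk] := Foo k; split.
  by rewrite -[X in measurable X]setTI; exact: measurable_mx_tuple.
rewrite /lam /pushforward (_ : _ @^-1` _ = F k)//.
by apply/funext => t; rewrite /preimage/= /g mxtK.
Qed.

HB.instance Definition _ p q := Measure_isSigmaFinite.Build _ _ _ (@lam p q)
  (@lam_sigma_finite p q).

Lemma integral_lam p q (f : mxb p q -> \bar R) : measurable_fun setT f ->
  (forall x, 0 <= f x) ->
  \int[lam (p:=p) (q:=q)]_x f x = \int[power_measure mu (p * q)]_t f (mxt t).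
Proof.
move=> mf f0; exact: (ge0_integralT_pushforward (@measurable_mxt R K p q)).
Qed.

End MatrixMeasure.
Arguments lam {R K} mu p q.

(** * Product measures: translations and boxes *)

Section PowerMeasure.
Context {R : realType} {K : absFieldType R}.
Context {mu : {sigma_finite_measure set (borel K) -> \bar R}} {nabs : K -> R}.
Context {L : local_haar mu nabs}.
Local Open Scope ereal_scope.

Lemma integral_mu_shift (a : K) (f : borel K -> \bar R) : measurable_fun setT f ->
  (forall x, 0 <= f x) -> \int[mu]_x f ((x : K) + a)%R = \int[mu]_x f x.
Proof.
move=> mf f0; pose s (x : borel K) : borel K := ((x : K) + a)%R.
have ms : measurable_fun setT s.
  by apply: measurable_absD; [exact: measurable_id|exact: measurable_cst].
rewrite -(ge0_integralT_pushforward ms mu mf f0).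
apply: eq_measure_integral => A mA _; rewrite /pushforward.
have := @mu_shift _ _ mu _ L (- a)%R A mA => <-; congr (mu _).
apply/seteqP; split => [x Ax|_ [x Ax <-]].
  by exists (s x) => //; rewrite /s addrC addrK.
by rewrite /s /preimage/= addrC addNKr.
Qed.

Lemma consp_tnth n (x : K) (t : n.-tuple K) (v : 'I_n.+1 -> K) :
  [tuple (tnth (@consp _ (borel K) n (x, t)) i + v i)%R | i < n.+1] =
  @consp _ (borel K) n ((x + v ord0)%R, [tuple (tnth t i + v (lift ord0 i))%R | i < n]).
Proof.
apply: eq_from_tnth => i; rewrite tnth_mktuple.
have [j|] := unliftP ord0 i => ->; last by rewrite !tnth0.
by rewrite !tnthS tnth_mktuple.
Qed.

Lemma integral_power_cons n (f : n.+1.-tuple (borel K) -> \bar R) :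
  measurable_fun setT f -> (forall x, 0 <= f x) ->
  \int[power_measure mu n.+1]_t f t =
  \int[mu]_x \int[power_measure mu n]_t f (@consp _ (borel K) n (x, t)).
Proof.
move=> mf f0.
have mc : measurable_fun setT (@consp _ (borel K) n) by exact: measurable_consp.
rewrite (ge0_integralT_pushforward mc (mu \x power_measure mu n) mf f0).
rewrite (fubini_tonelli1 (f \o @consp _ (borel K) n))//.
  exact: measurableT_comp.
by move=> x; exact: f0.
Qed.

Lemma measurable_tuple_shift n (v : 'I_n -> K) : measurable_fun setT
  (fun t : n.-tuple (borel K) => [tuple (tnth t i + v i)%R | i < n] : n.-tuple (borel K)).
Proof.
apply/measurable_fun_tnthP => i.
rewrite (_ : _ \o _ = fun t : n.-tuple (borel K) => (tnth t i : K) + v i)%R; last first.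
  by apply/funext => t; rewrite /comp tnth_mktuple.
by apply: measurable_absD; [exact: measurable_tnth|exact: measurable_cst].
Qed.

Lemma integral_power_shift n (v : 'I_n -> K) (f : n.-tuple (borel K) -> \bar R) :
  measurable_fun setT f -> (forall x, 0 <= f x) ->
  \int[power_measure mu n]_t f [tuple (tnth t i + v i)%R | i < n] =
  \int[power_measure mu n]_t f t.
Proof.
elim: n v f => [|n IH] v f mf f0.
  by apply: eq_integral => t _; congr f; apply: eq_from_tnth => -[].
have mc : measurable_fun setT (@consp _ (borel K) n) by exact: measurable_consp.
have mfc : measurable_fun setT (f \o @consp _ (borel K) n) by exact: measurableT_comp.
rewrite !integral_power_cons//; last first.
  exact: (measurableT_comp mf (measurable_tuple_shift v)).
pose F x := \int[power_measure mu n]_t f (consp (x, t)).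
transitivity (\int[mu]_x F ((x : K) + v ord0)%R).
  apply: eq_integral => x _; rewrite /F.
  under eq_integral do rewrite consp_tnth.
  pose g t := f (@consp _ (borel K) n ((x + v ord0)%R, t)).
  have mg : measurable_fun setT g.
    apply: (measurableT_comp mfc).
    by apply: measurable_fun_pair => //; exact: measurable_cst.
  exact: (IH (fun i => v (lift ord0 i)) g mg (fun t => f0 _)).
apply: integral_mu_shift; last by move=> x; exact: integral_ge0.
exact (measurable_fun_fubini_tonelli_F (m2 := power_measure mu n)
  (f \o @consp _ (borel K) n) mfc (fun x => f0 _)).
Qed.

Lemma power_box n (A : 'I_n -> set (borel K)) (r : 'I_n -> R) :
  (forall i, measurable (A i)) -> (forall i, mu (A i) = (r i)%:E) ->
  power_measure mu n [set t | forall i, A i (tnth t i)] = (\prod_i r i)%:E.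
Proof.
elim: n A r => [|n IH] A r mA mr.
  rewrite big_ord0 /= diracE mem_set//= => i; by case: i.
pose B : set (n.-tuple (borel K)) := [set t | forall i, A (lift ord0 i) (tnth t i)].
have mB : measurable B.
  rewrite (_ : B = \bigcap_(i in [set: 'I_n]) ((@tnth _ _)^~ i @^-1` A (lift ord0 i))).
    apply: fin_bigcap_measurable => // i _.
    by rewrite -[X in measurable X]setTI; exact: measurable_tnth.
  by apply/seteqP; split => [t h i _|t h i]; [exact: h|exact: (h i)].
transitivity ((mu \x power_measure mu n) (A ord0 `*` B)); last first.
  refine (eq_trans (product_measure1E mu (power_measure mu n) (mA ord0) mB) _).
  rewrite big_ord_recl EFinM; congr (_ * _); first exact (mr ord0).
  exact (IH (fun i => A (lift ord0 i)) (fun i => r (lift ord0 i))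
    (fun i => mA _) (fun i => mr _)).
rewrite [LHS]/= /cons_measure /pushforward; congr (_ _).
apply/seteqP; split=> -[x t] /=.
  by move=> h; split => [|i]; [have := h ord0; rewrite tnth0|
    have := h (lift ord0 i); rewrite tnthS].
move=> [Ax Bt] i; have [j|] := unliftP ord0 i => ->; first by rewrite tnthS.
by rewrite tnth0.
Qed.

End PowerMeasure.

Section Tonelli.
Context d1 d2 (X : measurableType d1) (Y : measurableType d2) (R : realType).
Variables (m1 : {sigma_finite_measure set X -> \bar R}).
Variables (m2 : {sigma_finite_measure set Y -> \bar R}).
Local Open Scope ereal_scope.

Lemma tonelli_swap (f : X -> Y -> \bar R) :
  measurable_fun setT (fun z : X * Y => f z.1 z.2) -> (forall x y, 0 <= f x y) ->
  \int[m1]_x \int[m2]_y f x y = \int[m2]_y \int[m1]_x f x y.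
Proof.
move=> mf f0.
exact (fubini_tonelli (m1 := m1) (m2 := m2) (fun z => f z.1 z.2) mf (fun z => f0 _ _)).
Qed.

Lemma measurable_integral (f : X -> Y -> \bar R) :
  measurable_fun setT (fun z : X * Y => f z.1 z.2) -> (forall x y, 0 <= f x y) ->
  measurable_fun setT (fun x => \int[m2]_y f x y).
Proof.
move=> mf f0.
exact (measurable_fun_fubini_tonelli_F (m2 := m2) (fun z => f z.1 z.2) mf (fun z => f0 _ _)).
Qed.

End Tonelli.

Section InvariantMeasure.
Context {R : realType} {K : absFieldType R}.
Context {mu : {sigma_finite_measure set (borel K) -> \bar R}} {nabs : K -> R}.
Context {L : local_haar mu nabs}.
Local Open Scope ereal_scope.

Lemma integral_lam_shift p q (v : 'M[K]_(p, q)) (f : mxb p q -> \bar R) :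
  measurable_fun setT f -> (forall x, 0 <= f x) ->
  \int[lam mu p q]_x f ((x : 'M[K]_(p, q)) + v)%R = \int[lam mu p q]_x f x.
Proof.
move=> mf f0; have ms : measurable_fun [set: mxb p q]
    (fun x : mxb p q => (x : 'M[K]_(p, q)) + v : mxb p q)%R.
  by apply: measurable_addmx; [exact: measurable_id|exact: measurable_cst].
rewrite (integral_lam mu (measurableT_comp mf ms) (fun x => f0 _)).
rewrite (integral_lam mu mf f0).
pose w (k : 'I_(p * q)) := mxvec v 0%R k.
have mft : measurable_fun setT (fun t : (p * q).-tuple (borel K) => f (mxt t)).
  exact: (measurableT_comp mf (@measurable_mxt R K p q)).
rewrite -(integral_power_shift w mft (fun t => f0 _)).
apply: eq_integral => t _ /=; congr f; apply/matrixP => i j.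
by rewrite !mxE tnth_mktuple /w mxvecE.
Qed.

(** The reference set on which invariant measures are calibrated: symmetric, stable under
    transposition, of known finite positive volume. *)
Definition cube p q : set (mxb p q) := [set x : 'M[K]_(p, q) | forall i j, (absv (x i j) <= 1)%R].

Lemma lam_disks p q (D : 'M[K]_(p, q)) : (forall i j, D i j != 0%R) ->
  lam mu p q [set x : 'M[K]_(p, q) | forall i j, (absv (x i j) <= absv (D i j))%R] =
  (\prod_i \prod_j (nabs (D i j) * disk_volume (mu := mu)))%:E.
Proof.
move=> D0; rewrite /lam /pushforward.
pose A (k : 'I_(p * q)) := disk (K := K) (absv (mxvec D 0%R k)).
pose r (k : 'I_(p * q)) := (nabs (mxvec D 0%R k) * disk_volume (mu := mu))%R.
rewrite (_ : _ @^-1` _ = [set t | forall k, A k (tnth t k)]); last first.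
  apply/seteqP; split => t h.
    by move=> k; case/mxvec_indexP: k => i j; have := h i j; rewrite /A mxvecE mxE.
  by move=> i j; have := h (mxvec_index i j); rewrite /A mxvecE mxE.
refine (eq_trans (@power_box R K mu (p * q) A r _ _) _).
- by move=> k; exact: measurable_disk.
- move=> k; case/mxvec_indexP: k => i j.
  by rewrite /A /r mxvecE; exact (nabs_disk (D0 i j)).
congr EFin; rewrite pair_bigA /= (reindex _ (curry_mxvec_bij p q)) /=.
by apply: eq_bigr => -[i j] _ /=; rewrite /r mxvecE.
Qed.

Lemma lam_cube p q : lam mu p q (@cube p q) = (disk_volume (mu := mu) ^+ (p * q))%:E.
Proof.
have := @lam_disks p q (const_mx 1%R); rewrite (_ : [set x | _] = @cube p q).
  move=> ->; last by move=> i j; rewrite mxE oner_neq0.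
  congr EFin; rewrite -[(p * q)%N]card_ord.
  under eq_bigr do under eq_bigr do rewrite mxE nabs1 mul1r.
  under eq_bigr do rewrite prodr_const card_ord.
  by rewrite prodr_const !card_ord -exprM mulnC.
by apply/seteqP; split => x h i j; have := h i j; rewrite mxE absv1.
Qed.

Lemma measurable_cube p q : measurable (@cube p q).
Proof.
rewrite (_ : @cube p q = \bigcap_(ij in [set: 'I_p * 'I_q])
    ((fun x : mxb p q => x ij.1 ij.2 : borel K) @^-1` disk 1)).
  apply: fin_bigcap_measurable => // ij _; rewrite -[X in measurable X]setTI.
  by apply: measurable_entry => //; exact: measurable_disk.
by apply/seteqP; split => [x h ij _|x h i j]; [exact: h|exact: (h (i, j))].
Qed.

Definition cube_ind p q (x : mxb p q) : \bar R := (\1_(@cube p q) x)%:E.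

Lemma cube_ind_ge0 p q (x : mxb p q) : 0 <= cube_ind x.
Proof. by rewrite lee_fin. Qed.
Hint Resolve cube_ind_ge0 : core.

Lemma measurable_cube_ind p q : measurable_fun setT (@cube_ind p q).
Proof.
apply/measurable_EFinP.
have h := @measurable_indic _ _ R setT _ (@measurable_cube p q); exact h.
Qed.

Lemma integral_cube p q :
  \int[lam mu p q]_x cube_ind x = (disk_volume (mu := mu) ^+ (p * q))%:E.
Proof.
rewrite /cube_ind.
have := @integral_indic _ _ _ (lam mu p q) setT measurableT _ (@measurable_cube p q).
by rewrite setIT => ->; exact: lam_cube.
Qed.

Lemma cube_indN p q (x : 'M[K]_(p, q)) : cube_ind (- x)%R = cube_ind (x : mxb p q).
Proof.
rewrite /cube_ind !indicE; congr ((nat_of_bool _)%:R%:E); apply/idP/idP => /set_mem h.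
  by apply/mem_set => i j; have := h i j; rewrite mxE absvN.
by apply/mem_set => i j; have := h i j; rewrite mxE absvN.
Qed.

(** * Uniqueness of translation-invariant measures *)

Section Uniqueness.
Context d (X : measurableType d) (la : {sigma_finite_measure set X -> \bar R}).
Context p q (T : X -> mxb (K := K) p q).
Hypothesis mT : measurable_fun setT T.
Hypothesis invT : forall (v : 'M[K]_(p, q)) (f : mxb p q -> \bar R),
  measurable_fun setT f -> (forall x, 0 <= f x) ->
  \int[la]_x f ((T x : 'M[K]_(p, q)) + v)%R = \int[la]_x f (T x).

(** The double integral of F(x) H(T y + x) is computed in both orders: shifting [T y] by [x] gives
    the left side, and substituting x - T y for [x], then shifting by -x, gives the right side.
    Working with a map [T] instead of a measure on matrices covers linear maps, transposition and
    block decompositions alike. *)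
Lemma invariant_product (F H : mxb p q -> \bar R) :
  measurable_fun setT F -> (forall x, 0 <= F x) ->
  measurable_fun setT H -> (forall x, 0 <= H x) ->
  (\int[lam mu p q]_x F x) * (\int[la]_y H (T y)) =
  (\int[la]_y F (- (T y : 'M[K]_(p, q)))%R) * (\int[lam mu p q]_x H x).
Proof.
move=> mF F0 mH H0.
have mN : measurable_fun [set: mxb p q] (fun x => (- (x : 'M[K]_(p, q)))%R : mxb p q).
  apply/measurable_mxbP => i j; under eq_fun do rewrite mxE.
  by apply: measurable_absN; exact: measurable_entry.
have mHT : measurable_fun setT (fun y => H (T y)) by exact: measurableT_comp.
rewrite -ge0_integralZr//; last exact: integral_ge0.
have m1 : measurable_fun setT (fun z : mxb p q * X => F z.1 *
    H ((T z.2 : 'M[K]_(p, q)) + (z.1 : 'M[K]_(p, q)))%R).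
  apply: emeasurable_funM; first exact: measurableT_comp.
  apply: (measurableT_comp mH); apply: measurable_addmx => //.
  exact: measurableT_comp.
transitivity (\int[lam mu p q]_x \int[la]_y
    (F x * H ((T y : 'M[K]_(p, q)) + (x : 'M[K]_(p, q)))%R)).
  apply: eq_integral => x _; rewrite ge0_integralZl//; last first.
    apply: (measurableT_comp mH); apply: measurable_addmx => //.
  by rewrite invT.
rewrite tonelli_swap//; last by move=> x y; exact: mule_ge0.
have m2 : measurable_fun setT (fun z : X * mxb p q =>
    F ((z.2 : 'M[K]_(p, q)) - (T z.1 : 'M[K]_(p, q)))%R * H z.2).
  apply: emeasurable_funM; last exact: measurableT_comp.
  apply: (measurableT_comp mF); apply: measurable_addmx => //.
  by apply: (measurableT_comp mN); exact: measurableT_comp.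
transitivity (\int[la]_y \int[lam mu p q]_x
    (F ((x : 'M[K]_(p, q)) - (T y : 'M[K]_(p, q)))%R * H x)).
  apply: eq_integral => y _.
  have mg : measurable_fun setT (fun x : mxb p q => F ((x : 'M[K]_(p, q)) - T y)%R * H x).
    apply: emeasurable_funM => //.
    by apply: (measurableT_comp mF); apply: measurable_addmx.
  rewrite -(integral_lam_shift (T y : 'M[K]_(p, q)) mg); last first.
    by move=> x; exact: mule_ge0.
  by apply: eq_integral => x _; rewrite addrK (addrC x).
rewrite tonelli_swap//; last by move=> x y; exact: mule_ge0.
have mFN : measurable_fun setT (fun x : mxb p q => F (- (x : 'M[K]_(p, q)))%R).
  exact: (measurableT_comp mF mN).
rewrite -ge0_integralZl//; last exact: integral_ge0.
apply: eq_integral => x _.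
rewrite ge0_integralZr//; last first.
  apply: (measurableT_comp mF); apply: measurable_addmx => //.
  by apply: (measurableT_comp mN).
congr (_ * _); rewrite -(invT (- (x : 'M[K]_(p, q)))%R mFN)//.
by apply: eq_integral => y _; rewrite opprD opprK addrC.
Qed.

(** The product formula with the indicator of the cube for [F]; the cube is symmetric, so the sign
    in F(- T y) disappears. *)
Lemma invariant_unique (c : R) : (\int[la]_y cube_ind (T y) = c%:E) ->
  forall H : mxb p q -> \bar R, measurable_fun setT H -> (forall x, 0 <= H x) ->
  \int[la]_y H (T y) = (c / disk_volume (mu := mu) ^+ (p * q))%:E * \int[lam mu p q]_x H x.
Proof.
move=> ec H mH H0.
have := invariant_product (@measurable_cube_ind p q) (@cube_ind_ge0 p q) mH H0.
under [X in _ = X * _]eq_integral do rewrite cube_indN.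
rewrite ec integral_cube => e.
have v0 : (0 < disk_volume (mu := mu) ^+ (p * q))%R by rewrite exprn_gt0// disk_volume_gt0.
rewrite mulrC EFinM -muleA -e muleA -EFinM mulVf ?mul1e//.
by rewrite gt_eqF.
Qed.

End Uniqueness.

Section Linear.
Context p q (T S : 'M[K]_(p, q) -> 'M[K]_(p, q)).
Hypothesis mT : measurable_fun setT (T : mxb p q -> mxb p q).
Hypothesis mS : measurable_fun setT (S : mxb p q -> mxb p q).
Hypothesis TD : forall x y, T (x + y)%R = (T x + T y)%R.
Hypothesis TS : cancel S T.
Hypothesis ST : cancel T S.

Lemma integral_linear_shift (v : 'M[K]_(p, q)) (f : mxb p q -> \bar R) :
  measurable_fun setT f -> (forall x, 0 <= f x) ->
  \int[lam mu p q]_x f (T x + v)%R = \int[lam mu p q]_x f (T x).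
Proof.
move=> mf f0; rewrite -[v]TS -(integral_lam_shift (S v) (measurableT_comp mf mT))//.
  by apply: eq_integral => x _; rewrite /= TD.
by move=> x; exact: f0.
Qed.

(** The constant is neither 0 nor infinite: with the indicator of the cube composed with [S] for
    [H], the product formula exhibits it as a factor of the squared volume of the cube, a positive
    real. *)
Lemma integral_linear : exists2 c : R, (0 < c)%R & forall H : mxb p q -> \bar R,
  measurable_fun setT H -> (forall x, 0 <= H x) ->
  \int[lam mu p q]_y H (T y) = c%:E * \int[lam mu p q]_x H x.
Proof.
set c0 := \int[lam mu p q]_y cube_ind (T y : mxb p q).
have v0 : (0 < disk_volume (mu := mu) ^+ (p * q))%R by rewrite exprn_gt0// disk_volume_gt0.
have m1 : measurable_fun setT (fun x : mxb p q => cube_ind (S x : mxb p q)).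
  exact (measurableT_comp (@measurable_cube_ind p q) mS).
have := invariant_product mT integral_linear_shift (@measurable_cube_ind p q)
  (@cube_ind_ge0 p q) m1 (fun x => cube_ind_ge0 _).
under [X in _ * X = _]eq_integral do rewrite ST.
under [X in _ = X * _]eq_integral do rewrite cube_indN.
rewrite integral_cube -/c0 => e.
have c00 : 0 <= c0 by exact: integral_ge0.
have {e} [c [c_gt0 ec]] : exists c : R, (0 < c)%R /\ c0 = c%:E.
  have i0 : 0 <= \int[lam mu p q]_x cube_ind (S x : mxb p q) by exact: integral_ge0.
  have : 0 < c0 * \int[lam mu p q]_x cube_ind (S x : mxb p q).
    by rewrite -e -EFinM lte_fin mulr_gt0.
  have : c0 * \int[lam mu p q]_x cube_ind (S x : mxb p q) \is a fin_num by rewrite -e.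
  move: c00 i0; move: c0 (\int[_]_x _) {e} => [c||] [i||]//=; rewrite ?lee_fin => c0 i0.
  - move=> _; rewrite -EFinM lte_fin => ci; exists c; split => //.
    by rewrite lt_neqAle c0 andbT eq_sym; apply: contraTneq ci => ->; rewrite mul0r ltxx.
  - move: c0; rewrite le_eqVlt => /predU1P[<-|c0]; first by rewrite mul0e ltxx.
    by rewrite gt0_muley.
  - move: i0; rewrite le_eqVlt => /predU1P[<-|i0]; first by rewrite mule0 ltxx.
    by rewrite gt0_mulye.
exists (c / disk_volume (mu := mu) ^+ (p * q))%R; first by rewrite divr_gt0.
exact: (invariant_unique mT integral_linear_shift ec).
Qed.

End Linear.
End InvariantMeasure.

(** * The module of left multiplication *)

Section Pivot.
Context {R : realType} {K : absFieldType R}.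

Lemma block_pivot m (r : K) (u : 'rV[K]_m) (c : 'cV[K]_m) (h : 'M[K]_m) :
  block_mx r%:M (r *: u) c (c *m u + h) =
  block_mx r%:M 0 c h *m block_mx 1%:M u 0 1%:M :> 'M[K]_(1 + m).
Proof.
by rewrite mulmx_block !mulmx0 !mulmx1 !addr0 mul_scalar_mx.
Qed.

(** The entry of largest absolute value in the first row is moved to the first column and serves as
    pivot [r]. The rest of that row divided by [r] is [u], whence the bound 1 on its entries; [h] is
    the Schur complement. *)
Lemma pivot m (x : 'M[K]_(1 + m)) : x \in unitmx ->
  exists (j : 'I_(1 + m)) (r : K) (u : 'rV[K]_m) (c : 'cV[K]_m) (h : 'M[K]_m),
    [/\ r != 0, h \in unitmx, forall i, absv (u 0 i) <= 1 &
      x = block_mx r%:M (r *: u) c (c *m u + h) *m tperm_mx (lshift m 0) j].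
Proof.
move=> xU; pose z : 'I_(1 + m) := lshift m 0.
have [j hj] : exists j, forall k, absv (x z k) <= absv (x z j).
  exists [arg max_(k > z) absv (x z k)]%O.
  by move=> k; case: arg_maxP => [//|i _ hi]; exact: hi.
pose P : 'M[K]_(1 + m) := tperm_mx z j; pose y := x *m P.
have PP : P *m P = 1%:M by rewrite /P /tperm_mx -perm_mxM tperm2 perm_mx1.
have yE i k : y i k = x i (tperm z j k).
  by rewrite /y /P /tperm_mx -[in LHS](tpermV z j) -col_permE mxE.
have yU : y \in unitmx by rewrite unitmx_mul xU unitmx_perm.
have ymax k : absv (y z k) <= absv (y z z).
  by rewrite !yE tpermL; exact: hj.
pose r := y z z.
have r0 : r != 0.
  apply/eqP => r0; move: yU; rewrite unitmxE unitfE (expand_det_row _ z) big1 ?eqxx//.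
  move=> k _; suff -> : y z k = 0 by rewrite mul0r.
  by apply/eqP; rewrite -absv_eq0 eq_le absv_ge0 andbT (le_trans (ymax k))// -/r r0 absv0.
pose u : 'rV[K]_m := r^-1 *: ursubmx y.
pose c : 'cV[K]_m := dlsubmx y.
pose h : 'M[K]_m := drsubmx y - c *m u.
have ey : y = block_mx r%:M (r *: u) c (c *m u + h).
  rewrite -[LHS]submxK /u scalerA divff// scale1r.
  rewrite /h addrC subrK; congr block_mx.
  apply/matrixP => i k; rewrite !ord1 [RHS]mxE eqxx mulr1n /r.
  by rewrite /ulsubmx [LHS]mxE [LHS]mxE.
exists j, r, u, c, h; split => //.
- move: yU; rewrite ey block_pivot unitmx_mul => /andP[+ _].
  by rewrite !unitmxE det_lblock unitrM => /andP[].
- move=> i; rewrite /u mxE absvM absvV ler_pdivrMl ?absv_gt0// mulr1.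
  by rewrite /ursubmx mxE mxE; exact: ymax.
- by rewrite -ey /y -mulmxA PP mulmx1.
Qed.
End Pivot.

Section DetCharacter.
Context {R : realType} {K : absFieldType R}.
Context {mu : {sigma_finite_measure set (borel K) -> \bar R}} {nabs : K -> R}.
Context {L : local_haar mu nabs}.

Lemma nabsN1 : nabs (-1) = 1.
Proof.
have : nabs (-1) * nabs (-1) = 1 by rewrite -nabsM mulN1r opprK nabs1.
move/eqP; rewrite -expr2 sqrf_eq1 => /orP[/eqP//|/eqP h].
have : 0 <= nabs (-1) by exact: nabs_ge0.
by rewrite h ler0N1.
Qed.

(* A unipotent block matrix is a product of two involutions, hence any
   positive character of GL kills it. *)
Lemma det_character (k m : nat) (chi : 'M[K]_m -> R) :
  (forall x y, x \in unitmx -> y \in unitmx -> chi (x *m y) = chi x * chi y) ->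
  (forall x, x \in unitmx -> 0 < chi x) ->
  (forall d : 'rV[K]_m, (forall i, d 0 i != 0) ->
     chi (diag_mx d) = nabs (\prod_i d 0 i) ^- k) ->
  forall x, x \in unitmx -> chi x = nabs (\det x) ^- k.
Proof.
elim: m chi => [chi _ _ chiD x xU|m IH].
  have -> : x = diag_mx (const_mx 1) by apply/matrixP => -[].
  by rewrite chiD; [rewrite det_diag|move=> -[]].
rewrite -[m.+1]/(1 + m)%N => chi chiM chi0 chiD x xU.
have chi1 y : y *m y = 1%:M -> chi y = 1.
  move=> yy; have yU : y \in unitmx by have [] := mulmx1_unit yy.
  have h1 : chi (1%:M) = 1.
    have := chiM _ _ (unitmx1 _ _) (unitmx1 _ _); rewrite mulmx1 => /eqP.
    rewrite -subr_eq0 -{1}[chi _]mulr1 -mulrBr mulf_eq0 gt_eqF/= ?chi0 ?unitmx1//.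
    by rewrite subr_eq0 eq_sym => /eqP.
  have := chiM y y yU yU; rewrite yy h1 => /esym/eqP.
  rewrite -expr2 sqrf_eq1 => /orP[/eqP//|/eqP h].
  by have := chi0 y yU; rewrite h ltr0N1.
have chi_inv y e : y *m e *m (y *m e) = 1%:M -> e *m e = 1%:M -> chi y = 1.
  move=> ye ee; have eU : e \in unitmx by have [] := mulmx1_unit ee.
  have yU : y \in unitmx.
    by have [+ _] := mulmx1_unit ye; rewrite unitmx_mul eU andbT.
  by have := chi1 _ ye; rewrite chiM// (chi1 _ ee) mulr1.
pose e : 'M[K]_(1 + m) := block_mx 1%:M 0 0 (- 1%:M).
have ee : e *m e = 1%:M.
  by rewrite /e mulmx_block !(mulmx0, mul0mx, mulmx1, mul1mx, mulmxN, mulNmx, opprK, addr0, add0r, oppr0, addNr, subrr) -scalar_mx_block.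
have chi_up u : chi (block_mx 1%:M u 0 1%:M : 'M[K]_(1 + m)) = 1.
  apply: (@chi_inv _ e) => //; rewrite /e !mulmx_block.
  by rewrite !(mulmx0, mul0mx, mulmx1, mul1mx, mulmxN, mulNmx, opprK, addr0, add0r, oppr0, addNr, subrr) -scalar_mx_block.
have chi_low c : chi (block_mx 1%:M 0 c 1%:M : 'M[K]_(1 + m)) = 1.
  apply: (@chi_inv _ e) => //; rewrite /e !mulmx_block.
  by rewrite !(mulmx0, mul0mx, mulmx1, mul1mx, mulmxN, mulNmx, opprK, addr0, add0r, oppr0, addNr, subrr) -scalar_mx_block.
(* Pivoting factors [x] into unipotent blocks and a permutation matrix, all killed by [chi], and the
   blocks diag(r, 1) and diag(1, h). The first of these is diagonal, the second falls under the
   induction hypothesis. *)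
have [j [r [u [c [h [r0 hU _ ->]]]]]] := pivot xU.
pose P : 'M[K]_(1 + m) := tperm_mx (lshift m 0) j.
have PP : P *m P = 1%:M by rewrite /P /tperm_mx -perm_mxM tperm2 perm_mx1.
have PU : P \in unitmx by have [] := mulmx1_unit PP.
have U1 : (block_mx 1%:M u 0 1%:M : 'M[K]_(1 + m)) \in unitmx.
  by rewrite unitmxE det_ublock !det1 mulr1 unitr1.
have U2 : (block_mx r%:M 0 c h : 'M[K]_(1 + m)) \in unitmx.
  by rewrite unitmxE det_lblock det_scalar1 unitrM unitfE r0.
have U3 : (block_mx 1%:M 0 (r^-1 *: c) 1%:M : 'M[K]_(1 + m)) \in unitmx.
  by rewrite unitmxE det_lblock !det1 mulr1 unitr1.
have U4 : (block_mx r%:M 0 0 1%:M : 'M[K]_(1 + m)) \in unitmx.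
  by rewrite unitmxE det_lblock det_scalar1 det1 mulr1 unitfE.
have U5 : (block_mx 1%:M 0 0 h : 'M[K]_(1 + m)) \in unitmx.
  by rewrite unitmxE det_lblock det1 mul1r.
have e2 : block_mx r%:M 0 c h = block_mx 1%:M 0 (r^-1 *: c) 1%:M *m
    (block_mx r%:M 0 0 1%:M *m block_mx 1%:M 0 0 h) :> 'M[K]_(1 + m).
  rewrite !mulmx_block !(mulmx0, mul0mx, mulmx1, mul1mx, mulmxN, mulNmx, opprK, addr0, add0r, oppr0, addNr, subrr).
  by rewrite mul_mx_scalar scalerA divff// scale1r.
rewrite block_pivot -/P !det_mulmx !chiM ?unitmx_mul ?U1 ?U2 ?PU//.
rewrite chi_up (chi1 _ PP) !mulr1 det_ublock !det1 mulr1 mulr1 e2.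
rewrite !chiM ?unitmx_mul ?U4 ?U5// chi_low mul1r !det_mulmx.
rewrite !det_lblock !det1 !det_scalar1 !mul1r mulr1.
have -> : chi (block_mx r%:M 0 0 1%:M) = nabs r ^- k.
  rewrite (_ : block_mx _ _ _ _ = diag_mx (row_mx (const_mx r) (const_mx 1) : 'rV_(1 + m))).
    rewrite chiD; last first.
      move=> i; case: (split_ordP i) => l ->; first by rewrite row_mxEl mxE.
      by rewrite row_mxEr mxE oner_neq0.
    rewrite big_split_ord/= big_ord1 row_mxEl mxE big1 ?mulr1// => i _.
    by rewrite row_mxEr mxE.
  by rewrite diag_mx_row !diag_const_mx.
have -> : chi (block_mx 1%:M 0 0 h) = nabs (\det h) ^- k.
  pose chi' (h : 'M[K]_m) := chi (block_mx 1%:M 0 0 h : 'M[K]_(1 + m)).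
  apply: (IH chi') => //.
  - move=> a b aU bU; rewrite /chi' -chiM.
    + by rewrite mulmx_block !(mulmx0, mul0mx, mulmx1, mul1mx, mulmxN, mulNmx, opprK, addr0, add0r, oppr0, addNr, subrr).
    + by rewrite unitmxE det_lblock det1 mul1r.
    + by rewrite unitmxE det_lblock det1 mul1r.
  - by move=> a aU; apply: chi0; rewrite unitmxE det_lblock det1 mul1r.
  - move=> d d0; rewrite /chi' (_ : block_mx _ _ _ _ = diag_mx (row_mx (const_mx 1) d : 'rV_(1 + m))).
      rewrite chiD; last first.
        move=> i; case: (split_ordP i) => l ->; last by rewrite row_mxEr.
        by rewrite row_mxEl mxE oner_neq0.
      rewrite big_split_ord/= big_ord1 row_mxEl mxE mul1r.
      by under eq_bigr do rewrite row_mxEr.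
    by rewrite diag_mx_row diag_const_mx.
have dP : nabs (\det P) = 1.
  rewrite /P /tperm_mx det_perm; case: (odd_perm _); last by rewrite expr0 nabs1.
  by rewrite expr1 nabsN1.
by rewrite !nabsM dP mulr1 exprMn invfM.
Qed.

End DetCharacter.

Section Module.
Context {R : realType} {K : absFieldType R}.
Context {mu : {sigma_finite_measure set (borel K) -> \bar R}} {nabs : K -> R}.
Context {L : local_haar mu nabs}.
Local Open Scope ereal_scope.

(** Calibration on the cube: its preimage under the scaling is the polydisk of radii 1/|D i j|,
    whose volume is known. *)
Lemma integral_scale p q (D : 'M[K]_(p, q)) : (forall i j, D i j != 0%R) ->
  forall H : mxb p q -> \bar R, measurable_fun setT H -> (forall x, 0 <= H x) ->
  \int[lam mu p q]_x H (\matrix_(i, j) (D i j * (x : 'M[K]_(p, q)) i j))%R =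
  ((\prod_i \prod_j nabs (D i j))^-1)%:E * \int[lam mu p q]_x H x.
Proof.
move=> D0 H mH H0.
pose T (x : 'M[K]_(p, q)) : 'M[K]_(p, q) := (\matrix_(i, j) (D i j * x i j))%R.
pose S (x : 'M[K]_(p, q)) : 'M[K]_(p, q) := (\matrix_(i, j) ((D i j)^-1 * x i j))%R.
have mT : measurable_fun setT (T : mxb p q -> mxb p q).
  apply/measurable_mxbP => i j; under eq_fun do rewrite mxE.
  by apply: measurable_absM; [exact: measurable_cst|exact: measurable_entry].
have TD (x y : 'M[K]_(p, q)) : T (x + y)%R = (T x + T y)%R.
  by apply/matrixP => i j; rewrite !mxE mulrDr.
have TS : cancel S T by move=> x; apply/matrixP => i j; rewrite !mxE mulVKf.
have nv0 i j : (D i j)^-1%R != 0%R by rewrite invr_neq0.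
have v0 : (0 < disk_volume (mu := mu))%R by exact: disk_volume_gt0.
rewrite (@invariant_unique _ _ mu nabs L _ _ (lam mu p q) p q T mT
  (integral_linear_shift mT TD TS)
  ((\prod_i \prod_j nabs (D i j))^-1 * disk_volume (mu := mu) ^+ (p * q))%R _ H mH H0).
  by rewrite mulfK// expf_neq0// gt_eqF.
pose D' : 'M[K]_(p, q) := (\matrix_(i, j) (D i j)^-1)%R.
have D'0 i j : D' i j != 0%R by rewrite mxE.
have -> : ((\prod_i \prod_j nabs (D i j))^-1 * disk_volume (mu := mu) ^+ (p * q))%R =
    (\prod_i \prod_j (nabs (D' i j) * disk_volume (mu := mu)))%R.
  under [RHS]eq_bigr do rewrite big_split/= prodr_const card_ord.
  rewrite big_split/= prodr_const card_ord -exprM [in RHS]mulnC; congr (_ * _)%R.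
  rewrite -prodfV; apply: eq_bigr => i _; rewrite -prodfV; apply: eq_bigr => j _.
  have := @nabsM _ _ mu nabs L (D i j) (D' i j); rewrite mxE divff// nabs1 => e.
  by apply/esym; apply: (mulfI (lt0r_neq0 (nabs_gt0 (D0 i j)))); rewrite -e divff// gt_eqF// nabs_gt0.
rewrite -(lam_disks D'0) /cube_ind.
under eq_integral do rewrite indicE.
pose A := [set x : 'M[K]_(p, q) | forall i j, (absv (x i j) <= absv (D' i j))%R] : set (mxb p q).
have AE (x : mxb p q) : (T x \in @cube _ K p q) = (x \in A).
  apply/idP/idP => /set_mem h; apply/mem_set => i j; have := h i j; rewrite !mxE.
    by rewrite absvM absvV -ler_pdivlMl ?mulr1// absv_gt0.
  by rewrite absvM absvV -[X in (_ <= X)%R]mulr1 ler_pdivlMl ?absv_gt0.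
under eq_integral do rewrite AE -indicE.
have mA : measurable A.
  rewrite (_ : A = T @^-1` @cube _ K p q); last first.
    by apply/funext => x; have := AE x; rewrite /preimage /= => /(congr1 is_true); rewrite !inE.
  by rewrite -[X in measurable X]setTI; apply: mT => //; exact: measurable_cube.
have := @integral_indic _ _ _ (lam mu p q) setT measurableT _ mA.
by rewrite setIT.
Qed.

(** The factor by which left multiplication changes integrals is positive and multiplicative in the
    matrix, so [det_character] reduces its computation to diagonal matrices, where it is a scaling
    of the entries. *)
Lemma integral_mulmx p q (x : 'M[K]_p) : x \in unitmx ->
  forall H : mxb p q -> \bar R, measurable_fun setT H -> (forall y, 0 <= H y) ->
  \int[lam mu p q]_y H (x *m (y : 'M[K]_(p, q))) =
  (nabs (\det x) ^- q)%:E * \int[lam mu p q]_y H y.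
Proof.
have mM (z : 'M[K]_p) : measurable_fun setT (mulmx z : mxb p q -> mxb p q).
  by apply: measurable_mulmx; [exact: measurable_cst|exact: measurable_id].
have lin (z : 'M[K]_p) : z \in unitmx -> exists2 c : R, (0 < c)%R &
    forall H : mxb p q -> \bar R, measurable_fun setT H -> (forall y, 0 <= H y) ->
    \int[lam mu p q]_y H (z *m (y : 'M[K]_(p, q))) = c%:E * \int[lam mu p q]_y H y.
  move=> zU; apply: (integral_linear (S := mulmx (invmx z))) => //.
  - exact: mulmxDr.
  - by move=> y; rewrite mulKVmx.
  - by move=> y; rewrite mulKmx.
pose v := (disk_volume (mu := mu) ^+ (p * q))%R.
have v0 : (0 < v)%R by rewrite exprn_gt0// disk_volume_gt0.
pose chi (z : 'M[K]_p) := (fine (\int[lam mu p q]_y cube_ind (mulmx z y : mxb p q)) / v)%R.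
have mc := @measurable_cube_ind R K p q.
have chiE (z : 'M[K]_p) : z \in unitmx -> (0 < chi z)%R /\
    forall H : mxb p q -> \bar R, measurable_fun setT H -> (forall y, 0 <= H y) ->
    \int[lam mu p q]_y H (z *m (y : 'M[K]_(p, q))) = (chi z)%:E * \int[lam mu p q]_y H y.
  move=> /lin[c c0 hc]; suff -> : chi z = c by [].
  rewrite /chi (hc _ mc)//; first by rewrite integral_cube -EFinM/= mulfK// gt_eqF.
  exact: cube_ind_ge0.
have chi0 (z : 'M[K]_p) : z \in unitmx -> (0 < chi z)%R by move=> /chiE[].
move=> xU H mH H0; have [_ ->//] := chiE x xU; congr (_%:E * _).
move: x xU; apply: (det_character (chi := chi)) => // [x y xU yU|d d0].
  have xyU : x *m y \in unitmx by rewrite unitmx_mul xU.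
  have [_ /(_ _ mc (@cube_ind_ge0 _ _ _ _))] := chiE _ xyU.
  under eq_integral do rewrite -mulmxA.
  have mcx : measurable_fun setT (fun y : mxb p q => cube_ind (x *m (y : 'M[K]_(p, q)) : mxb p q)).
    exact (measurableT_comp mc (mM x)).
  have [_ hy] := chiE _ yU; rewrite (hy _ mcx (fun=> cube_ind_ge0 _)).
  have [_ hx] := chiE _ xU; rewrite (hx _ mc (@cube_ind_ge0 _ _ _ _)).
  rewrite integral_cube -!EFinM => -[] e.
  by apply: (mulIf (lt0r_neq0 v0)); rewrite -e mulrCA mulrA.
have dU : diag_mx d \in unitmx.
  by rewrite unitmxE det_diag unitfE; apply/prodf_neq0 => i _.
have [_ /(_ _ mc (@cube_ind_ge0 _ _ _ _))] := chiE _ dU.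
pose D : 'M[K]_(p, q) := (\matrix_(i, j) d 0%R i)%R.
have D0 i j : D i j != 0%R by rewrite mxE.
under eq_integral => y _.
  rewrite (_ : _ *m _ = \matrix_(i, j) (D i j * (y : 'M[K]_(p, q)) i j))%R; last first.
    by apply/matrixP => i j; rewrite mul_diag_mx !mxE.
  over.
rewrite (integral_scale D0 mc (@cube_ind_ge0 _ _ _ _)) integral_cube -!EFinM.
move=> [] /(mulIf (lt0r_neq0 v0)) <-; congr (_^-1)%R.
under eq_bigr do under eq_bigr do rewrite mxE.
under eq_bigr do rewrite prodr_const card_ord.
rewrite prodrXl; congr (_ ^+ _)%R; apply/esym.
by apply: (big_morph nabs (@nabsM _ _ _ _ L) (@nabs1 _ _ _ _ L)).
Qed.

End Module.

(** * The Haar functional *)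

Section HaarFunctional.
Context {R : realType} {K : absFieldType R}.
Context {mu : {sigma_finite_measure set (borel K) -> \bar R}} {nabs : K -> R}.
Context {L : local_haar mu nabs}.
Local Open Scope ereal_scope.

(** The constant is 1 because transposition maps the cube onto the cube. *)
Lemma integral_trmx p q (H : mxb p q -> \bar R) : measurable_fun setT H ->
  (forall x, 0 <= H x) ->
  \int[lam mu q p]_y H ((y : 'M[K]_(q, p))^T : mxb p q) = \int[lam mu p q]_x H x.
Proof.
move=> mH H0; pose T (y : mxb q p) : mxb p q := (y : 'M[K]_(q, p))^T.
have mT : measurable_fun setT T by apply: measurable_trmx; exact: measurable_id.
have invT (v : 'M[K]_(p, q)) (f : mxb p q -> \bar R) :
    measurable_fun setT f -> (forall x, 0 <= f x) ->
    \int[lam mu q p]_x f ((T x : 'M[K]_(p, q)) + v)%R = \int[lam mu q p]_x f (T x).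
  move=> mf f0; rewrite -(integral_lam_shift (v^T) (measurableT_comp mf mT) (fun=> f0 _)).
  by apply: eq_integral => x _ /=; rewrite /T linearD /= trmxK.
rewrite (@invariant_unique _ _ mu nabs L _ _ (lam mu q p) p q T mT invT
  (disk_volume (mu := mu) ^+ (p * q))%R _ H mH H0).
  by rewrite divff ?mul1e// expf_neq0// gt_eqF// disk_volume_gt0.
rewrite mulnC -integral_cube; apply: eq_integral => y _.
rewrite /cube_ind !indicE; congr ((nat_of_bool _)%:R%:E).
by apply/idP/idP => /set_mem h; apply/mem_set => i j; have := h j i; rewrite mxE.
Qed.

Lemma integral_mulmxr p q (x : 'M[K]_q) : x \in unitmx ->
  forall H : mxb p q -> \bar R, measurable_fun setT H -> (forall y, 0 <= H y) ->
  \int[lam mu p q]_y H ((y : 'M[K]_(p, q)) *m x) =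
  (nabs (\det x) ^- p)%:E * \int[lam mu p q]_y H y.
Proof.
move=> xU H mH H0.
have mHx : measurable_fun setT (fun y : mxb p q => H ((y : 'M[K]_(p, q)) *m x)).
  apply: (measurableT_comp mH).
  by apply: measurable_mulmx; [exact: measurable_id|exact: measurable_cst].
rewrite -(integral_trmx mHx)// -(integral_trmx mH)//.
have mHt : measurable_fun setT (fun y : mxb q p => H ((y : 'M[K]_(q, p))^T)).
  by apply: (measurableT_comp mH); apply: measurable_trmx; exact: measurable_id.
rewrite -(det_tr x) -(integral_mulmx _ mHt)//; last by rewrite unitmx_tr.
by apply: eq_integral => y _; rewrite trmx_mul trmxK.
Qed.

(* The weight vanishes on singular matrices: [0 ^- m = 0] for [m > 0]. *)
Definition haar_weight m (x : 'M[K]_m) : R := nabs (\det x) ^- m.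

(** The Haar integral over GL_m, written over all matrices so that no domain has to be carried
    along. *)
Definition hint m (f : 'M[K]_m -> \bar R) : \bar R :=
  \int[lam mu m m]_x (f x * (haar_weight (x : 'M[K]_m))%:E).

Lemma haar_weight_ge0 m (x : 'M[K]_m) : (0 <= haar_weight x)%R.
Proof. by rewrite invr_ge0 exprn_ge0// nabs_ge0. Qed.

Lemma haar_weight_sing m (x : 'M[K]_m) : x \notin unitmx -> haar_weight x = 0%R.
Proof.
rewrite unitmxE unitfE negbK /haar_weight => /eqP e.
case: m x e => [|m] x e; last by rewrite e nabs0 expr0n/= invr0.
by move: e; rewrite det_mx00 => /eqP; rewrite oner_eq0.
Qed.

Lemma haar_weightM m (x y : 'M[K]_m) :
  haar_weight (x *m y) = (haar_weight x * haar_weight y)%R.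
Proof. by rewrite /haar_weight det_mulmx nabsM exprMn invfM. Qed.

Lemma haar_weight_gt0 m (x : 'M[K]_m) : x \in unitmx -> (0 < haar_weight x)%R.
Proof. by move=> xU; rewrite invr_gt0 exprn_gt0// nabs_gt0// -unitfE -unitmxE. Qed.

Lemma measurable_haar_weight d (X : measurableType d) m (f : X -> mxb m m) :
  measurable_fun setT f -> measurable_fun setT (fun x => haar_weight (f x : 'M[K]_m)).
Proof.
move=> mf.
have h : measurable_fun setT (fun x => nabs (\det (f x : 'M[K]_m))^-1)%R.
  by apply: measurable_nabs; apply: measurable_absV; exact: measurable_det.
apply: (eq_measurable_fun (fun x => nabs (\det (f x : 'M[K]_m))^-1 ^+ m)%R); last first.
  exact: measurable_funX.
move=> x _; rewrite /haar_weight -exprVn; congr (_ ^+ _)%R.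
have [->|d0] := eqVneq (\det (f x : 'M[K]_m)) 0%R; first by rewrite invr0 nabs0 invr0.
have := @nabsM _ _ mu nabs L (\det (f x : 'M[K]_m)) ((\det (f x : 'M[K]_m))^-1)%R.
rewrite divff// nabs1 => e; apply: (mulfI (lt0r_neq0 (nabs_gt0 d0))).
by rewrite -e divff// gt_eqF// nabs_gt0.
Qed.

Lemma measurable_haar_weightE d (X : measurableType d) m (f : X -> mxb m m) :
  measurable_fun setT f -> measurable_fun setT (fun x => (haar_weight (f x : 'M[K]_m))%:E).
Proof.
move=> mf.
exact (measurableT_comp (@EFin_measurable R setT) (measurable_haar_weight mf)).
Qed.

Lemma measurable_hint_integrand m (f : mxb m m -> \bar R) : measurable_fun setT f ->
  measurable_fun setT (fun x : mxb m m => f x * (haar_weight (x : 'M[K]_m))%:E).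
Proof.
move=> mf; apply: emeasurable_funM => //.
exact (measurable_haar_weightE (@measurable_id _ (mxb m m) setT)).
Qed.

Lemma hint_ge0 m (f : 'M[K]_m -> \bar R) : (forall x, 0 <= f x) -> 0 <= hint f.
Proof.
by move=> f0; apply: integral_ge0 => x _; rewrite mule_ge0// lee_fin haar_weight_ge0.
Qed.

Lemma hint_mull m (x : 'M[K]_m) (f : mxb m m -> \bar R) : x \in unitmx ->
  measurable_fun setT f -> (forall x, 0 <= f x) ->
  hint (fun y => f (x *m y)) = hint f.
Proof.
move=> xU mf f0; rewrite /hint.
have w0 := haar_weight_gt0 xU.
transitivity (\int[lam mu m m]_y ((haar_weight x)^-1%:E *
   (f (x *m (y : 'M[K]_m)) * (haar_weight (x *m (y : 'M[K]_m)))%:E))).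
  apply: eq_integral => y _; rewrite muleCA -EFinM haar_weightM.
  by rewrite mulrA mulVf ?mul1r// gt_eqF.
have mg := measurable_hint_integrand mf.
have mM : measurable_fun setT (mulmx x : mxb m m -> mxb m m).
  by apply: measurable_mulmx; [exact: measurable_cst|exact: measurable_id].
have g0 (y : mxb m m) : 0 <= f y * (haar_weight (y : 'M[K]_m))%:E.
  by rewrite mule_ge0// lee_fin haar_weight_ge0.
have c0 : 0 <= ((haar_weight x)^-1)%:E by rewrite lee_fin invr_ge0 ltW.
rewrite (ge0_integralZl (lam mu m m) measurableT (measurableT_comp mg mM) (fun y _ => g0 _) c0) /=.
rewrite (integral_mulmx xU mg g0) muleA -EFinM -/(haar_weight x) mulVf ?mul1e//.
by rewrite gt_eqF.
Qed.

Lemma hint_mulr m (x : 'M[K]_m) (f : mxb m m -> \bar R) : x \in unitmx ->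
  measurable_fun setT f -> (forall x, 0 <= f x) ->
  hint (fun y => f (y *m x)) = hint f.
Proof.
move=> xU mf f0; rewrite /hint.
have w0 := haar_weight_gt0 xU.
transitivity (\int[lam mu m m]_y ((haar_weight x)^-1%:E *
   (f ((y : 'M[K]_m) *m x) * (haar_weight ((y : 'M[K]_m) *m x))%:E))).
  apply: eq_integral => y _; rewrite muleCA -EFinM haar_weightM.
  by rewrite mulrCA mulVf ?mulr1// gt_eqF.
have mg := measurable_hint_integrand mf.
have mM : measurable_fun setT ((mulmx)^~ x : mxb m m -> mxb m m).
  by apply: measurable_mulmx; [exact: measurable_id|exact: measurable_cst].
have g0 (y : mxb m m) : 0 <= f y * (haar_weight (y : 'M[K]_m))%:E.
  by rewrite mule_ge0// lee_fin haar_weight_ge0.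
have c0 : 0 <= ((haar_weight x)^-1)%:E by rewrite lee_fin invr_ge0 ltW.
rewrite (ge0_integralZl (lam mu m m) measurableT (measurableT_comp mg mM) (fun y _ => g0 _) c0) /=.
rewrite (integral_mulmxr xU mg g0) muleA -EFinM -/(haar_weight x) mulVf ?mul1e//.
by rewrite gt_eqF.
Qed.

Lemma le_hint m (f g : mxb m m -> \bar R) : measurable_fun setT f ->
  measurable_fun setT g -> (forall x, 0 <= f x) ->
  (forall x : 'M[K]_m, x \in unitmx -> f x <= g x) -> hint f <= hint g.
Proof.
move=> mf mg f0 fg; apply: ge0_le_integral => //.
- by move=> x _; rewrite mule_ge0// lee_fin haar_weight_ge0.
- exact: measurable_hint_integrand.
- exact: measurable_hint_integrand.
- move=> x _; have [xU|xU] := boolP ((x : 'M[K]_m) \in unitmx); last first.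
    by rewrite haar_weight_sing// !mule0.
  by rewrite lee_wpmul2r ?fg// lee_fin haar_weight_ge0.
Qed.

Lemma eq_hint m (f g : 'M[K]_m -> \bar R) :
  (forall x : 'M[K]_m, x \in unitmx -> f x = g x) -> hint f = hint g.
Proof.
move=> fg; apply: eq_integral => x _.
have [xU|xU] := boolP ((x : 'M[K]_m) \in unitmx); first by rewrite fg.
by rewrite haar_weight_sing// !mule0.
Qed.

Lemma hintZl m (c : \bar R) (f : mxb m m -> \bar R) : 0 <= c ->
  measurable_fun setT f -> (forall x, 0 <= f x) ->
  hint (fun x => c * f x) = c * hint f.
Proof.
move=> c0 mf f0; rewrite /hint -ge0_integralZl//.
- by apply: eq_integral => x _; rewrite muleA.
- exact: measurable_hint_integrand.
- by move=> x _; rewrite mule_ge0// lee_fin haar_weight_ge0.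
Qed.

Lemma measurable_hint d (X : measurableType d) m (f : X -> mxb m m -> \bar R) :
  measurable_fun setT (fun z : X * mxb m m => f z.1 z.2) -> (forall x y, 0 <= f x y) ->
  measurable_fun setT (fun x => hint (f x)).
Proof.
move=> mf f0.
have mw : measurable_fun setT (fun z : X * mxb (K := K) m m => (haar_weight (z.2 : 'M[K]_m))%:E).
  exact (measurable_haar_weightE measurable_snd).
apply: (@measurable_integral _ _ _ _ _ (lam mu m m)
  (fun x (y : mxb m m) => f x y * (haar_weight (y : 'M[K]_m))%:E)).
  exact: emeasurable_funM.
by move=> x y; rewrite mule_ge0// lee_fin haar_weight_ge0.
Qed.

Lemma hint_swap m1 m2 (f : mxb m1 m1 -> mxb m2 m2 -> \bar R) :
  measurable_fun setT (fun z : mxb m1 m1 * mxb m2 m2 => f z.1 z.2) ->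
  (forall x y, 0 <= f x y) ->
  hint (fun x => hint (f x)) = hint (fun y => hint (f^~ y)).
Proof.
move=> mf f0; rewrite /hint.
have mw1 : measurable_fun setT (fun z : mxb (K := K) m1 m1 * mxb (K := K) m2 m2 => (haar_weight (z.1 : 'M[K]_m1))%:E).
  exact (measurable_haar_weightE measurable_fst).
have mw2 : measurable_fun setT (fun z : mxb (K := K) m1 m1 * mxb (K := K) m2 m2 => (haar_weight (z.2 : 'M[K]_m2))%:E).
  exact (measurable_haar_weightE measurable_snd).
have w0 m (x : 'M[K]_m) : 0 <= (haar_weight x)%:E by rewrite lee_fin haar_weight_ge0.
transitivity (\int[lam mu m1 m1]_x \int[lam mu m2 m2]_y
   (f x y * (haar_weight (y : 'M[K]_m2))%:E * (haar_weight (x : 'M[K]_m1))%:E)).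
  apply: eq_integral => x _; rewrite ge0_integralZr//.
    exact (emeasurable_funM (measurableT_comp mf (measurable_pair1 x))
      (measurableT_comp mw2 (measurable_pair1 x))).
  by move=> y _; rewrite mule_ge0.
have mg : measurable_fun setT (fun z : mxb (K := K) m1 m1 * mxb (K := K) m2 m2 =>
    f z.1 z.2 * (haar_weight (z.2 : 'M[K]_m2))%:E * (haar_weight (z.1 : 'M[K]_m1))%:E).
  exact (emeasurable_funM (emeasurable_funM mf mw2) mw1).
rewrite tonelli_swap; [|exact mg|by move=> x y; rewrite !mule_ge0].
apply: eq_integral => y _; rewrite -ge0_integralZr//.
- by apply: eq_integral => x _; rewrite -!muleA [X in _ * X]muleC.
- exact (emeasurable_funM (measurableT_comp mf (measurable_pair2 y))
    (measurableT_comp mw1 (measurable_pair2 y))).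
- by move=> x _; rewrite mule_ge0.
Qed.

End HaarFunctional.
Arguments haar_weight {R K} nabs {m} x.
Arguments hint {R K} mu nabs {m} f.

(** * Integrals of decaying functions and Tate integrals *)

Section Shells.
Context d (X : measurableType d) (R : realType) (la : {measure set X -> \bar R}).
Local Open Scope ereal_scope.

(** The recursion keeps every partial integral below A / (1 - t), the fixed point of I = A + t I;
    monotone convergence concludes. *)
Lemma shell_lty (f : X -> \bar R) (E : nat -> set X) (A t : R) :
  measurable_fun setT f -> (forall x, 0 <= f x) ->
  (forall j, measurable (E j)) -> (forall j, E j `<=` E j.+1) ->
  (0 <= t < 1)%R -> \int[la]_(x in E 0%N) f x <= A%:E ->
  (forall j, \int[la]_(x in E j.+1) f x <= A%:E + t%:E * \int[la]_(x in E j) f x) ->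
  \int[la]_(x in \bigcup_j E j) f x < +oo.
Proof.
move=> mf f0 mE ndE /andP[t0 t1] I0 Istep.
have A0 : (0 <= A)%R by rewrite -lee_fin (le_trans _ I0)// integral_ge0.
have t1' : (0 < 1 - t)%R by rewrite subr_gt0.
have bd j : \int[la]_(x in E j) f x <= (A / (1 - t))%:E.
  elim: j => [|j IH].
    by rewrite (le_trans I0)// lee_fin ler_pdivlMr// ler_piMr// gerBl.
  apply: (le_trans (Istep j)).
  apply: (@le_trans _ _ (A%:E + t%:E * (A / (1 - t))%:E)).
    by rewrite leeD2l// lee_wpmul2l.
  rewrite -EFinM -EFinD lee_fin le_eqVlt; apply/orP; left; apply/eqP.
  by field; rewrite gt_eqF.
have nd : nondecreasing_seq E.
  by apply/nondecreasing_seqP => j; apply/subsetPset; exact: ndE.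
have cv := @ge0_nondecreasing_set_cvg_integral _ _ _ E f la nd mE
  (fun i => measurable_funTS mf) (fun i x _ => f0 x).
apply: (@le_lt_trans _ _ (A / (1 - t))%:E); last exact: ltry.
rewrite -(cvg_lim _ cv)//; apply: lime_le; last by apply: nearW => j; exact: bd.
by apply/cvg_ex; eexists; exact: cv.
Qed.

End Shells.

Section Decay.
Context {R : realType} {K : absFieldType R}.
Context {mu : {sigma_finite_measure set (borel K) -> \bar R}} {nabs : K -> R}.
Context {L : local_haar mu nabs}.
Local Open Scope ereal_scope.

Definition decay N p q (x : 'M[K]_(p, q)) : R := ((1 + mx_size x) ^- N)%R.

Lemma decay_gt0 N p q (x : 'M[K]_(p, q)) : (0 < decay N x)%R.
Proof. by rewrite invr_gt0 exprn_gt0// ltr_wpDr// mx_size_ge0. Qed.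

Lemma decay_ge0 N p q (x : 'M[K]_(p, q)) : (0 <= decay N x)%R.
Proof. exact/ltW/decay_gt0. Qed.

Lemma decay_le1 N p q (x : 'M[K]_(p, q)) : (decay N x <= 1)%R.
Proof. by rewrite invf_le1 ?exprn_gt0 ?exprn_ege1 ?lerDl ?ltr_wpDr ?mx_size_ge0. Qed.

Lemma measurable_decay d (X : measurableType d) N p q (f : X -> mxb p q) :
  measurable_fun setT f -> measurable_fun setT (fun x => decay N (f x : 'M[K]_(p, q))).
Proof.
move=> mf; have h : measurable_fun setT (fun x => 1 + mx_size (f x : 'M[K]_(p, q)))%R.
  by apply: measurable_funD => //; exact: measurable_mx_size.
apply: (eq_measurable_fun (fun x => (1 + mx_size (f x : 'M[K]_(p, q))) `^ (- N%:R))%R).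
  by move=> x _; rewrite powRN powR_mulrn// addr_ge0// mx_size_ge0.
exact (measurableT_comp (measurable_powR _) h).
Qed.

Lemma integral_scalar p q (a : K) : a != 0%R ->
  forall H : mxb p q -> \bar R, measurable_fun setT H -> (forall x, 0 <= H x) ->
  \int[lam mu p q]_x H (a *: (x : 'M[K]_(p, q)))%R =
  (nabs a ^- (p * q))%:E * \int[lam mu p q]_x H x.
Proof.
move=> a0 H mH H0.
have := @integral_scale _ _ mu nabs L p q (const_mx a) _ H mH H0.
rewrite (_ : (\prod_i _)^-1%R = nabs a ^- (p * q))%R => [<-|].
- apply: eq_integral => x _; congr H; apply/matrixP => i j.
  by rewrite !mxE.
- by move=> i j; rewrite mxE.
congr (_^-1)%R; under eq_bigr do under eq_bigr do rewrite mxE.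
by under eq_bigr do rewrite prodr_const card_ord; rewrite prodr_const card_ord -exprM mulnC.
Qed.

Lemma measurable_size_le p q (r : R) : measurable ([set x : 'M[K]_(p, q) | (mx_size x <= r)%R] : set (mxb p q)).
Proof.
rewrite -[X in measurable X]setCK; apply: measurableC; apply: measurable_open_mxb.
by apply: closed_openC; exact: closed_mx_size_le.
Qed.

Lemma lam_size_le_lty p q : lam mu p q [set x : 'M[K]_(p, q) | (mx_size x <= 1)%R] < +oo.
Proof.
apply: (@le_lt_trans _ _ (lam mu p q (@cube _ K p q))).
  apply: le_measure; rewrite ?inE; [exact: measurable_size_le|exact: measurable_cube|].
  by move=> x /= h i j; exact: le_trans (absv_le_size _ _ _) h.
by rewrite lam_cube ltry.
Qed.

Lemma integral_decay_lty p q : exists N, \int[lam mu p q]_x (decay N (x : 'M[K]_(p, q)))%:E < +oo.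
Proof.
have [a a1] := exists_absv_gt1 (K := K).
have a0 : a != 0%R by rewrite -absv_gt0 (lt_trans ltr01).
pose k := (nabs a ^+ (p * q))%R.
have k0 : (0 < k)%R by rewrite exprn_gt0// nabs_gt0.
(* With this [t], 1 + |a| s >= t (1 + s) as soon as s >= 1: outside the unit ball, scaling by [a]
   divides the decay factor by at least t^N. *)
pose t := ((1 + absv a) / 2)%R.
have t1 : (1 < t)%R by rewrite /t; lra.
(* The substitution x -> a x costs the factor [k]; [N] is chosen so that the gain t^N beats it by a
   factor 2, which gives the ratio 1/2 of the shells. *)
have [N hN] := exp_unbounded (2 * k)%R t1.
have tN : (0 < t ^+ N)%R by rewrite exprn_gt0// (lt_trans ltr01).
exists N.
pose E j : set (mxb p q) := [set x : 'M[K]_(p, q) | (mx_size x <= absv a ^+ j)%R].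
have mE j : measurable (E j) by exact: measurable_size_le.
have ndE j : E j `<=` E j.+1.
  move=> x /=; rewrite /E /= => h; apply: le_trans h _.
  by rewrite exprS ler_peMl ?exprn_ge0 ?absv_ge0// ltW.
have -> : \int[lam mu p q]_x (decay N (x : 'M[K]_(p, q)))%:E =
    \int[lam mu p q]_(x in \bigcup_j E j) (decay N (x : 'M[K]_(p, q)))%:E.
  congr (integral _ _ _); apply/esym/seteqP; split => // x _.
  by have [j hj] := exp_unbounded (mx_size (x : 'M[K]_(p, q))) a1; exists j.
have mdec : measurable_fun setT (fun x : mxb p q => (decay N (x : 'M[K]_(p, q)))%:E).
  exact (measurableT_comp (@EFin_measurable R setT) (measurable_decay N (@measurable_id _ (mxb p q) setT))).
have dec0 (x : mxb p q) : 0 <= (decay N (x : 'M[K]_(p, q)))%:E by rewrite lee_fin decay_ge0.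
pose V := fine (lam mu p q (E 0%N)).
have VE : lam mu p q (E 0%N) = V%:E.
  rewrite fineK// ge0_fin_numE//; have := lam_size_le_lty p q.
  by rewrite /E expr0.
have V0 : (0 <= V)%R by rewrite fine_ge0.
apply: (@shell_lty _ _ _ _ _ E ((1 + k) * V)%R (1/2)%R) => //.
- by lra.
- apply: (@le_trans _ _ (\int[lam mu p q]_(x in E 0%N) 1%:E)).
    apply: ge0_le_integral => //; first exact: measurable_funTS.
    by move=> x _; rewrite lee_fin decay_le1.
  rewrite integral_cst// mul1e; apply: (@le_trans _ _ V%:E).
    by rewrite -VE; exact: lexx.
  by rewrite lee_fin ler_peMl// lerDl ltW.
move=> j; rewrite integral_mkcond.
pose g := (fun x : mxb p q => (decay N (x : 'M[K]_(p, q)))%:E) \_ (E j.+1).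
pose g' := (fun x : mxb p q => (decay N (x : 'M[K]_(p, q)))%:E) \_ (E j).
have mg : measurable_fun setT g by apply/(measurable_restrictT _ (mE _)); exact: measurable_funTS.
have mg' : measurable_fun setT g' by apply/(measurable_restrictT _ (mE _)); exact: measurable_funTS.
have g0 x : 0 <= g x by apply: erestrict_ge0 => y _; exact: dec0.
have g'0 x : 0 <= g' x by apply: erestrict_ge0 => y _; exact: dec0.
have := integral_scalar a0 mg g0; rewrite -/k => e.
have -> : \int[lam mu p q]_x g x = k%:E * \int[lam mu p q]_x g (a *: (x : 'M[K]_(p, q)))%R.
  by rewrite e muleA -EFinM divff ?mul1e// gt_eqF.
rewrite [X in _ + _ * X]integral_mkcond -/g'.
have mI : measurable_fun setT (fun x : mxb p q => (\1_(E 0%N) x)%:E : \bar R).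
  exact (measurableT_comp (@EFin_measurable R setT) (@measurable_indic _ _ R setT _ (mE 0%N))).
have mga : measurable_fun setT (fun x : mxb p q => g (a *: (x : 'M[K]_(p, q)))%R).
  apply: (measurableT_comp mg); apply/measurable_mxbP => i l.
  under eq_fun do rewrite mxE.
  by apply: measurable_absM; [exact: measurable_cst|exact: measurable_entry].
have mtg : measurable_fun setT (fun x : mxb p q => (t ^- N)%:E * g' x).
  by apply: emeasurable_funM => //; exact: measurable_cst.
have t0 : 0 <= (t ^- N)%:E by rewrite lee_fin invr_ge0 ltW.
have tg0 x : 0 <= (t ^- N)%:E * g' x by rewrite mule_ge0.
have I0 (x : mxb p q) : 0 <= (\1_(E 0%N) x)%:E :> \bar R by rewrite lee_fin.
(* A point with a x in the ball [E j.+1] lies in [E j]. If it is in the unit ball, bounding the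
   decay by 1 contributes at most [V]; otherwise the gain t^N applies. *)
have key : \int[lam mu p q]_x g (a *: (x : 'M[K]_(p, q)))%R <=
    V%:E + (t ^- N)%:E * \int[lam mu p q]_x g' x.
  rewrite -VE -(setIT (E 0%N)) -integral_indic// -ge0_integralZl// -ge0_integralD//.
  apply: ge0_le_integral => //; first exact: emeasurable_funD.
  move=> x _; rewrite {1}/g patchE; case: ifPn; last by rewrite adde_ge0.
  rewrite inE /E/= mx_sizeZ exprS ler_pM2l ?absv_gt0// => xj.
  rewrite /g' patchE mem_set//.
  have s0 := mx_size_ge0 (x : 'M[K]_(p, q)).
  have [x1|x1] := leP (mx_size (x : 'M[K]_(p, q))) 1%R.
    rewrite indicE mem_set/=; last by rewrite /E /= expr0.
    apply: (@le_trans _ _ 1%:E); first by rewrite lee_fin decay_le1.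
    by rewrite leeDl// mule_ge0.
  apply: (@le_trans _ _ ((t ^- N)%:E * (decay N (x : 'M[K]_(p, q)))%:E)); last by rewrite leeDr.
  rewrite -EFinM lee_fin /decay mx_sizeZ -invfM -exprMn lef_pV2 ?posrE.
  - rewrite lerXn2r ?nnegrE ?mulr_ge0//; rewrite /t; nra.
  - rewrite exprn_gt0//; nra.
  - rewrite exprn_gt0//; rewrite /t; nra.
apply: (@le_trans _ _ (k%:E * (V%:E + (t ^- N)%:E * \int[lam mu p q]_x g' x))).
  by rewrite lee_wpmul2l// lee_fin ltW.
have Ig'0 : 0 <= \int[lam mu p q]_x g' x by exact: integral_ge0.
rewrite ge0_muleDr ?lee_fin//; last by rewrite mule_ge0.
apply: leeD; first by rewrite -EFinM lee_fin ler_wpM2r// lerDr.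
rewrite muleA -EFinM lee_wpmul2r// lee_fin.
by rewrite ler_pdivrMr//; lra.
Qed.

End Decay.

Section Tate.
Context {R : realType} {K : absFieldType R}.
Context {mu : {sigma_finite_measure set (borel K) -> \bar R}} {nabs : K -> R}.
Context {L : local_haar mu nabs}.
Local Open Scope ereal_scope.

Lemma mx_size11 (x : 'M[K]_1) : mx_size x = absv (x 0 0)%R.
Proof. by rewrite /mx_size !big_ord1. Qed.

Lemma measurable_nabs_entry (e : R) p q i j :
  measurable_fun setT (fun x : mxb p q => (nabs ((x : 'M[K]_(p, q)) i j) `^ e)%R).
Proof.
exact (measurableT_comp (measurable_powR e) (measurable_nabs (@measurable_entry R K p q i j))).
Qed.

(** The exponent may have either sign; since y <= 1, the worst case is -|e|. *)
Lemma powR_le_annulus (k e y : R) : (0 < k)%R -> (k^-1 <= y <= 1)%R ->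
  (y `^ e <= (k^-1 `^ `|e|)^-1)%R.
Proof.
move=> k0 /andP[ky y1]; have k1 : (0 < k^-1)%R by rewrite invr_gt0.
have y0 : (0 < y)%R by exact: lt_le_trans ky.
apply: (@le_trans _ _ (y `^ (- `|e|))%R).
  by apply: ger_powR; [rewrite y0|rewrite lerNl -normrN ler_norm].
rewrite powRN lef_pV2 ?posrE ?powR_gt0//.
by apply: (ge0_ler_powR (normr_ge0 e)); rewrite ?nnegrE // ltW.
Qed.

(** Scaling by [a] carries each small annulus to the next larger one and multiplies the integral
    over it by nabs a^(1+e). The ratio of the shells is thus the inverse [t] of this number, which
    is below 1 because e > -1. *)
Lemma integral_tate_unit (e : R) : (-1 < e)%R ->
  \int[lam mu 1 1]_(x in [set x : 'M[K]_1 | (mx_size x <= 1)%R])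
    (nabs ((x : 'M[K]_1) 0 0)%R `^ e)%:E < +oo.
Proof.
move=> e1; have [a a1] := exists_absv_gt1 (K := K).
have a0 : a != 0%R by rewrite -absv_gt0 (lt_trans ltr01).
have k1 : (1 < nabs a)%R by exact: nabs_gt1.
have k0 : (0 < nabs a)%R by exact: lt_trans ltr01 k1.
pose D : set (mxb 1 1) := [set x : 'M[K]_1 | (mx_size x <= 1)%R].
(* The unit disk minus a punctured small disk: the origin is kept, so that the sets exhaust the
   whole disk. *)
pose E j : set (mxb 1 1) := D `\` ([set x : 'M[K]_1 | (mx_size x <= absv a ^- j)%R] `\`
   [set x : 'M[K]_1 | (mx_size x <= 0)%R]).
have mD : measurable D by exact: measurable_size_le.
have mE j : measurable (E j).
  by apply: measurableD => //; apply: measurableD; exact: measurable_size_le.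
have aj j : (0 < absv a ^+ j)%R by rewrite exprn_gt0// (lt_trans ltr01).
have ndE j : E j `<=` E j.+1.
  move=> x [Dx nx]; split => // -[/= h1 h2]; apply: nx; split => //=.
  apply: le_trans h1 _; rewrite lef_pV2 ?posrE// exprS ler_peMl//; exact: ltW.
have DE : D = \bigcup_j E j.
  apply/seteqP; split => [x Dx|x [j _ []]//].
  have [x0|x0] := leP (mx_size (x : 'M[K]_1)) 0%R.
    by exists 0%N => //; split => // -[].
  have [j hj] := exp_unbounded ((mx_size (x : 'M[K]_1))^-1 + 1)%R a1.
  exists j => //; split => // -[/= h _].
  have : ((absv a ^+ j)^-1 < mx_size (x : 'M[K]_1))%R.
    rewrite -[X in (_ < X)%R]invrK ltf_pV2 ?posrE ?invr_gt0//.
    by apply: lt_le_trans hj; rewrite ltrDl.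
  by rewrite ltNge h.
pose f (x : mxb 1 1) : \bar R := (nabs ((x : 'M[K]_1) 0 0)%R `^ e)%:E.
have mf : measurable_fun setT f.
  exact (measurableT_comp (@EFin_measurable R setT) (@measurable_nabs_entry e 1 1 0 0)%R).
have f0 x : 0 <= f x by rewrite lee_fin powR_ge0.
rewrite -/D DE.
pose V := fine (lam mu 1 1 D).
have VE : lam mu 1 1 D = V%:E.
  by rewrite fineK// ge0_fin_numE//; exact: lam_size_le_lty.
have V0 : (0 <= V)%R by rewrite fine_ge0.
(* The summand 1 serves the origin, where the power of 0 is 1 for e = 0 and 0 otherwise. *)
pose B := (1 + ((nabs a)^-1 `^ `|e|)^-1)%R.
have B0 : (0 <= B)%R by rewrite addr_ge0// invr_ge0 powR_ge0.
have E1 : \int[lam mu 1 1]_(x in E 1%N) f x <= (B * V)%:E.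
  apply: (@le_trans _ _ (\int[lam mu 1 1]_(x in E 1%N) B%:E)).
    apply: ge0_le_integral => //; first exact: measurable_funTS.
    move=> x [Dx nx]; rewrite lee_fin /B.
    have [x0|x0] := eqVneq ((x : 'M[K]_1) 0 0)%R 0%R.
      rewrite x0 nabs0 {1}/powR eqxx; case: (e == 0)%R; rewrite /=; last first.
        by rewrite addr_ge0// invr_ge0 powR_ge0.
      by rewrite lerDl invr_ge0 powR_ge0.
    apply: (@le_trans _ _ (((nabs a)^-1 `^ `|e|)^-1)%R); last by rewrite lerDr.
    apply: powR_le_annulus => //; apply/andP; split.
      have iE : (nabs a^-1 = (nabs a)^-1)%R.
        by apply: (mulfI (lt0r_neq0 k0)); rewrite -nabsM !divff ?gt_eqF// nabs1.
      rewrite -iE nabs_mono ?invr_neq0// absvV leNgt; apply/negP => h.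
      apply: nx; split => /=; rewrite mx_size11; first by rewrite expr1 ltW.
      by apply/negP; rewrite -ltNge absv_gt0.
    by rewrite -nabs1 nabs_mono// absv1 -mx_size11.
  rewrite integral_cst// EFinM; apply: lee_wpmul2l; first by rewrite lee_fin.
  rewrite -VE; apply: (le_measure (lam mu 1 1)); rewrite ?inE; first by [].
    by [].
  by move=> x [].
pose t := (nabs a `^ (- (1 + e)))%R.
have tk : t = ((nabs a)^-1 * nabs a `^ (- e))%R.
  rewrite /t opprD powRD; last by rewrite (gt_eqF k0) implybT.
  by rewrite (powRN _ 1) powRr1// ltW.
apply: (@shell_lty _ _ _ _ f E (B * V)%R t) => //.
- rewrite powR_ge0 /t /=; apply: (@lt_le_trans _ _ (nabs a `^ 0)%R); last by rewrite powRr0.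
  rewrite /powR !gt_eqF// ltr_expR mul0r mulNr oppr_lt0 mulr_gt0 ?ln_gt0//; lra.
- apply: le_trans E1; apply: ge0_subset_integral => //; exact: measurable_funTS.
move=> j; apply: (@le_trans _ _ (\int[lam mu 1 1]_(x in E 1%N) f x +
   t%:E * \int[lam mu 1 1]_(x in E j) f x)); last by rewrite leeD2r.
rewrite [leLHS]integral_mkcond [X in _ <= X + _]integral_mkcond.
rewrite [X in _ <= _ + _ * X]integral_mkcond.
have mr i : measurable_fun setT (f \_ (E i)).
  by apply/(measurable_restrictT _ (mE _)); exact: measurable_funTS.
have r0 i x : 0 <= (f \_ (E i)) x by apply: erestrict_ge0.
have ej := @integral_scalar _ _ mu nabs L 1 1 a a0 _ (mr j) (r0 j).
rewrite (_ : nabs a ^- (1 * 1) = (nabs a)^-1)%R in ej; last by rewrite mul1n expr1.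
rewrite tk mulrC EFinM -muleA -ej.
have c0 : 0 <= (nabs a `^ (- e))%:E by rewrite lee_fin powR_ge0.
have mra : measurable_fun setT (fun x : mxb 1 1 => (f \_ (E j)) (a *: (x : 'M[K]_1))%R).
  apply: (measurableT_comp (mr j)); apply/measurable_mxbP => i l.
  under eq_fun do rewrite mxE.
  by apply: measurable_absM; [exact: measurable_cst|exact: measurable_entry].
have mcr : measurable_fun setT (fun x : mxb 1 1 =>
    (nabs a `^ (- e))%:E * (f \_ (E j)) (a *: (x : 'M[K]_1))%R).
  by apply: emeasurable_funM => //; exact: measurable_cst.
rewrite -ge0_integralZl// -ge0_integralD//; last by move=> x _; rewrite mule_ge0.
apply: ge0_le_integral => //; first exact: emeasurable_funD.
move=> x _; rewrite [leLHS]patchE; case: ifPn => [|_]; last by rewrite adde_ge0// mule_ge0.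
rewrite inE => -[Dx nx].
have [E1x|nE1x] := pselect (E 1%N x).
  by rewrite [X in X + _]patchE mem_set// leeDl// mule_ge0.
have [x0 xa] : (0 < mx_size (x : 'M[K]_1) /\ mx_size (x : 'M[K]_1) <= (absv a)^-1)%R.
  apply: contrapT => h; apply: nE1x; split => // -[/= h1 h2]; apply: h; split.
    by rewrite ltNge; apply/negP.
  by move: h1; rewrite expr1.
have Ej : E j (a *: (x : 'M[K]_1))%R.
  split; first by rewrite /D/= mx_sizeZ -ler_pdivlMl ?mulr1// (lt_trans ltr01).
  move=> [/= h1 h2]; apply: nx; split => /=; last by apply/negP; rewrite -ltNge.
  by move: h1; rewrite mx_sizeZ exprS invfM ler_pdivlMl// (lt_trans ltr01).
rewrite [X in _ <= _ + _ * X]patchE mem_set//.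
rewrite [X in _ <= _ + X](_ : _ = f x); first by rewrite leeDr.
rewrite /f mxE nabsM -EFinM powRM ?nabs_ge0// mulrA -powRD.
  by rewrite addNr powRr0 mul1r.
by rewrite (gt_eqF k0) implybT.
Qed.

Lemma integral_tate (e : R) : (-1 < e)%R -> exists N,
  \int[lam mu 1 1]_x (nabs ((x : 'M[K]_1) 0 0)%R `^ e * decay N (x : 'M[K]_1))%:E < +oo.
Proof.
move=> e1; have [N hN] := @integral_decay_lty _ _ mu nabs L 1 1.
(* Outside the unit disk the integrand grows at most like |x|^(c e), which [k] additional powers of
   decay absorb. *)
pose c := @nabs_exponent R K nabs; pose k := Num.bound (`|c * e|)%R.
exists (N + k)%N.
pose D : set (mxb 1 1) := [set x : 'M[K]_1 | (mx_size x <= 1)%R].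
have mD : measurable D by exact: measurable_size_le.
pose f (x : mxb 1 1) : \bar R := (nabs ((x : 'M[K]_1) 0 0)%R `^ e)%:E.
have mf : measurable_fun setT f.
  exact (measurableT_comp (@EFin_measurable R setT) (@measurable_nabs_entry e 1 1 0 0)%R).
have f0 x : 0 <= f x by rewrite lee_fin powR_ge0.
have mr : measurable_fun setT (f \_ D).
  by apply/(measurable_restrictT _ mD); exact: measurable_funTS.
have r0 x : 0 <= (f \_ D) x by apply: erestrict_ge0.
have mdec n : measurable_fun setT (fun x : mxb 1 1 => (decay n (x : 'M[K]_1))%:E).
  exact (measurableT_comp (@EFin_measurable R setT) (measurable_decay n (@measurable_id _ (mxb 1 1) setT))).
apply: (@le_lt_trans _ _ (\int[lam mu 1 1]_x ((f \_ D) x + (decay N (x : 'M[K]_1))%:E))).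
  apply: ge0_le_integral => //.
  - by move=> x _; rewrite lee_fin mulr_ge0 ?powR_ge0// decay_ge0.
  - apply: (eq_measurable_fun (fun x : mxb 1 1 => f x * (decay (N + k) (x : 'M[K]_1))%:E)) => //.
    exact: emeasurable_funM.
  - exact: emeasurable_funD.
  move=> x _; have dx0 n : (0 <= decay n (x : 'M[K]_1))%R by exact: decay_ge0.
  have [xD|xD] := boolP (x \in D).
    rewrite patchE xD -[leLHS]adde0; apply: leeD; last by rewrite lee_fin.
    by rewrite /f lee_fin ler_piMr ?powR_ge0// decay_le1.
  rewrite patchE (negbTE xD) add0e lee_fin.
  have s1 : (1 < mx_size (x : 'M[K]_1))%R.
    by rewrite ltNge; apply/negP => h; move/negP: xD; apply; exact/mem_set.
  rewrite /decay exprD invfM mulrCA ler_piMr ?invr_ge0 ?exprn_ge0//.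
    by rewrite addr_ge0// mx_size_ge0.
  rewrite ler_pdivrMr ?mul1r; last by rewrite exprn_gt0//; lra.
  rewrite nabsE -powRrM -mx_size11 -/c.
  apply: (@le_trans _ _ (mx_size (x : 'M[K]_1) `^ k%:R)%R).
    apply: ler_powR; first exact: ltW.
    by apply: le_trans (ler_norm _) _; apply: ltW; exact: archi_boundP.
  rewrite powR_mulrn; last by lra.
  by apply: lerXn2r; rewrite ?nnegrE; lra.
have d0 (x : mxb 1 1) : setT x -> 0 <= (decay N (x : 'M[K]_1))%:E.
  by move=> _; rewrite lee_fin decay_ge0.
rewrite (ge0_integralD (lam mu 1 1) measurableT (fun x _ => r0 x) mr d0 (mdec N)).
rewrite lte_add_pinfty// -integral_mkcond.
exact: integral_tate_unit.
Qed.

End Tate.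

Lemma invmx_mulmx (F : fieldType) m (A B : 'M[F]_m) : A \in unitmx -> B \in unitmx ->
  invmx (A *m B) = invmx B *m invmx A.
Proof.
move=> AU BU; have ABU : A *m B \in unitmx by rewrite unitmx_mul AU.
apply: (can_inj (mulKmx ABU)); rewrite mulmxV// mulmxA -(mulmxA A) mulmxV// mulmx1.
by rewrite mulmxV.
Qed.

(** * Invariance of Haar measure on GL under inverse transpose *)

Section HaarInversion.
Context {R : realType} {K : absFieldType R}.
Context {mu : {sigma_finite_measure set (borel K) -> \bar R}} {nabs : K -> R}.
Context {L : local_haar mu nabs}.
Local Open Scope ereal_scope.

Lemma lam_shift p q (v : 'M[K]_(p, q)) (A : set (mxb p q)) : measurable A ->
  lam mu p q [set x : mxb p q | A ((x : 'M[K]_(p, q)) + v)%R] = lam mu p q A.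
Proof.
move=> mA.
have ms : measurable_fun [set: mxb p q] (fun x => ((x : 'M[K]_(p, q)) + v)%R : mxb p q).
  by apply: measurable_addmx; [exact: measurable_id|exact: measurable_cst].
have mB : measurable [set x : mxb p q | A ((x : 'M[K]_(p, q)) + v)%R].
  by have := ms measurableT _ mA; rewrite setTI.
have mI : measurable_fun setT (fun x : mxb p q => (\1_A x)%:E : \bar R).
  exact (measurableT_comp (@EFin_measurable R setT) (@measurable_indic _ _ R setT _ mA)).
have := @integral_lam_shift _ _ mu nabs L p q v _ mI (fun x => _).
move=> /(_ ltac:(by move=> x; rewrite lee_fin)).
have eA := @integral_indic _ _ _ (lam mu p q) setT measurableT _ mA.
have eB := @integral_indic _ _ _ (lam mu p q) setT measurableT _ mB.
rewrite setIT in eA; rewrite setIT in eB.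
by move=> e; refine (eq_trans (esym eB) (eq_trans e eA)).
Qed.

(** GL is open, so it contains a polydisk around the identity. The radius is taken to be the
    absolute value of a nonzero element, since volumes of polydisks are known for such radii. *)
Lemma lam_GL_gt0 m : 0 < lam mu m m (@GL R K m).
Proof.
have [P hP PG] : nbhs (1%:M : 'M[K]_m) (@GL R K m).
  by apply: open_nbhs_nbhs; split; [exact: open_GL|exact: unitmx1].
have [pi pi1] := exists_absv_gt1 (K := K).
have p0 : pi != 0%R by rewrite -absv_gt0 (lt_trans ltr01).
have [a a0 ha] : exists2 a : K, a != 0%R & forall ij (x : K), (absv x <= absv a)%R ->
    P ij.1 ij.2 (x + (1%:M : 'M[K]_m) ij.1 ij.2)%R.
  have : \forall k \near \oo, forall ij,
      ball ((1%:M : 'M[K]_m) ij.1 ij.2) (k.+1%:R^-1 : R)%R `<=` P ij.1 ij.2.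
    apply: filter_forall => -[i j] /=; have /nbhs_ballP[e /= e0 eP] := hP i j.
    apply: filterS (near_infty_natSinv_lt (PosNum e0)) => k /= hk.
    by apply: subset_trans eP; apply: le_ball; exact: ltW.
  move=> [k _ /(_ k (leqnn k)) hk].
  have [n hn] := exp_unbounded (k.+1%:R + 1)%R pi1.
  exists (pi ^- n)%R; first by rewrite invr_neq0// expf_neq0.
  move=> ij x xa; apply: hk; rewrite /ball/= /absdist opprD addrCA subrr addr0 absvN.
  apply: le_lt_trans xa _; rewrite absvV absvX ltf_pV2 ?posrE//.
    by apply: lt_le_trans hn; rewrite ltrDl.
  by rewrite exprn_gt0// (lt_trans ltr01).
have D0 i j : (const_mx a : 'M[K]_m) i j != 0%R by rewrite mxE.
pose B : set (mxb m m) := [set x : 'M[K]_m | forall i j, (absv (x i j) <= absv ((const_mx a : 'M[K]_m) i j))%R].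
have lB : 0 < lam mu m m B.
  rewrite (lam_disks D0) lte_fin; apply: prodr_gt0 => i _; apply: prodr_gt0 => j _.
  by rewrite mulr_gt0 ?disk_volume_gt0// nabs_gt0.
have mB : measurable B.
  rewrite (_ : B = \bigcap_(ij in [set: 'I_m * 'I_m])
    ((fun x : mxb m m => x ij.1 ij.2 : borel K) @^-1` disk (absv a))).
    apply: fin_bigcap_measurable => // ij _; rewrite -[X in measurable X]setTI.
    by apply: measurable_entry => //; exact: measurable_disk.
  apply/seteqP; split => [x h ij _|x h i j].
    by have := h ij.1 ij.2; rewrite mxE.
  by rewrite mxE; exact: (h (i, j)).
apply: (lt_le_trans lB); rewrite -(lam_shift (- 1%:M) mB).
have ms : measurable_fun [set: mxb m m] (fun x => ((x : 'M[K]_m) - 1%:M)%R : mxb m m).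
  by apply: measurable_addmx; [exact: measurable_id|exact: measurable_cst].
apply: le_measure; rewrite ?inE.
- by have := ms measurableT _ mB; rewrite setTI.
- exact: measurable_GL.
move=> x Bx; apply: PG => i j; have := Bx i j; rewrite [in X in (_ <= X)%R]mxE.
move=> /(ha (i, j)) /=.
by rewrite (_ : _ + _ = (x : 'M[K]_m) i j)%R// !mxE subrK.
Qed.

(** If the integral vanished, the integrand would vanish off a null set, and this null set would
    contain GL. *)
Lemma hint_gt0 m (f : mxb m m -> \bar R) : measurable_fun setT f ->
  (forall x, 0 <= f x) -> (forall x : 'M[K]_m, x \in unitmx -> 0 < f x) ->
  0 < hint mu nabs f.
Proof.
move=> mf f0 fpos; rewrite lt_neqAle (hint_ge0 f0) andbT eq_sym; apply/eqP => h0.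
have mg := @measurable_hint_integrand _ _ mu nabs L m f mf.
have g0 (x : mxb m m) : 0 <= f x * (haar_weight nabs (x : 'M[K]_m))%:E.
  by rewrite mule_ge0// lee_fin haar_weight_ge0.
have [N [mN N0 hN]] : ae_eq (lam mu m m) setT
    (fun x : mxb m m => f x * (haar_weight nabs (x : 'M[K]_m))%:E) (cst 0).
  apply/(ae_eq_integral_abs (lam mu m m) measurableT mg); rewrite -h0.
  by apply: eq_integral => x _; rewrite gee0_abs.
have : lam mu m m (@GL R K m) <= lam mu m m N.
  apply: le_measure; rewrite ?inE; [exact: measurable_GL|exact: mN|].
  move=> x xU; apply: hN => /(_ I) /eqP; rewrite mule_eq0 => /orP[/eqP e|/eqP[]].
    by have := fpos x xU; rewrite e ltxx.
  by move=> e; have := @haar_weight_gt0 _ _ mu nabs L _ _ xU; rewrite e ltxx.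
have N0' : lam mu m m N = 0 by exact N0.
by rewrite N0' leNgt lam_GL_gt0.
Qed.

Lemma measurable_iota d (X : measurableType d) m (f : X -> mxb m m) :
  measurable_fun setT f ->
  measurable_fun setT (fun x => iota_mx (f x : 'M[K]_m) : mxb m m).
Proof. by move=> mf; apply: measurable_trmx; exact: measurable_invmx. Qed.

(** The weight is a fixed power of |det x^-1|, which is polynomially bounded in the entries of the
    inverse. *)
Lemma haar_weight_bound m : exists (C : R) (k : nat), (0 <= C)%R /\ forall x : 'M[K]_m,
  x \in unitmx -> (haar_weight nabs x <= C * (1 + mx_size (invmx x)) ^+ k)%R.
Proof.
have [C hC] := @absv_det_le R K m.
pose c := @nabs_exponent R K nabs.
have c0 : (0 <= c)%R by apply: ltW; exact: nabs_exponent_gt0.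
pose C1 := `|C|%R; have C10 : (0 <= C1)%R by exact: normr_ge0.
exists (C1 `^ (c * m%:R))%R, (m * Num.bound (c * m%:R)%R)%N.
split=> [|x xU]; first exact: powR_ge0.
have s0 := mx_size_ge0 (invmx x).
have dx0 : \det x != 0%R by rewrite -unitfE -unitmxE.
have -> : haar_weight nabs x = (absv (\det (invmx x)) `^ (c * m%:R))%R.
  rewrite /haar_weight det_inv absvV nabsE powRrM powR_mulrn ?powR_ge0//.
  by rewrite -exprVn -powRN -[in RHS]powR_inv1 ?absv_ge0// -powRrM mulN1r.
apply: (@le_trans _ _ ((C1 * (1 + mx_size (invmx x)) ^+ m) `^ (c * m%:R))%R).
  have e0 : (0 <= c * m%:R)%R by rewrite mulr_ge0.
  apply: (ge0_ler_powR e0); rewrite ?nnegrE ?absv_ge0 ?mulr_ge0 ?exprn_ge0 ?addr_ge0//.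
  apply: le_trans (hC _) _; apply: (@le_trans _ _ (C1 * mx_size (invmx x) ^+ m)%R).
    by rewrite ler_wpM2r ?exprn_ge0 ?ler_norm.
  by apply: ler_wpM2l => //; rewrite lerXn2r ?nnegrE ?addr_ge0// lerDr.
rewrite powRM ?exprn_ge0 ?addr_ge0// ler_wpM2l ?powR_ge0//.
rewrite exprM -[leRHS]powR_mulrn ?exprn_ge0 ?addr_ge0//.
apply: ler_powR; first by rewrite exprn_ege1// lerDl.
by apply: ltW; apply: archi_boundP; rewrite mulr_ge0.
Qed.

(** A function to be cancelled in the uniqueness argument. It is a negative power of 1 + |x| +
    |x^-1|, symmetric under [iota_mx]; [k] of the powers pay for the Haar weight and [N] for
    convergence. *)
Lemma hint_test_function m : exists F : mxb m m -> \bar R,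
  [/\ measurable_fun setT F, forall x, 0 <= F x,
      forall x : 'M[K]_m, x \in unitmx -> F (iota_mx x) = F x,
      0 < hint mu nabs F & hint mu nabs F < +oo].
Proof.
have [N hN] := @integral_decay_lty _ _ mu nabs L m m.
have [C [k [C0 hk]]] := haar_weight_bound m.
pose s (x : mxb m m) := (1 + mx_size (x : 'M[K]_m) + mx_size (invmx (x : 'M[K]_m)))%R.
have s0 x : (0 < s x)%R by rewrite /s ltr_wpDr ?mx_size_ge0// ltr_wpDr ?mx_size_ge0.
pose F (x : mxb m m) : \bar R := (s x ^- (N + k))%:E.
have ms : measurable_fun setT s.
  apply: measurable_funD; last first.
    by apply: measurable_mx_size; apply: measurable_invmx; exact: measurable_id.
  by apply: measurable_funD => //; apply: measurable_mx_size; exact: measurable_id.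
have mF : measurable_fun setT F.
  apply: (eq_measurable_fun (fun x => (s x `^ (- (N + k)%:R))%:E)).
    by move=> x _; rewrite powRN powR_mulrn// ltW.
  apply: (measurableT_comp (@EFin_measurable R setT)).
  exact (measurableT_comp (measurable_powR _) ms).
have F0 x : 0 <= F x by rewrite lee_fin invr_ge0 exprn_ge0// ltW.
exists F; split => //.
- move=> x xU; rewrite /F /s /iota_mx; congr ((_ ^- _)%:E).
  by rewrite -trmx_inv invmxK !mx_sizeT addrAC.
- by apply: hint_gt0 => // x _; rewrite lte_fin invr_gt0 exprn_gt0.
apply: (@le_lt_trans _ _ (\int[lam mu m m]_x (C%:E * (decay N (x : 'M[K]_m))%:E))).
  have mdec : measurable_fun setT (fun x : mxb m m => (decay N (x : 'M[K]_m))%:E).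
    exact (measurableT_comp (@EFin_measurable R setT) (measurable_decay N (@measurable_id _ (mxb m m) setT))).
  apply: ge0_le_integral => //.
  - by move=> x _; rewrite mule_ge0// lee_fin haar_weight_ge0.
  - exact: measurable_hint_integrand.
  - by apply: emeasurable_funM => //; exact: measurable_cst.
  move=> x _; have [xU|xU] := boolP ((x : 'M[K]_m) \in unitmx); last first.
    by rewrite haar_weight_sing// mule0 mule_ge0// lee_fin ?decay_ge0.
  have sx0 := mx_size_ge0 (x : 'M[K]_m); have si0 := mx_size_ge0 (invmx (x : 'M[K]_m)).
  rewrite /F /decay -!EFinM lee_fin.
  apply: (@le_trans _ _ (s x ^- (N + k) * (C * s x ^+ k))%R).
    apply: ler_wpM2l; first by rewrite invr_ge0 exprn_ge0// ltW.
    apply: le_trans (hk _ xU) _; rewrite ler_wpM2l// lerXn2r ?nnegrE ?addr_ge0//.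
    by rewrite /s -addrA lerD2l lerDr.
  rewrite mulrCA exprD invfM -mulrA mulVf ?mulr1; last by rewrite expf_neq0// gt_eqF.
  rewrite ler_wpM2l// lef_pV2 ?posrE ?exprn_gt0//; last by rewrite ltr_wpDr.
  by rewrite lerXn2r ?nnegrE ?addr_ge0// /s lerDl.
rewrite ge0_integralZl//.
- by rewrite lte_mul_pinfty// lee_fin.
- exact (measurableT_comp (@EFin_measurable R setT) (measurable_decay N (@measurable_id _ (mxb m m) setT))).
- by move=> x _; rewrite lee_fin decay_ge0.
Qed.

(* Uniqueness of Haar measure: [th] is only used through
   [th (x' y) = x^-1 th y], so it may be the identity or [iota_mx]. *)
Lemma hint_twist m (th : 'M[K]_m -> 'M[K]_m) (F H : mxb m m -> \bar R) :
  measurable_fun setT (th : mxb m m -> mxb m m) ->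
  (forall x, x \in unitmx -> th x \in unitmx) ->
  (forall x, x \in unitmx -> exists2 x', x' \in unitmx &
     forall y, y \in unitmx -> th (x' *m y) = invmx x *m th y) ->
  measurable_fun setT F -> (forall x, 0 <= F x) ->
  measurable_fun setT H -> (forall x, 0 <= H x) ->
  hint mu nabs F * hint mu nabs (fun y => H (th y)) =
  hint mu nabs (fun y => F (th y)) * hint mu nabs (fun x => H (invmx x)).
Proof.
move=> mth thU thx mF F0 mH H0.
have mHth : measurable_fun setT (fun y : mxb m m => H (th y)) by exact (measurableT_comp mH mth).
have mFth : measurable_fun setT (fun y : mxb m m => F (th y)) by exact (measurableT_comp mF mth).
have minv : measurable_fun setT (fun y : mxb m m => invmx (y : 'M[K]_m) : mxb m m).
  by apply: measurable_invmx; exact: measurable_id.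
have mHi : measurable_fun setT (fun y : mxb m m => H (invmx (y : 'M[K]_m))) by exact (measurableT_comp mH minv).
have mth1 : measurable_fun setT (fun z : mxb (K := K) m m * mxb (K := K) m m => th z.1 : mxb m m).
  exact (measurableT_comp mth measurable_fst).
have mth2 : measurable_fun setT (fun z : mxb (K := K) m m * mxb (K := K) m m => th z.2 : mxb m m).
  exact (measurableT_comp mth measurable_snd).
have mi1 : measurable_fun setT (fun z : mxb (K := K) m m * mxb (K := K) m m => invmx (z.1 : 'M[K]_m) : mxb m m).
  exact (measurableT_comp minv measurable_fst).
have mi2 : measurable_fun setT (fun z : mxb (K := K) m m * mxb (K := K) m m => invmx (z.2 : 'M[K]_m) : mxb m m).
  exact (measurableT_comp minv measurable_snd).
have ge0 : 0 <= hint mu nabs F by exact: hint_ge0.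
rewrite -hintZl//.
transitivity (hint mu nabs (fun y => hint mu nabs (fun x => F (x *m th y) * H (th y)))).
  apply: eq_hint => y yU; rewrite muleC -hintZl//.
  rewrite -(hint_mulr (thU _ yU))//; last by move=> x; exact: mule_ge0.
    by apply: eq_hint => x xU; rewrite muleC.
  by apply: emeasurable_funM => //; exact: measurable_cst.
have m1 : measurable_fun setT (fun z : mxb (K := K) m m * mxb (K := K) m m =>
    F ((z.2 : 'M[K]_m) *m th z.1) * H (th z.1)).
  apply: emeasurable_funM; last exact (measurableT_comp mH mth1).
  apply: (measurableT_comp mF); apply: measurable_mulmx => //; exact: measurable_snd.
rewrite (@hint_swap _ _ _ _ _ _ _ (fun y x => F (x *m th y) * H (th y)) m1); last first.
  by move=> x y; exact: mule_ge0.
(* Left invariance in [y]: replacing [y] by x' y turns th y into x^-1 (th y), and the factor [x] in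
   the argument of [F] cancels. *)
transitivity (hint mu nabs (fun x => hint mu nabs (fun y => F (th y) * H (invmx x *m th y)))).
  apply: eq_hint => x xU; have [x' x'U hx'] := thx _ xU.
  have m2 : measurable_fun setT (fun y : mxb m m => F (x *m th y) * H (th y)).
    by apply: emeasurable_funM => //; apply: (measurableT_comp mF);
      apply: measurable_mulmx => //; exact: measurable_cst.
  rewrite -(hint_mull x'U m2); last by move=> y; exact: mule_ge0.
  by apply: eq_hint => y yU; rewrite hx'// mulKVmx.
have m3 : measurable_fun setT (fun z : mxb (K := K) m m * mxb (K := K) m m =>
    F (th z.2) * H (invmx (z.1 : 'M[K]_m) *m th z.2)).
  apply: emeasurable_funM; first exact (measurableT_comp mF mth2).
  apply: (measurableT_comp mH); exact: measurable_mulmx.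
rewrite (@hint_swap _ _ _ _ _ _ _ (fun x y => F (th y) * H (invmx x *m th y)) m3); last first.
  by move=> x y; exact: mule_ge0.
have ge0' : 0 <= hint mu nabs (fun x => H (invmx x)) by exact: hint_ge0.
rewrite muleC -hintZl//; apply: eq_hint => y yU; rewrite muleC.
have m4 : measurable_fun setT (fun x : mxb m m => H (invmx (x : 'M[K]_m) *m th y)).
  apply: (measurableT_comp mH); apply: measurable_mulmx => //; exact: measurable_cst.
rewrite hintZl//; congr (_ * _).
(* Here [x] is replaced by (th y) x, whose inverse times th y is x^-1. *)
rewrite -(hint_mull (thU _ yU) m4)//; apply: eq_hint => x xU.
by rewrite invmx_mulmx ?thU// mulmxKV// thU.
Qed.

(** [hint_twist] for the identity and for [iota_mx] has the same right-hand side when the test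
    function is invariant under [iota_mx]; the integral of the test function is finite and nonzero
    and cancels. *)
Lemma hint_iota m (H : mxb m m -> \bar R) : measurable_fun setT H ->
  (forall x, 0 <= H x) -> hint mu nabs (fun x => H (iota_mx x)) = hint mu nabs H.
Proof.
move=> mH H0; have [F [mF F0 Fi Fgt0 Flty]] := hint_test_function m.
have mi : measurable_fun setT (iota_mx (F := K) (n := m) : mxb m m -> mxb m m).
  exact (measurable_iota (@measurable_id _ (mxb m m) setT)).
have e1 := @hint_twist m id F H (@measurable_id _ (mxb m m) setT) (fun x h => h).
have e2 := @hint_twist m (@iota_mx K m) F H mi.
have {}e1 : hint mu nabs F * hint mu nabs H = hint mu nabs F * hint mu nabs (fun x => H (invmx x)).
  apply: e1 => // x xU; exists (invmx x) => //; by rewrite unitmx_inv.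
have {}e2 : hint mu nabs F * hint mu nabs (fun x => H (iota_mx x)) =
    hint mu nabs F * hint mu nabs (fun x => H (invmx x)).
  rewrite -[X in _ = X * _](eq_hint (f := fun x => F (iota_mx x)) Fi); apply: e2 => // x xU.
    by rewrite /iota_mx unitmx_tr unitmx_inv.
  exists x^T; first by rewrite unitmx_tr.
  move=> y yU; rewrite /iota_mx invmx_mulmx ?unitmx_tr// trmx_mul.
  by congr (_ *m _); rewrite trmx_inv trmxK.
rewrite -e1 in e2; move: e2 Fgt0 Flty.
case: (hint mu nabs F) => [c||]//; rewrite lte_fin => e2 c0 _.
have := congr1 (fun z => (c^-1)%:E * z) e2.
by rewrite !muleA -EFinM mulVf ?gt_eqF// !mul1e.
Qed.

End HaarInversion.

(** * Flag functions *)

Section Flags.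
Context {R : realType} {K : absFieldType R}.

(** Summing over all maps instead of increasing ones only multiplies the sum by k!, because repeated
    columns give 0. This is, up to k!, the l^1 norm of the wedge of the first [k] rows; for k = 0 it
    is 1. *)
Definition minors n k (hk : (k <= n)%N) (x : 'M[K]_n) : R :=
  \sum_(s : {ffun 'I_k -> 'I_n}) absv (\det (mxsub (widen_ord hk) s x)).

Lemma minors_ge0 n k (hk : (k <= n)%N) (x : 'M[K]_n) : 0 <= minors hk x.
Proof. by apply: sumr_ge0 => s _; exact: absv_ge0. Qed.

Lemma mxsub_trig_mul n k (hk : (k <= n)%N) (s : 'I_k -> 'I_n) (b x : 'M[K]_n) :
  is_trig_mx b -> mxsub (widen_ord hk) s (b *m x) =
  mxsub (widen_ord hk) (widen_ord hk) b *m mxsub (widen_ord hk) s x.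
Proof.
move=> /is_trig_mxP bT; apply/matrixP => i j; rewrite !mxE.
rewrite (bigID (fun l : 'I_n => (l < k)%N)) /= [X in _ + X]big1 ?addr0.
  by rewrite big_ord_narrow; apply: eq_bigr => l _; rewrite !mxE.
move=> l kl; rewrite bT ?mul0r//= (leq_trans (ltn_ord i))// leqNgt.
exact: kl.
Qed.

Lemma minors_trig_mul n k (hk : (k <= n)%N) (b x : 'M[K]_n) : is_trig_mx b ->
  minors hk (b *m x) = (\prod_(j < k) absv (b (widen_ord hk j) (widen_ord hk j))) * minors hk x.
Proof.
move=> bT; rewrite /minors mulr_sumr; apply: eq_bigr => s _.
rewrite mxsub_trig_mul// det_mulmx absvM det_trig ?absv_prod.
  by congr (_ * _); apply: eq_bigr => j _; rewrite mxE.
by apply/is_trig_mxP => i j ij; rewrite mxE; exact: (is_trig_mxP bT).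
Qed.

(** The first [k] rows of an invertible matrix have rank [k], so some choice of [k] columns gives a
    nonzero minor. *)
Lemma minors_gt0 n k (hk : (k <= n)%N) (x : 'M[K]_n) : x \in unitmx -> 0 < minors hk x.
Proof.
move=> xU; rewrite lt_neqAle minors_ge0 andbT eq_sym; apply/eqP => m0.
pose A := rowsub (widen_ord hk) x.
have fA : row_full A^T.
  apply/row_fullP; exists (invmx x *m colsub (widen_ord hk) 1%:M)^T.
  rewrite -trmx_mul (_ : A *m _ = 1%:M) ?trmx1//.
  rewrite mulmxA /A mul_rowsub_mx mulmxV//; apply/matrixP => i j.
  rewrite !mxE (bigD1 (widen_ord hk j))//= !mxE eqxx mulr1 big1 ?addr0; last first.
    by move=> l lj; rewrite !mxE (negbTE lj) mulr0.
  by congr (_%:R); apply/eqP/eqP => [/(congr1 val)/= /val_inj|->].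
have := fullrowsub_unit fA; rewrite -unitmx_tr trmx_mxsub trmxK unitmxE unitfE.
rewrite -absv_eq0 => /eqP; apply.
apply/eqP; rewrite eq_le absv_ge0 andbT -m0 /minors.
rewrite (bigD1 (fullrankfun fA))//= (_ : mxsub (widen_ord hk) _ x = mxsub id (fullrankfun fA) A).
  by rewrite lerDl; apply: sumr_ge0 => s _; exact: absv_ge0.
by apply/matrixP => i j; rewrite !mxE.
Qed.

Lemma cvg_minors {T : Type} {F : set_system T} {FF : Filter F} n k
    (hk : (k <= n)%N) (f : T -> 'M[K]_n) (a : 'M[K]_n) : f @ F --> a ->
  minors hk (f t) @[t --> F] --> minors hk a.
Proof.
move=> /cvg_mxP fa; apply: cvg_big => [|s _]; first exact: add_continuous.
apply: cvg_abs; apply: cvg_det; apply/cvg_mxP => i j; rewrite mxE.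
under eq_fun do rewrite mxE.
exact: fa.
Qed.

Lemma minors_cvg n k (hk : (k <= n)%N) (x : 'M[K]_n) :
  minors hk y @[y --> x] --> minors hk x.
Proof. exact: (@cvg_minors _ (nbhs x) _ n k hk id x cvg_id). Qed.

(** [ltn_ord i] selects the minors of size [i.+1] and [ltnW (ltn_ord i)] those of size [i]: the
    quotient scales by the diagonal entry at [i] under lower triangular matrices. *)
Definition row_ratio n (i : 'I_n) (x : 'M[K]_n) : R :=
  minors (ltn_ord i) x / minors (ltnW (ltn_ord i)) x.

Lemma row_ratio_gt0 n (i : 'I_n) (x : 'M[K]_n) : x \in unitmx -> 0 < row_ratio i x.
Proof. by move=> xU; rewrite divr_gt0// minors_gt0. Qed.

Lemma trig_diag_neq0 n (b : 'M[K]_n) i : is_trig_mx b -> b \in unitmx -> b i i != 0.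
Proof.
move=> bT; rewrite unitmxE unitfE det_trig// => /prodf_neq0 h; exact: h.
Qed.

Lemma row_ratio_trig_mul n (i : 'I_n) (b x : 'M[K]_n) : is_trig_mx b -> b \in unitmx ->
  row_ratio i (b *m x) = absv (b i i) * row_ratio i x.
Proof.
move=> bT bU; rewrite /row_ratio !minors_trig_mul// big_ord_recr/=.
have -> : widen_ord (ltn_ord i) ord_max = i by apply/val_inj.
rewrite (eq_bigr (fun j : 'I_i => absv (b (widen_ord (ltnW (ltn_ord i)) j)
  (widen_ord (ltnW (ltn_ord i)) j)))); last first.
  by move=> j _; congr (absv (b _ _)); apply/val_inj.
set p := \prod_(_ < _) _; have p0 : p != 0.
  by apply/prodf_neq0 => j _; rewrite absv_eq0 trig_diag_neq0.
rewrite invfM; set m1 := minors _ x; set m2 := minors _ x.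
have -> : p * absv (b i i) * m1 * (p^-1 * m2^-1) =
    (p * p^-1) * (absv (b i i) * (m1 * m2^-1)) by ring.
by rewrite mulfV// mul1r.
Qed.

(** Stands for membership in a compact part of GL. The bound grows under products, which is harmless
    since only finitely many are formed. *)
Definition bounded_gl n (M : R) (x : 'M[K]_n) : Prop :=
  [/\ x \in unitmx, mx_size x <= M & mx_size (invmx x) <= M].

Lemma bounded_glM n (M N : R) (x y : 'M[K]_n) :
  bounded_gl M x -> bounded_gl N y -> bounded_gl (M * N) (x *m y).
Proof.
move=> [xU xM xiM] [yU yN yiN]; split; first by rewrite unitmx_mul xU.
  by rewrite (le_trans (mx_sizeM _ _))// ler_pM// mx_size_ge0.
by rewrite invmx_mulmx// (le_trans (mx_sizeM _ _))// mulrC ler_pM// mx_size_ge0.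
Qed.

Lemma bounded_gl_ex n (x : 'M[K]_n) : x \in unitmx -> exists M, bounded_gl M x.
Proof.
move=> xU; exists (mx_size x + mx_size (invmx x)); split => //.
  by rewrite lerDl mx_size_ge0.
by rewrite lerDr mx_size_ge0.
Qed.

Lemma bounded_gl_iota n (M : R) (x : 'M[K]_n) : bounded_gl M x -> bounded_gl M (iota_mx x).
Proof.
move=> [xU h1 h2]; rewrite /bounded_gl /iota_mx unitmx_tr unitmx_inv mx_sizeT.
by rewrite -trmx_inv invmxK mx_sizeT.
Qed.

Lemma bounded_gl_block m (M : R) (u : 'rV[K]_m) (k : 'M[K]_m) :
  (forall i, absv (u 0 i) <= 1) -> bounded_gl M k ->
  bounded_gl (1 + m%:R + `|M| + m%:R * `|M|) (block_mx 1%:M u 0 k : 'M[K]_(1 + m)).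
Proof.
move=> u1 [kU kM kiM].
pose k1 : 'M[K]_(1 + m) := block_mx 1%:M u 0 k.
pose k2 : 'M[K]_(1 + m) := block_mx 1%:M (- (u *m invmx k)) 0 (invmx k).
have k12 : k1 *m k2 = 1%:M.
  rewrite /k1 /k2 mulmx_block !mulmx0 !mul0mx !mulmx1 !mul1mx !addr0 !add0r.
  by rewrite addNr mulmxV// -scalar_mx_block.
have [k1U _] := mulmx1_unit k12.
have k1i : invmx k1 = k2 by apply: (can_inj (mulKmx k1U)); rewrite mulmxV.
have su : mx_size u <= m%:R.
  rewrite /mx_size big_ord1 -[X in _ <= X%:R]card_ord -sumr_const.
  exact: ler_sum.
have sM : M <= `|M| by exact: ler_norm.
have s1 : mx_size (1%:M : 'M[K]_1) = 1 by rewrite /mx_size !big_ord1 mxE eqxx absv1.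
split => //.
  rewrite mx_size_block_mx s1 mx_size0.
  have : 0 <= m%:R * `|M| by rewrite mulr_ge0.
  by lra.
rewrite -/k1 k1i /k2 mx_size_block_mx s1 mx_size0 mx_sizeN.
have : mx_size (u *m invmx k) <= m%:R * `|M|.
  apply: le_trans (mx_sizeM _ _) _; apply: ler_pM; rewrite ?mx_size_ge0//.
  exact: le_trans sM.
by have : 0 <= (m%:R : R) by []; lra.
Qed.

(* Column pivoting keeps the unipotent factors bounded, so no valuation ring or
   inner product is needed. *)
Lemma iwasawa n : exists M : R, forall x : 'M[K]_n, x \in unitmx ->
  exists b k, [/\ is_trig_mx b, b \in unitmx, bounded_gl M k & x = b *m k].
Proof.
elim: n => [|m [M IH]].
  exists 0 => x xU; exists 1%:M, x; split.
  - by apply/is_trig_mxP => -[].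
  - exact: unitmx1.
  - by split => //; rewrite /mx_size big_ord0.
  - by rewrite mul1mx.
pose N : R := 1 + m%:R + `|M| + m%:R * `|M|.
(* [N] bounds the unipotent-type factor by [bounded_gl_block], and 1 + m the permutation matrix,
   which is its own inverse. *)
exists (N * (1 + m)%:R); rewrite -[m.+1]/(1 + m)%N => x xU.
have [j [r [u [c [h [r0 hU u1 ->]]]]]] := pivot xU.
have [b [k [bT bU bk hE]]] := IH h hU.
pose B : 'M[K]_(1 + m) := block_mx r%:M 0 c b.
pose k1 : 'M[K]_(1 + m) := block_mx 1%:M u 0 k.
pose P : 'M[K]_(1 + m) := tperm_mx (lshift m 0) j.
have PP : P *m P = 1%:M by rewrite /P /tperm_mx -perm_mxM tperm2 perm_mx1.
have [PU _] := mulmx1_unit PP.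
have Pinv : invmx P = P by apply: (can_inj (mulKmx PU)); rewrite mulmxV.
have bk1 : bounded_gl N k1 by exact: bounded_gl_block.
have bP : bounded_gl (1 + m)%:R P.
  have sP : mx_size P <= (1 + m)%:R.
    rewrite /mx_size -[X in _ <= X%:R](card_ord (1 + m)) -sumr_const; apply: ler_sum => i _.
    rewrite (bigD1 (tperm (lshift m 0) j i))//= !mxE eqxx absv1 big1 ?addr0// => l li.
    by rewrite !mxE eq_sym (negbTE li) absv0.
  by split => //; rewrite Pinv.
exists B, (k1 *m P); split.
- apply/is_trig_mxP => i l; rewrite /B; case: (split_ordP i) => i' ->; case: (split_ordP l) => l' -> /=.
  + by rewrite !ord1.
  + by rewrite block_mxEur mxE.
  + by rewrite (ord1 l') /= add1n ltn0.
  + by rewrite block_mxEdr !add1n ltnS => il; exact: (is_trig_mxP bT).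
- by rewrite unitmxE det_lblock unitrM -!unitmxE bU andbT unitmxE det_scalar1 unitfE.
- exact: bounded_glM.
- rewrite mulmxA /B /k1 mulmx_block !mulmx0 !mul0mx !mulmx1 !addr0 mul_scalar_mx.
  by rewrite hE addrC.
Qed.

Context {Klocal : is_local_field K}.

(** The bound on the inverse bounds det x^-1 from above, hence |det x| from below by [e]: a
    condition that is visibly closed and keeps the set inside GL. *)
Lemma bounded_gl_compact n (M : R) : exists D : set 'M[K]_n,
  [/\ compact D, D `<=` @GL R K n & forall x, bounded_gl M x -> D x].
Proof.
have [C hC] := @absv_det_le R K n; pose e : R := (`|C| * `|M| ^+ n + 1)^-1.
have e0 : 0 < `|C| * `|M| ^+ n + 1 by rewrite ltr_wpDl// mulr_ge0// exprn_ge0.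
exists ([set x : 'M[K]_n | mx_size x <= M] `&` [set x : 'M[K]_n | e <= absv (\det x)]); split.
- apply: compact_closedI; first exact: compact_mx_size_le.
  have : closed [set r : R | e <= r] by exact: closed_ge.
  move=> /closed_comp; apply => x _.
  apply: (@cvg_abs _ _ _ (nbhs x)); exact: det_cvg.
- move=> x [_ /= ex]; rewrite /GL/= unitmxE unitfE -absv_gt0 (lt_le_trans _ ex)//.
  by rewrite invr_gt0.
- move=> x [xU xM xiM]; split => //=.
  have dx0 : \det x != 0 by rewrite -unitfE -unitmxE.
  rewrite /e -[leRHS]invrK -absvV -det_inv lef_pV2 ?posrE//; last first.
    by rewrite absv_gt0 det_inv invr_neq0.
  apply: le_trans (hC _) _; apply: (@le_trans _ _ (`|C| * mx_size (invmx x) ^+ n)).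
    by rewrite ler_wpM2r ?exprn_ge0 ?mx_size_ge0// ler_norm.
  apply: (@le_trans _ _ (`|C| * `|M| ^+ n)); last by rewrite lerDl.
  apply: ler_wpM2l => //; apply: lerXn2r; rewrite ?nnegrE ?mx_size_ge0//.
  exact: le_trans (ler_norm _).
Qed.

Lemma bounded_gl_fun n (M : R) (f : 'M[K]_n -> R) :
  (forall x : 'M[K]_n, x \in unitmx -> f y @[y --> x] --> f x) ->
  exists2 C, 0 < C & forall x, bounded_gl M x -> `|f x| <= C.
Proof.
move=> cf; have [D [cD DG hD]] := bounded_gl_compact n M.
have [C C0 hC] := compact_bounded_fun cD (fun x Dx => cf x (DG x Dx)).
by exists C => // x /hD; exact: hC.
Qed.

Lemma minors_bounded n k (hk : (k <= n)%N) (M : R) : exists2 C, 0 < C &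
  forall x, bounded_gl M x -> C^-1 <= minors hk x <= C.
Proof.
have [C C0 hC] := @bounded_gl_fun n M (minors hk) (fun x _ => @minors_cvg _ _ hk x).
have [C' C'0 hC'] := @bounded_gl_fun n M (fun x => (minors hk x)^-1)
  (fun x xU => cvgV (lt0r_neq0 (minors_gt0 hk xU)) (@minors_cvg _ _ hk x)).
exists (Num.max C C'); first by rewrite lt_max C0.
move=> x bx; have xU : x \in unitmx by case: bx.
have m0 := minors_gt0 hk xU; apply/andP; split.
  rewrite invf_ple ?posrE ?lt_max ?C0//.
  by have := hC' x bx; rewrite ger0_norm ?invr_ge0 ?minors_ge0// => h; rewrite le_max h orbT.
by have := hC x bx; rewrite ger0_norm ?minors_ge0// => h; rewrite le_max h.
Qed.

End Flags.

Section FlagFunction.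
Context {R : realType} {K : absFieldType R}.
Context {mu : {sigma_finite_measure set (borel K) -> \bar R}} {nabs : K -> R}.
Context {L : local_haar mu nabs}.

(** Row ratios are built from [absv]; the factor [nabs_exponent] makes [al] the exponents with
    respect to the normalized absolute value. *)
Definition flag n (al : 'I_n -> R) (x : 'M[K]_n) : R :=
  \prod_i row_ratio i x `^ (@nabs_exponent R K nabs * al i).

Lemma flag_ge0 n al (x : 'M[K]_n) : 0 <= flag al x.
Proof. by apply: prodr_ge0 => i _; exact: powR_ge0. Qed.

Lemma flag_gt0 n al (x : 'M[K]_n) : x \in unitmx -> 0 < flag al x.
Proof. by move=> xU; apply: prodr_gt0 => i _; rewrite powR_gt0// row_ratio_gt0. Qed.

Lemma flag_trig_mul n al (b x : 'M[K]_n) : is_trig_mx b -> b \in unitmx -> x \in unitmx ->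
  flag al (b *m x) = (\prod_i nabs (b i i) `^ al i) * flag al x.
Proof.
move=> bT bU xU; rewrite /flag -big_split/=; apply: eq_bigr => i _.
rewrite row_ratio_trig_mul// powRM ?absv_ge0//; last by rewrite ltW// row_ratio_gt0.
by rewrite nabsE -powRrM.
Qed.

Lemma powR_two_sided (C y e : R) : 0 < C -> C^-1 <= y <= C ->
  y `^ e <= (C^-1 `^ `|e|)^-1 * C `^ `|e|.
Proof.
move=> C0 /andP[Cy yC].
have Ci : 0 < C^-1 by rewrite invr_gt0.
have C1 : 1 <= C.
  have : C^-1 <= C by exact: le_trans yC.
  by rewrite -[leLHS]mul1r ler_pdivrMr// -expr2 expr_ge1// ltW.
have C2 : 1 <= C `^ `|e| by rewrite -(powRr0 C) ler_powR.
have C3 : 1 <= (C^-1 `^ `|e|)^-1.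
  rewrite invf_ge1 ?powR_gt0// -[leRHS](powRr0 C^-1); apply: ger_powR => //.
  by rewrite Ci invf_le1.
have [y1|y1] := leP y 1.
  apply: (@le_trans _ _ ((C^-1 `^ `|e|)^-1)); last by rewrite ler_peMr// (le_trans ler01).
  by apply: powR_le_annulus => //; rewrite Cy.
apply: (@le_trans _ _ (C `^ `|e|)); last by rewrite ler_peMl// (le_trans ler01).
apply: (@le_trans _ _ (y `^ `|e|)); first by apply: ler_powR; [exact: ltW|exact: ler_norm].
have y0 : 0 < y by exact: lt_trans ltr01 y1.
by apply: (ge0_ler_powR (normr_ge0 e)); rewrite ?nnegrE ?(ltW y0) ?(ltW C0).
Qed.

Lemma row_ratio_bounded n (i : 'I_n) (M : R) : exists2 C, 0 < C &
  forall x : 'M[K]_n, bounded_gl M x -> C^-1 <= row_ratio i x <= C.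
Proof.
have [C1 C10 h1] := @minors_bounded R K _ n _ (ltn_ord i) M.
have [C2 C20 h2] := @minors_bounded R K _ n _ (ltnW (ltn_ord i)) M.
exists (C1 * C2) => [|x bx]; first by rewrite mulr_gt0.
have /andP[a1 b1] := h1 x bx; have /andP[a2 b2] := h2 x bx.
have xU : x \in unitmx by case: bx.
have m1 := minors_gt0 (ltn_ord i) xU; have m2 := minors_gt0 (ltnW (ltn_ord i)) xU.
apply/andP; split.
  rewrite invfM /row_ratio; apply: ler_pM; [by rewrite invr_ge0 ltW|
    by rewrite invr_ge0 ltW|exact: a1|by rewrite lef_pV2 ?posrE].
rewrite /row_ratio; apply: ler_pM; [exact: ltW|by rewrite invr_ge0 ltW|exact: b1|].
by rewrite invf_ple ?posrE.
Qed.

Lemma flag_le n al (M : R) : exists2 C, 0 < C &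
  forall x : 'M[K]_n, bounded_gl M x -> flag al x <= C.
Proof.
have h i := cid2 (row_ratio_bounded (n := n) i M).
pose e i := @nabs_exponent R K nabs * al i.
pose C i := projT1 (h i).
have C0 i : 0 < C i by rewrite /C; case: (h i).
have hC i (x : 'M[K]_n) : bounded_gl M x -> (C i)^-1 <= row_ratio i x <= C i.
  by rewrite /C; case: (h i) => ? /= _ + bx; exact.
exists (\prod_i (((C i)^-1 `^ `|e i|)^-1 * C i `^ `|e i|)).
  by apply: prodr_gt0 => i _; rewrite mulr_gt0 ?invr_gt0 ?powR_gt0 ?invr_gt0.
move=> x bx; apply: ler_prod => i _; rewrite powR_ge0/=.
exact/powR_two_sided/hC.
Qed.

Lemma flagN n al (x : 'M[K]_n) : flag (fun i => - al i) x = (flag al x)^-1.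
Proof.
by rewrite /flag -prodfV; apply: eq_bigr => i _; rewrite mulrN powRN.
Qed.

Lemma flag_ge n al (M : R) : exists2 C, 0 < C &
  forall x : 'M[K]_n, bounded_gl M x -> C <= flag al x.
Proof.
have [C C0 hC] := flag_le (n := n) (fun i => - al i) M.
exists C^-1 => [|x bx]; first by rewrite invr_gt0.
have xU : x \in unitmx by case: bx.
have := hC x bx; rewrite flagN invf_ple ?posrE// ?flag_gt0//.
Qed.

(** Testing Iwasawa products b k suffices: the flag function of b k is the character of [b] times
    its value at [k], and the latter is bounded below on bounded sets. *)
Lemma flag_dominates n al (f : 'M[K]_n -> R) :
  (forall M, exists2 C, 0 < C & forall b k, is_trig_mx b -> b \in unitmx -> bounded_gl M k ->
     f (b *m k) <= C * \prod_i nabs (b i i) `^ al i) ->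
  exists2 C, 0 < C & forall x, x \in unitmx -> f x <= C * flag al x.
Proof.
have [M hM] := @iwasawa R K n; move=> /(_ M)[C C0 hC].
have [c c0 hc] := flag_ge (n := n) al M.
exists (C / c) => [|x xU]; first by rewrite divr_gt0.
have [b [k [bT bU bk ->]]] := hM x xU.
have kU : k \in unitmx by case: bk.
apply: le_trans (hC _ _ bT bU bk) _; rewrite flag_trig_mul//.
rewrite -mulrA ler_pM2l// mulrCA ler_peMr//.
  by apply: prodr_ge0 => i _; exact: powR_ge0.
by rewrite mulrC ler_pdivlMr// mul1r hc.
Qed.

Lemma flag_mulr_le n al (M : R) : exists2 C, 0 < C &
  forall x y : 'M[K]_n, x \in unitmx -> bounded_gl M y -> flag al (x *m y) <= C * flag al x.
Proof.
have [M' hM] := @iwasawa R K n.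
have [C C0 hC] := flag_le (n := n) al (M' * M); have [c c0 hc] := flag_ge (n := n) al M'.
exists (C / c) => [|x y xU by_]; first by rewrite divr_gt0.
have [b [k [bT bU bk ->]]] := hM x xU.
have kU : k \in unitmx by case: bk.
have yU : y \in unitmx by case: by_.
have kyU : k *m y \in unitmx by rewrite unitmx_mul kU.
rewrite -mulmxA (flag_trig_mul al bT bU kyU) (flag_trig_mul al bT bU kU).
rewrite [leRHS]mulrCA; apply: ler_wpM2l.
  by apply: prodr_ge0 => i _; exact: powR_ge0.
apply: le_trans (hC _ (bounded_glM bk by_)) _.
by rewrite -mulrA ler_peMr// ?(ltW C0)// mulrC ler_pdivlMr// mul1r hc.
Qed.

Lemma measurable_flag d (X : measurableType d) n al (f : X -> mxb n n) :
  measurable_fun setT f -> measurable_fun setT (fun x => flag al (f x : 'M[K]_n)).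
Proof.
move=> mf; apply: measurable_prod => i _.
have mm k (hk : (k <= n)%N) : measurable_fun setT (fun x => minors hk (f x : 'M[K]_n)).
  apply: measurable_sum => s; apply: measurable_absv; apply: measurable_det.
  exact: measurable_mxsub.
apply: (@measurableT_comp _ _ _ _ _ _ (@powR R ^~ (@nabs_exponent R K nabs * al i)) _
  (fun x => row_ratio i (f x : 'M[K]_n))); first exact: measurable_powR.
apply: (eq_measurable_fun (fun x => minors (ltn_ord i) (f x : 'M[K]_n) *
  minors (ltnW (ltn_ord i)) (f x : 'M[K]_n) `^ (-1))).
  by move=> x _; rewrite powR_inv1 ?minors_ge0.
by apply: measurable_funM => //; exact (measurableT_comp (measurable_powR _) (mm _ _)).
Qed.

End FlagFunction.
Arguments flag {R K} nabs {n} al x.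

(** * The Godement-Jacquet integral *)

Section ProductInvariance.
Context d1 d2 (X : measurableType d1) (Y : measurableType d2) (R : realType).
Variables (m1 : {sigma_finite_measure set X -> \bar R}).
Variables (m2 : {sigma_finite_measure set Y -> \bar R}).
Local Open Scope ereal_scope.

(* The sigma-finite instance of [m1 \x m2] in the library only covers
   subprobabilities. *)
Definition prodm : set (X * Y) -> \bar R := m1 \x m2.

HB.instance Definition _ := Measure.copy prodm (m1 \x m2).

Lemma prodm_sigma_finite : sigma_finite setT prodm.
Proof.
have /sigma_finiteP[F [FT ndF Foo]] := sigma_finiteT m1.
have /sigma_finiteP[G [GT ndG Goo]] := sigma_finiteT m2.
exists (fun k => F k `*` G k) => [|k].
  apply/seteqP; split=> // -[x y] _.
  have [i _ Fi] : (\bigcup_i F i) x by rewrite -FT.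
  have [j _ Gj] : (\bigcup_i G i) y by rewrite -GT.
  exists (maxn i j) => //; split => /=.
    by have /subsetPset := ndF _ _ (leq_maxl i j); apply.
  by have /subsetPset := ndG _ _ (leq_maxr i j); apply.
have [mF Fk] := Foo k; have [mG Gk] := Goo k; split; first exact: measurableX.
by rewrite /prodm product_measure1E// lte_mul_pinfty// ge0_fin_numE.
Qed.

HB.instance Definition _ := Measure_isSigmaFinite.Build _ _ _ prodm
  prodm_sigma_finite.

Lemma integral_prodm (f : X -> Y -> \bar R) :
  measurable_fun setT (fun z : X * Y => f z.1 z.2) -> (forall x y, 0 <= f x y) ->
  \int[prodm]_z f z.1 z.2 = \int[m1]_x \int[m2]_y f x y.
Proof.
move=> mf f0.
exact (fubini_tonelli1 (m1 := m1) (m2 := m2) (fun z => f z.1 z.2) mf (fun z => f0 _ _)).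
Qed.

End ProductInvariance.

Section Preserves.
Context (R : realType).
Local Open Scope ereal_scope.

Definition preserves d (Z : measurableType d) (m : {measure set Z -> \bar R}) (s : Z -> Z) :=
  measurable_fun setT s /\ forall f : Z -> \bar R, measurable_fun setT f ->
    (forall z, 0 <= f z) -> \int[m]_z f (s z) = \int[m]_z f z.

Lemma preserves_prod d1 d2 (X : measurableType d1) (Y : measurableType d2)
    (m1 : {sigma_finite_measure set X -> \bar R})
    (m2 : {sigma_finite_measure set Y -> \bar R}) (s1 : X -> X) (s2 : Y -> Y) :
  preserves m1 s1 -> preserves m2 s2 ->
  preserves (prodm m1 m2) (fun z => (s1 z.1, s2 z.2)).
Proof.
move=> [ms1 h1] [ms2 h2].
have ms : measurable_fun setT (fun z : X * Y => (s1 z.1, s2 z.2)).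
  apply: measurable_fun_pair.
    exact (measurableT_comp ms1 measurable_fst).
  exact (measurableT_comp ms2 measurable_snd).
split=> // f mf f0.
have mf' : measurable_fun setT (fun z : X * Y => f (z.1, z.2)).
  by apply: (eq_measurable_fun f) => // -[].
transitivity (\int[prodm m1 m2]_z f (s1 z.1, s2 z.2)) => //.
rewrite (@integral_prodm _ _ _ _ _ m1 m2 (fun x y => f (s1 x, s2 y)))//; last first.
  exact (measurableT_comp mf ms).
transitivity (\int[prodm m1 m2]_z f (z.1, z.2)); last by apply: eq_integral => -[].
rewrite (@integral_prodm _ _ _ _ _ m1 m2 (fun x y => f (x, y)))//.
pose F x := \int[m2]_y f (x, y).
have mF : measurable_fun setT F.
  exact: (@measurable_integral _ _ _ _ _ m2 (fun x y => f (x, y))).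
rewrite -(h1 F mF); last by move=> x; exact: integral_ge0.
apply: eq_integral => x _; rewrite /F.
rewrite (h2 (fun y => f (s1 x, y)))//.
exact (measurableT_comp mf (measurable_pair1 (s1 x))).
Qed.

End Preserves.

Section BlockIntegral.
Context {R : realType} {K : absFieldType R}.
Context {mu : {sigma_finite_measure set (borel K) -> \bar R}} {nabs : K -> R}.
Context {L : local_haar mu nabs}.
Local Open Scope ereal_scope.

Lemma preserves_lam_shift p q (v : 'M[K]_(p, q)) :
  preserves (lam mu p q) (fun x : mxb p q => ((x : 'M[K]_(p, q)) + v)%R : mxb p q).
Proof.
split; first by apply: measurable_addmx; [exact: measurable_id|exact: measurable_cst].
by move=> f mf f0; exact: integral_lam_shift.
Qed.

Lemma measurable_block_mx d (X : measurableType d) p q r s (f1 : X -> mxb p q)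
    (f2 : X -> mxb p r) (f3 : X -> mxb s q) (f4 : X -> mxb s r) :
  measurable_fun setT f1 -> measurable_fun setT f2 ->
  measurable_fun setT f3 -> measurable_fun setT f4 ->
  measurable_fun setT (fun x => block_mx (f1 x : 'M[K]_(p, q)) (f2 x : 'M[K]_(p, r))
     (f3 x : 'M[K]_(s, q)) (f4 x : 'M[K]_(s, r)) : mxb (p + s) (q + r)).
Proof.
move=> m1 m2 m3 m4; apply/measurable_mxbP => i j.
case: (split_ordP i) => i' ->; case: (split_ordP j) => j' ->.
- by under eq_fun do rewrite block_mxEul; exact: measurable_entries.
- by under eq_fun do rewrite block_mxEur; exact: measurable_entries.
- by under eq_fun do rewrite block_mxEdl; exact: measurable_entries.
- by under eq_fun do rewrite block_mxEdr; exact: measurable_entries.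
Qed.

Local Notation block_measure m :=
  (prodm (prodm (lam mu 1 1) (lam mu m 1)) (prodm (lam mu 1 m) (lam mu m m))).

(** The first column (r, c) forms the outer pair: it stays fixed while the remaining blocks u and h
    are substituted in [zeta_inner]. *)
Definition block_of m (z : (mxb (K := K) 1 1 * mxb (K := K) m 1) * (mxb (K := K) 1 m * mxb (K := K) m m)) :
  mxb (K := K) (1 + m) (1 + m) := block_mx z.1.1 z.2.1 z.1.2 z.2.2.

Lemma measurable_block_of m : measurable_fun setT (@block_of m).
Proof.
apply: measurable_block_mx.
- exact (measurableT_comp measurable_fst measurable_fst).
- exact (measurableT_comp measurable_fst measurable_snd).
- exact (measurableT_comp measurable_snd measurable_fst).
- exact (measurableT_comp measurable_snd measurable_snd).
Qed.

Lemma block_invariant m (v : 'M[K]_(1 + m)) (f : mxb (1 + m) (1 + m) -> \bar R) :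
  measurable_fun setT f -> (forall x, 0 <= f x) ->
  \int[block_measure m]_z f ((block_of z : 'M[K]_(1 + m)) + v)%R =
  \int[block_measure m]_z f (block_of z).
Proof.
move=> mf f0.
have h1 := @preserves_prod R _ _ _ _ (lam mu 1 1) (lam mu m 1) _ _
  (preserves_lam_shift (ulsubmx v)) (preserves_lam_shift (dlsubmx v)).
have h2 := @preserves_prod R _ _ _ _ (lam mu 1 m) (lam mu m m) _ _
  (preserves_lam_shift (ursubmx v)) (preserves_lam_shift (drsubmx v)).
have [_ h] := @preserves_prod R _ _ _ _ (prodm (lam mu 1 1) (lam mu m 1)) (prodm (lam mu 1 m) (lam mu m m)) _ _ h1 h2.
rewrite -(h _ (measurableT_comp mf (@measurable_block_of m)))//; last by move=> z; exact: f0.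
apply: eq_integral => z _ /=; congr f.
by rewrite /block_of /= -[in LHS](submxK v) add_block_mx.
Qed.

(** Both sides are translation invariant, hence proportional. Only finiteness will be transported,
    so a positive constant is enough. *)
Lemma integral_block m : exists c : R, forall f : mxb (1 + m) (1 + m) -> \bar R,
  measurable_fun setT f -> (forall x, 0 <= f x) ->
  \int[block_measure m]_z f (block_of z) = c%:E * \int[lam mu (1 + m) (1 + m)]_x f x /\ (0 < c)%R.
Proof.
pose v := disk_volume (mu := mu).
have v0 : (0 < v)%R by exact: disk_volume_gt0.
pose q (z : (mxb (K := K) 1 1 * mxb (K := K) m 1) * (mxb (K := K) 1 m * mxb (K := K) m m)) : \bar R :=
  cube_ind (block_of z).
have cE : \int[block_measure m]_z q z =
    ((v ^+ (1 * 1) * v ^+ (m * 1)) * (v ^+ (1 * m) * v ^+ (m * m)))%R%:E.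
  have -> : q = (fun z => (\1_((@cube _ K 1 1 `*` @cube _ K m 1) `*` (@cube _ K 1 m `*` @cube _ K m m)) z)%:E).
    apply/funext => -[[r c] [u h]]; rewrite /q /cube_ind !indicE; congr ((nat_of_bool _)%:R%:E).
    apply/idP/idP => /set_mem H; apply/mem_set.
      split=> /=; split => /= i j.
      - by have := H (lshift m i) (lshift m j); rewrite /block_of/= block_mxEul.
      - by have := H (rshift 1 i) (lshift m j); rewrite /block_of/= block_mxEdl.
      - by have := H (lshift m i) (rshift 1 j); rewrite /block_of/= block_mxEur.
      - by have := H (rshift 1 i) (rshift 1 j); rewrite /block_of/= block_mxEdr.
    case: H => [[/= H1 H2] [/= H3 H4]] i j; rewrite /block_of/=.
    case: (split_ordP i) => i' ->; case: (split_ordP j) => j' ->.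
    - by rewrite block_mxEul; exact: H1.
    - by rewrite block_mxEur; exact: H3.
    - by rewrite block_mxEdl; exact: H2.
    - by rewrite block_mxEdr; exact: H4.
  have mc p q' := @measurable_cube R K p q'.
  have mX := measurableX (mc 1%N 1%N) (mc m 1%N).
  have mY := measurableX (mc 1%N m) (mc m m).
  have := @integral_indic _ _ _ (block_measure m) setT measurableT _ (measurableX mX mY).
  rewrite setIT => ->.
  refine (eq_trans (product_measure1E (prodm (lam mu 1 1) (lam mu m 1)) (prodm (lam mu 1 m) (lam mu m m)) mX mY) _).
  rewrite [in RHS]EFinM; congr (_ * _).
    refine (eq_trans (product_measure1E (lam mu 1 1) (lam mu m 1) (mc _ _) (mc _ _)) _).
    by rewrite EFinM; congr (_ * _); exact (lam_cube _ _).
  refine (eq_trans (product_measure1E (lam mu 1 m) (lam mu m m) (mc _ _) (mc _ _)) _).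
  by rewrite EFinM; congr (_ * _); exact (lam_cube _ _).
eexists => f mf f0; split.
  exact: (@invariant_unique _ _ mu nabs L _ _ (block_measure m) _ _ (@block_of m)
    (@measurable_block_of m) (@block_invariant m) _ cE f mf f0).
by rewrite divr_gt0 ?exprn_gt0// !mulr_gt0 ?exprn_gt0.
Qed.

End BlockIntegral.

Section Zeta.
Context {R : realType} {K : absFieldType R}.
Context {mu : {sigma_finite_measure set (borel K) -> \bar R}} {nabs : K -> R}.
Context {L : local_haar mu nabs}.

Lemma nabs_det_bounded n (M s : R) : exists2 C, 0 < C &
  forall x : 'M[K]_n, bounded_gl M x -> nabs (\det x) `^ s <= C.
Proof.
have cd (x : 'M[K]_n) : absv (\det y) @[y --> x] --> absv (\det x).
  by apply: (@cvg_abs _ _ _ (nbhs x)); exact: det_cvg.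
have d0 (x : 'M[K]_n) : x \in unitmx -> absv (\det x) != 0.
  by rewrite unitmxE unitfE absv_eq0.
have [C C0 hC] := @bounded_gl_fun R K _ n M (fun x => absv (\det x)) (fun x _ => @cd x).
have [C' C'0 hC'] := @bounded_gl_fun R K _ n M (fun x => (absv (\det x))^-1)
  (fun x xU => cvgV (d0 x xU) (@cd x)).
pose D := Num.max C C'; have D0 : 0 < D by rewrite lt_max C0.
exists ((D^-1 `^ `|@nabs_exponent R K nabs * s|)^-1 * D `^ `|@nabs_exponent R K nabs * s|).
  by rewrite mulr_gt0 ?invr_gt0 ?powR_gt0 ?invr_gt0.
move=> x bx; rewrite nabsE -powRrM; apply: powR_two_sided => //.
have xU : x \in unitmx by case: bx.
have m0 : 0 < absv (\det x) by rewrite lt_neqAle absv_ge0 eq_sym d0.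
apply/andP; split.
  rewrite invf_ple ?posrE// le_max; apply/orP; right.
  by have := hC' x bx; rewrite ger0_norm// invr_ge0 ltW.
by have := hC x bx; rewrite ger0_norm ?absv_ge0// => h; rewrite le_max h.
Qed.

(** On lower triangular matrices |det|^s is the character with all exponents equal to [s]; on
    bounded matrices it is bounded. *)
Lemma flag_shift_le n (al : 'I_n -> R) (s : R) : exists2 C, 0 < C & forall x : 'M[K]_n,
  x \in unitmx -> flag nabs al x * nabs (\det x) `^ s <= C * flag nabs (fun i => al i + s) x.
Proof.
apply: (@flag_dominates _ _ mu nabs L n (fun i => al i + s)
  (fun x => flag nabs al x * nabs (\det x) `^ s)) => M.
have [C1 C10 h1] := @flag_le _ _ mu nabs L n al M.
have [C2 C20 h2] := nabs_det_bounded n M s.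
exists (C1 * C2) => [|b k bT bU bk]; first by rewrite mulr_gt0.
have kU : k \in unitmx by case: bk.
rewrite flag_trig_mul// det_mulmx nabsM powRM ?nabs_ge0// det_trig//.
have -> : nabs (\prod_i b i i) `^ s = \prod_i nabs (b i i) `^ s.
  elim/big_rec2: _ => [|i u v _ <-]; first by rewrite nabs1 powR1.
  by rewrite nabsM powRM ?nabs_ge0.
have -> : \prod_i nabs (b i i) `^ (al i + s) =
    (\prod_i nabs (b i i) `^ al i) * (\prod_i nabs (b i i) `^ s).
  rewrite -big_split; apply: eq_bigr => i _ /=; rewrite powRD//.
  by rewrite (gt_eqF (nabs_gt0 _)) ?implybT// trig_diag_neq0.
set p := \prod_i _; set q := \prod_i _.
rewrite mulrACA [leRHS]mulrC; apply: ler_wpM2l.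
  by rewrite mulr_ge0// prodr_ge0// => i _; exact: powR_ge0.
by apply: ler_pM; rewrite ?flag_ge0 ?powR_ge0 ?h1 ?h2.
Qed.

Lemma decay_scale N p q p' q' (x : 'M[K]_(p, q)) (y : 'M[K]_(p', q')) (A : R) :
  0 < A -> 1 + mx_size x <= A * (1 + mx_size y) -> decay N y <= A ^+ N * decay N x.
Proof.
move=> A0 h; have x0 := mx_size_ge0 x; have y0 := mx_size_ge0 y.
rewrite /decay mulrC ler_pdivlMl ?exprn_gt0 ?ltr_wpDr//.
rewrite ler_pdivrMr ?exprn_gt0 ?ltr_wpDr// -exprMn.
by apply: lerXn2r; rewrite ?nnegrE ?mulr_ge0 ?addr_ge0// ltW.
Qed.

Lemma decay_mulr N p q (x : 'M[K]_(p, q)) (y : 'M[K]_q) M : bounded_gl M y ->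
  decay N (x *m y) <= (1 + `|M|) ^+ N * decay N x.
Proof.
move=> [yU _ yM]; apply: decay_scale; first by rewrite ltr_pwDl.
have x0 := mx_size_ge0 (x *m y).
have : mx_size x <= mx_size (x *m y) * `|M|.
  rewrite -[X in mx_size X <= _](mulmxK yU); apply: le_trans (mx_sizeM _ _) _.
  by apply: ler_wpM2l => //; apply: le_trans yM _; exact: ler_norm.
by have : 0 <= `|M| by []; nra.
Qed.

Lemma decay_mull N p q (x : 'M[K]_(p, q)) (y : 'M[K]_p) M : bounded_gl M y ->
  decay N (y *m x) <= (1 + `|M|) ^+ N * decay N x.
Proof.
move=> [yU _ yM]; apply: decay_scale; first by rewrite ltr_pwDl.
have x0 := mx_size_ge0 (y *m x).
have : mx_size x <= `|M| * mx_size (y *m x).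
  rewrite -[X in mx_size X <= _](mulKmx yU); apply: le_trans (mx_sizeM _ _) _.
  by apply: ler_wpM2r => //; apply: le_trans yM _; exact: ler_norm.
by have : 0 <= `|M| by []; nra.
Qed.

(** With h = b k, the matrix is the lower triangular [r 0; c b] times the bounded [1 u; 0 k]. The
    column [c] stays below the diagonal and leaves no trace. *)
Lemma flag_block m (al : 'I_(1 + m) -> R) : exists2 C, 0 < C &
  forall (r : K) (u : 'rV[K]_m) (c : 'cV[K]_m) (h : 'M[K]_m),
  r != 0 -> (forall i, absv (u 0 i) <= 1) -> h \in unitmx ->
  flag nabs al (block_mx r%:M (r *: u) c (c *m u + h)) <=
  C * (nabs r `^ al (lshift m 0) * flag nabs (fun i => al (rshift 1 i)) h).
Proof.
have [M hM] := @iwasawa R K m.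
have [C C0 hC] := @flag_le _ _ mu nabs L (1 + m) al (1 + m%:R + `|M| + m%:R * `|M|).
have [c0 c00 hc] := @flag_ge _ _ mu nabs L m (fun i => al (rshift 1 i)) M.
exists (C / c0) => [|r u c h r0 u1 hU]; first by rewrite divr_gt0.
have [b [k [bT bU bk hE]]] := hM h hU.
have kU : k \in unitmx by case: bk.
pose B : 'M[K]_(1 + m) := block_mx r%:M 0 c b.
pose k1 : 'M[K]_(1 + m) := block_mx 1%:M u 0 k.
have bk1 := bounded_gl_block u1 bk.
have k1U : k1 \in unitmx by case: bk1.
have BU : B \in unitmx.
  by rewrite unitmxE det_lblock unitrM -!unitmxE bU andbT unitmxE det_scalar1 unitfE.
have BT : is_trig_mx B.
  apply/is_trig_mxP => i l; rewrite /B; case: (split_ordP i) => i' ->; case: (split_ordP l) => l' -> /=.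
  + by rewrite !ord1.
  + by rewrite block_mxEur mxE.
  + by rewrite (ord1 l') /= add1n ltn0.
  + by rewrite block_mxEdr !add1n ltnS => il; exact: (is_trig_mxP bT).
have -> : block_mx r%:M (r *: u) c (c *m u + h) = B *m k1.
  rewrite /B /k1 mulmx_block !mulmx0 !mulmx1 !mul0mx !addr0 mul_scalar_mx hE//.
rewrite hE !flag_trig_mul// big_split_ord/= big_ord1 /B block_mxEul mxE eqxx mulr1n.
under eq_bigr do rewrite block_mxEdr.
set p := nabs r `^ _; set q := \prod_i _.
have p0 : 0 <= p by exact: powR_ge0.
have q0 : 0 <= q by apply: prodr_ge0 => i _; exact: powR_ge0.
set f := flag nabs _ k.
have -> : C / c0 * (p * (q * f)) = p * q * (C / c0 * f) by ring.
apply: ler_wpM2l; first exact: mulr_ge0.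
apply: le_trans (hC _ bk1) _.
by rewrite -mulrA ler_peMr// ?(ltW C0)// mulrC ler_pdivlMr// mul1r hc.
Qed.

Local Open Scope ereal_scope.

Definition pivot_set m (j : 'I_(1 + m)) : set (mxb (K := K) (1 + m) (1 + m)) :=
  [set x : 'M[K]_(1 + m) | forall k, (absv (x (lshift m 0%R) k) <= absv (x (lshift m 0%R) j))%R].

Lemma measurable_pivot_set m j : measurable (@pivot_set m j).
Proof.
rewrite (_ : pivot_set j = \bigcap_(k in [set: 'I_(1 + m)])
   ((fun x : mxb (K := K) (1 + m) (1 + m) => absv (x (lshift m 0%R) j) - absv (x (lshift m 0%R) k)) @^-1` `[0%R, +oo[%classic)%R).
  apply: fin_bigcap_measurable => // k _; rewrite -[X in measurable X]setTI.
  have mf : measurable_fun setT (fun x : mxb (K := K) (1 + m) (1 + m) =>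
      absv (x (lshift m 0%R) j) - absv (x (lshift m 0%R) k))%R.
    by apply: measurable_funB; apply: measurable_absv; exact: measurable_entry.
  by apply: mf => //; exact: measurable_itv.
apply/seteqP; split => x h k.
  by move=> _; rewrite /preimage/= in_itv/= andbT subr_ge0; exact: h.
by have := h k I; rewrite /preimage/= in_itv/= andbT subr_ge0.
Qed.

Lemma hint_sum I (r : seq I) m (f : I -> mxb (K := K) m m -> \bar R) :
  (forall i, measurable_fun setT (f i)) -> (forall i x, 0 <= f i x) ->
  hint mu nabs (fun x => \sum_(i <- r) f i x) = \sum_(i <- r) hint mu nabs (f i).
Proof.
move=> mf f0; rewrite /hint -ge0_integral_sum//.
- apply: eq_integral => x _; rewrite ge0_sume_distrl// => i _; exact: f0.
- by move=> i; exact: measurable_hint_integrand.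
- by move=> i x _; rewrite mule_ge0// lee_fin haar_weight_ge0.
Qed.

(** GL is covered by the sets where a given column holds the pivot of the first row; a column
    transposition carries each of them to the first one and changes [f] by a bounded factor. *)
Lemma zeta_pivot m (f : mxb (K := K) (1 + m) (1 + m) -> \bar R) :
  measurable_fun setT f -> (forall x, 0 <= f x) ->
  (forall M, exists2 C : R, (0 < C)%R & forall x y : 'M[K]_(1 + m), x \in unitmx ->
     bounded_gl M y -> f (x *m y) <= C%:E * f x) ->
  hint mu nabs (fun x => f x * (\1_(pivot_set (lshift m 0%R)) x)%:E) < +oo ->
  hint mu nabs f < +oo.
Proof.
move=> mf f0 fC fin0; pose z : 'I_(1 + m) := lshift m 0%R.
have mI j : measurable_fun setT (fun x : mxb (K := K) (1 + m) (1 + m) => (\1_(pivot_set j) x)%:E : \bar R).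
  exact (measurableT_comp (@EFin_measurable R setT) (@measurable_indic _ _ R setT _ (@measurable_pivot_set m j))).
have I0 j (x : mxb (K := K) (1 + m) (1 + m)) : 0 <= (\1_(pivot_set j) x)%:E :> \bar R by rewrite lee_fin.
have mfI j : measurable_fun setT (fun x => f x * (\1_(pivot_set j) x)%:E).
  exact (emeasurable_funM mf (mI j)).
apply: (@le_lt_trans _ _ (\sum_(j < 1 + m) hint mu nabs (fun x => f x * (\1_(pivot_set j) x)%:E))).
  rewrite -hint_sum//; last by move=> j x; exact: mule_ge0.
  apply: le_hint => //.
    by apply: emeasurable_sum => j; exact: mfI.
  move=> x xU; rewrite -ge0_sume_distrr//.
  rewrite -[leLHS]mule1; apply: lee_wpmul2l => //.
  rewrite (bigD1 [arg max_(k > z) absv (x z k)]%O)//= indicE mem_set; last first.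
    by move=> k; case: arg_maxP => [//|i _ hi]; exact: hi.
  by rewrite leeDl//; apply: sume_ge0.
apply: lte_sum_pinfty => j _.
pose P : 'M[K]_(1 + m) := tperm_mx z j.
have PP : P *m P = 1%:M by rewrite /P /tperm_mx -perm_mxM tperm2 perm_mx1.
have [PU _] := mulmx1_unit PP.
have [M bM] := bounded_gl_ex PU; have [C C0 hC] := fC M.
rewrite -(hint_mulr PU (mfI j)); last by move=> x; exact: mule_ge0.
have mP : measurable_fun setT ((mulmx)^~ P : mxb (K := K) (1 + m) (1 + m) -> mxb (1 + m) (1 + m)).
  by apply: measurable_mulmx; [exact: measurable_id|exact: measurable_cst].
apply: (@le_lt_trans _ _ (hint mu nabs (fun x => C%:E * (f x * (\1_(pivot_set z) x)%:E)))).
  apply: le_hint.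
  - exact (measurableT_comp (mfI j) mP).
  - by apply: emeasurable_funM; [exact: measurable_cst|exact: mfI].
  - by move=> x; exact: mule_ge0.
  move=> x xU; rewrite muleA; apply: lee_pmul => //; first exact: hC bM.
  rewrite lee_fin !indicE ler_nat; have [h|//] := boolP (x *m P \in _).
  rewrite (_ : _ \in _)//; apply/mem_set => k; move/set_mem: h => h.
  have xPE l : (x *m P) z l = x z (tperm z j l).
    by rewrite /P /tperm_mx -[in LHS](tpermV z j) -col_permE mxE.
  have := h (tperm z j k); rewrite -/z !xPE tpermK tpermR.
  exact.
rewrite hintZl//; last by move=> x; exact: mule_ge0.
by rewrite lte_mul_pinfty// lee_fin ltW.
by rewrite lee_fin ltW.
Qed.

End Zeta.

Section ZetaBound.
Context {R : realType} {K : absFieldType R}.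
Context {mu : {sigma_finite_measure set (borel K) -> \bar R}} {nabs : K -> R}.
Context {L : local_haar mu nabs}.

Lemma decay_le N N' p q p' q' (x : 'M[K]_(p, q)) (y : 'M[K]_(p', q')) :
  mx_size x <= mx_size y -> (N <= N')%N -> decay N' y <= decay N x.
Proof.
move=> xy NN'; have x0 := mx_size_ge0 x.
rewrite /decay lef_pV2 ?posrE ?exprn_gt0 ?ltr_wpDr// ?(le_trans x0)//.
apply: (@le_trans _ _ ((1 + mx_size y) ^+ N)).
  by apply: lerXn2r; rewrite ?nnegrE; lra.
by apply: ler_weXn2l => //; lra.
Qed.

Lemma decayD N N' p q (x : 'M[K]_(p, q)) : decay (N + N') x = decay N x * decay N' x.
Proof. by rewrite /decay exprD invfM. Qed.

Lemma mx_size_cube p q (u : 'M[K]_(p, q)) : (forall i j, absv (u i j) <= 1) ->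
  mx_size u <= (p * q)%:R.
Proof.
move=> u1; apply: (@le_trans _ _ (\sum_(i < p) \sum_(j < q) 1)).
  by apply: ler_sum => i _; apply: ler_sum => j _.
by rewrite !sumr_const !card_ord -mulrnA mulnC.
Qed.

(** The factor |r|^m on the left is the cost of the substitution u -> r u. Since det x = r det h,
    the weight |det x|^(-(1+m)) leaves 1/|r| and 1/|det h| times the weight of [h], and so every
    exponent drops by 1. The decay is shared between [r], [c] and [h]; for [h] it uses |h| <= |c u +
    h| + m |c|. *)
Lemma zeta_block_bound m (al : 'I_(1 + m) -> R) (N1 N2 N3 : nat) : exists2 A, 0 < A &
  forall (r : K) (u : 'rV[K]_m) (c : 'cV[K]_m) (h : 'M[K]_m) (x : 'M[K]_(1 + m)),
  x = block_mx r%:M (r *: u) c (c *m u + h) ->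
  r != 0 -> (forall i, absv (u 0 i) <= 1) -> h \in unitmx ->
  nabs r ^+ m * (flag nabs al x * decay (N1 + N2 + N3) x * haar_weight nabs x) <=
  A * (nabs r `^ (al (lshift m 0) - 1) * decay N1 (r%:M : 'M[K]_1) * decay N2 c) *
    (flag nabs (fun i => al (rshift 1 i) - 1) h * decay N3 h * haar_weight nabs h).
Proof.
have [C1 C10 h1] := @flag_block _ _ mu nabs L m al.
have [C2 C20 h2] := @flag_shift_le _ _ mu nabs L m (fun i => al (rshift 1 i)) (- 1).
exists (C1 * C2 * (1 + m%:R) ^+ N3) => [|r u c h x xE r0 u1 hU].
  by rewrite !mulr_gt0 ?exprn_gt0 ?ltr_pwDl.
have su : mx_size u <= m%:R.
  rewrite -[m in leRHS]mul1n; apply: mx_size_cube => i j; rewrite ord1; exact: u1.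
have sx : mx_size x = absv r + mx_size (r *: u) + (mx_size c + mx_size (c *m u + h)).
  by rewrite xE mx_size_block_mx mx_size11 mxE eqxx mulr1n.
have s1 := mx_size_ge0 (r *: u); have s2 := mx_size_ge0 c; have s3 := mx_size_ge0 (c *m u + h).
have ar := absv_ge0 r.
have d1 : decay N1 x <= decay N1 (r%:M : 'M[K]_1).
  by apply: decay_le => //; rewrite sx mx_size11 mxE eqxx mulr1n; lra.
have d2 : decay N2 x <= decay N2 c by apply: decay_le => //; rewrite sx; lra.
have d3 : decay N3 x <= (1 + m%:R) ^+ N3 * decay N3 h.
  apply: decay_scale; first by rewrite ltr_pwDl.
  have e1 : mx_size h <= mx_size (c *m u + h) + mx_size c * mx_size u.
    rewrite -[X in mx_size X <= _](addKr (c *m u)) addrC.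
    apply: le_trans (mx_sizeD _ _) _; rewrite mx_sizeN lerD2l; exact: mx_sizeM.
  have e2 : mx_size c * mx_size u <= mx_size c * m%:R by rewrite ler_wpM2l.
  have m0 : 0 <= (m%:R : R) by [].
  have e3 : m%:R * mx_size c <= m%:R * mx_size x by rewrite ler_wpM2l// sx; lra.
  rewrite mulrDl !mul1r mulrDr mulr1; move: e1 e2 e3; rewrite sx; lra.
have dx : \det x = r * \det h.
  have -> : x = (block_mx r%:M 0 c h : 'M[K]_(1 + m)) *m block_mx 1%:M u 0 1%:M.
    by rewrite xE mulmx_block !(mulmx0, mul0mx, mulmx1, mul1mx, addr0, add0r) mul_scalar_mx.
  by rewrite det_mulmx det_lblock det_ublock !det1 det_scalar1 !mulr1.
have nr0 : 0 < nabs r by exact: nabs_gt0.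
have nh0 : 0 < nabs (\det h) by apply: nabs_gt0; rewrite -unitfE -unitmxE.
have hw : nabs r ^+ m * haar_weight nabs x = nabs r `^ (- 1) * (nabs (\det h) `^ (- 1) * haar_weight nabs h).
  rewrite /haar_weight dx nabsM exprMn !exprS !powR_inv1 ?ltW//.
  have e1 : nabs r ^+ m != 0 by rewrite expf_neq0// gt_eqF.
  have e2 : nabs (\det h) ^+ m != 0 by rewrite expf_neq0// gt_eqF.
  have e3 : nabs r != 0 by rewrite gt_eqF.
  have e4 : nabs (\det h) != 0 by rewrite gt_eqF.
  by field; rewrite e1 e2 e3 e4.
have f1 := h1 r u c h r0 u1 hU; rewrite -xE in f1; have f2 := h2 h hU.
have raE : nabs r `^ (al (lshift m 0) - 1) = nabs r `^ al (lshift m 0) * nabs r `^ (- 1).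
  by rewrite powRD// (gt_eqF nr0) implybT.
rewrite raE !decayD.
move: f1 f2 d1 d2 d3 hw; set F := flag nabs al x; set ra := nabs r `^ al _.
set f' := flag _ _ h; set f'' := flag _ _ h; set ri := nabs r `^ _; set hi := nabs _ `^ _.
set D1 := decay N1 x; set D2 := decay N2 x; set D3 := decay N3 x.
set W := haar_weight _ x; set w := haar_weight _ h; set e1 := decay N1 _; set e2 := decay N2 c.
set e3 := decay N3 h; set E := (1 + m%:R) ^+ N3.
move=> f1 f2 d1 d2 d3 hw.
have -> : nabs r ^+ m * (F * (D1 * D2 * D3) * W) = F * D1 * D2 * D3 * (nabs r ^+ m * W) by ring.
rewrite hw.
have -> : C1 * C2 * E * (ra * ri * e1 * e2) * (f'' * e3 * w) =
   (C1 * ra * e1 * e2 * (E * e3) * (ri * w)) * (C2 * f'') by ring.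
have p0 : [/\ 0 <= ra, 0 <= ri, 0 <= w & 0 <= hi] by rewrite !powR_ge0 haar_weight_ge0.
case: p0 => ra0 ri0 w0 hi0; have F0 : 0 <= F by exact: flag_ge0.
have f0 : 0 <= f' by exact: flag_ge0.
have [D10 D20 D30] : [/\ 0 <= D1, 0 <= D2 & 0 <= D3] by rewrite !decay_ge0.
have [e10 e20 e30] : [/\ 0 <= e1, 0 <= e2 & 0 <= e3] by rewrite !decay_ge0.
have E0 : 0 <= E by rewrite exprn_ge0// addr_ge0.
apply: (@le_trans _ _ ((C1 * ra * e1 * e2 * (E * e3) * (ri * w)) * (f' * hi))).
  have -> : (C1 * ra * e1 * e2 * (E * e3) * (ri * w)) * (f' * hi) =
     (C1 * (ra * f')) * e1 * e2 * (E * e3) * (ri * (hi * w)) by ring.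
  apply: ler_wpM2r; first by rewrite !mulr_ge0.
  by rewrite !ler_pM ?mulr_ge0.
apply: ler_wpM2l; last exact: f2.
by rewrite !mulr_ge0// ltW.
Qed.

Local Open Scope ereal_scope.

Lemma measurable_EFin_fun d (X : measurableType d) (g : X -> R) : measurable_fun setT g ->
  measurable_fun setT (fun x => (g x)%:E).
Proof. by move=> mg; exact (measurableT_comp (@EFin_measurable R setT) mg). Qed.

Lemma lte_of_mull (c : R) (x : \bar R) : (0 < c)%R -> c%:E * x < +oo -> x < +oo.
Proof.
move=> c0; case: x => [x _|/=|_]; [exact: ltry| |by []].
by rewrite gt0_muley ?lte_fin.
Qed.

Lemma measurable_flag_decay n (al : 'I_n -> R) N :
  measurable_fun setT (fun x : mxb n n => (flag nabs al (x : 'M[K]_n) * decay N (x : 'M[K]_n))%:E : \bar R).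
Proof.
apply: measurable_EFin_fun; apply: measurable_funM.
  exact (measurable_flag al (@measurable_id _ (mxb n n) setT)).
exact (measurable_decay N (@measurable_id _ (mxb n n) setT)).
Qed.

Lemma flag_decay_ge0 n (al : 'I_n -> R) N (x : 'M[K]_n) : 0 <= (flag nabs al x * decay N x)%:E.
Proof. by rewrite lee_fin mulr_ge0 ?flag_ge0 ?decay_ge0. Qed.

End ZetaBound.

Section Zeta.
Context {R : realType} {K : absFieldType R}.
Context {mu : {sigma_finite_measure set (borel K) -> \bar R}} {nabs : K -> R}.
Context {L : local_haar mu nabs}.
Local Open Scope ereal_scope.

Lemma integral_scalarV p q (a : K) : a != 0%R ->
  forall H : mxb p q -> \bar R, measurable_fun setT H -> (forall x, 0 <= H x) ->
  \int[lam mu p q]_x H x =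
  (nabs a ^+ (p * q))%:E * \int[lam mu p q]_x H (a *: (x : 'M[K]_(p, q)))%R.
Proof.
move=> a0 H mH H0; have n0 : (0 < nabs a)%R by exact: nabs_gt0.
have -> := @integral_scalar _ _ mu nabs L p q _ a0 H mH H0.
by rewrite muleA -EFinM divff ?mul1e// expf_neq0// gt_eqF.
Qed.

(** For a fixed first column, u -> r u and h -> h + c u bring the integrand to the pivot form, whose
    bound is a product of functions of [u] and [h]. *)
Lemma zeta_inner m (H : mxb (1 + m) (1 + m) -> \bar R) (Zf : mxb m m -> \bar R) (B : R)
    (r : 'M[K]_1) (c : 'cV[K]_m) : r 0%R 0%R != 0%R -> (0 <= B)%R ->
  measurable_fun setT H -> (forall x, 0 <= H x) ->
  measurable_fun setT Zf -> (forall x, 0 <= Zf x) ->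
  (forall (u : 'rV[K]_m) (h : 'M[K]_m),
    (nabs (r 0 0)%R ^+ m)%:E *
      H (block_mx ((r 0 0)%R)%:M ((r 0 0)%R *: u) c (c *m u + h))%R <= B%:E * (cube_ind (u : mxb 1 m) * Zf h)) ->
  \int[lam mu 1 m]_u \int[lam mu m m]_h H (block_mx r (u : 'M[K]_(1, m)) c (h : 'M[K]_m)) <=
  B%:E * \int[lam mu m m]_h Zf h * (disk_volume (mu := mu) ^+ (1 * m))%:E.
Proof.
set rho := r 0%R 0%R => r0 B0 mH H0 mZ Z0 hH.
have rE : r = rho%:M by rewrite [r]mx11_scalar.
have nr0 : (0 < nabs rho)%R by exact: nabs_gt0.
have mb2 : measurable_fun setT (fun z : mxb 1 m * mxb m m =>
    H (block_mx r (z.1 : 'M[K]_(1, m)) c (z.2 : 'M[K]_m))).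
  apply: (measurableT_comp mH); apply: measurable_block_mx.
  - exact: measurable_cst.
  - exact: measurable_fst.
  - exact: measurable_cst.
  - exact: measurable_snd.
have mPhi : measurable_fun setT (fun u : mxb 1 m => \int[lam mu m m]_h H (block_mx r (u : 'M[K]_(1, m)) c (h : 'M[K]_m))).
  exact: (@measurable_integral _ _ _ _ _ (lam mu m m) (fun (u : mxb 1 m) (h : mxb m m) => H (block_mx r u c h))).
rewrite (integral_scalarV r0 mPhi); last by move=> u; exact: integral_ge0.
set Z := \int[lam mu m m]_h Zf h; set V := disk_volume (mu := mu).
have Z00 : 0 <= Z by exact: integral_ge0.
pose B' := (nabs rho ^- m * B)%R.
have B'0 : (0 <= B')%R by rewrite mulr_ge0// invr_ge0 exprn_ge0// ltW.
have BE : (nabs rho ^+ (1 * m))%:E * (B'%:E * Z * (V ^+ (1 * m))%:E) = B%:E * Z * (V ^+ (1 * m))%:E.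
  by rewrite !muleA -EFinM /B' mul1n mulrA divff ?mul1r// expf_neq0// gt_eqF.
rewrite -BE; apply: lee_wpmul2l; first by rewrite lee_fin exprn_ge0// ltW.
rewrite -(@integral_cube _ _ mu nabs L 1 m).
rewrite -ge0_integralZl//; last first.
- by rewrite mule_ge0.
- by move=> u _; exact: cube_ind_ge0.
- exact: measurable_cube_ind.
have ms : measurable_fun setT (fun u : mxb 1 m => (rho *: (u : 'M[K]_(1, m)))%R : mxb 1 m).
  apply/measurable_mxbP => i j; under eq_fun do rewrite mxE.
  by apply: measurable_absM; [exact: measurable_cst|exact: measurable_entry].
apply: ge0_le_integral => //.
- by move=> u _; exact: integral_ge0.
- exact (measurableT_comp mPhi ms).
- by apply: emeasurable_funM; [exact: measurable_cst|exact: measurable_cube_ind].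
move=> u _.
have mh : measurable_fun setT (fun h : mxb m m => H (block_mx r (rho *: (u : 'M[K]_(1, m)))%R c (h : 'M[K]_m))).
  exact (measurableT_comp mb2 (measurable_pair1 (_ : mxb 1 m))).
rewrite -(@integral_lam_shift _ _ mu nabs L _ _ (c *m (u : 'M[K]_(1, m)))%R _ mh)//.
rewrite muleAC -ge0_integralZl//; last first.
  by rewrite mule_ge0// cube_ind_ge0.
apply: ge0_le_integral => //.
- apply: (measurableT_comp mh); apply: measurable_addmx; [exact: measurable_id|exact: measurable_cst].
- by apply: emeasurable_funM => //; exact: measurable_cst.
move=> h _; rewrite /B' EFinM -!muleA lee_pdivlMl.
  by rewrite addrC rE; exact: hH.
by rewrite exprn_gt0.
Qed.

Lemma zeta_lty m (al : 'I_m -> R) : (forall i : 'I_m, ((i : nat)%:R < al i)%R) ->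
  exists N, hint mu nabs (fun x => (flag nabs al x * decay N x)%:E) < +oo.
Proof.
elim: m al => [|m IH] al hal.
  have [N hN] := @integral_decay_lty _ _ mu nabs L 0 0; exists N; rewrite /hint.
  apply: le_lt_trans hN; apply: ge0_le_integral => //.
  - by move=> x _; rewrite mule_ge0 ?flag_decay_ge0// lee_fin haar_weight_ge0.
  - exact (measurable_hint_integrand (measurable_flag_decay al N)).
  - exact (measurable_EFin_fun (measurable_decay N (@measurable_id _ (mxb 0 0) setT))).
  by move=> x _; rewrite /flag big_ord0 mul1r /haar_weight expr0 invr1 mule1.
move: al hal; rewrite -[m.+1]/(1 + m)%N => al hal.
have [N3 hN3] : exists N, hint mu nabs (fun x : 'M[K]_m =>
    (flag nabs (fun i => al (rshift 1 i) - 1) x * decay N x)%:E)%R < +oo.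
  (* Index [i] of the lower block is index i + 1 of the whole matrix, so al > i + 1 there; lowering
     the exponents by 1 gives exactly the induction hypothesis. *)
  apply: IH => i; have := hal (rshift 1 i); rewrite /= natrD; lra.
(* The condition al_0 > 0 is the convergence of Tate's integral in the pivot. *)
have a0 : (-1 < al (lshift m 0) - 1)%R by have := hal (lshift m 0)%R; rewrite /=; lra.
have [N1 hN1] := @integral_tate _ _ mu nabs L _ a0.
have [N2 hN2] := @integral_decay_lty _ _ mu nabs L m 1.
have [A A0 hA] := zeta_block_bound al N1 N2 N3.
exists (N1 + N2 + N3)%N; set N := (N1 + N2 + N3)%N.
have mf := @measurable_flag_decay R K mu nabs L (1 + m) al N.
apply: (@zeta_pivot _ _ mu nabs L m _ mf (@flag_decay_ge0 _ _ nabs _ al N)).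
  move=> M; have [C1 C10 h1] := @flag_mulr_le _ _ mu nabs L (1 + m) al M.
  exists (C1 * (1 + `|M|) ^+ N)%R => [|x y xU bxy].
    by rewrite mulr_gt0// exprn_gt0// ltr_pwDl.
  rewrite -EFinM lee_fin mulrACA; apply: ler_pM; rewrite ?flag_ge0 ?decay_ge0//.
    exact: h1.
  exact: decay_mulr.
pose H (x : mxb (1 + m) (1 + m)) : \bar R := (flag nabs al (x : 'M[K]_(1 + m)) * decay N (x : 'M[K]_(1 + m)))%:E
  * (\1_(pivot_set (lshift m 0%R)) x)%:E * (haar_weight nabs (x : 'M[K]_(1 + m)))%:E.
have mH : measurable_fun setT H.
  apply: (measurable_hint_integrand (f := fun x : mxb (1 + m) (1 + m) => (flag nabs al (x : 'M[K]_(1 + m)) * decay N (x : 'M[K]_(1 + m)))%:E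
  * (\1_(pivot_set (lshift m 0%R)) x)%:E)).
  apply: emeasurable_funM => //.
  exact (measurableT_comp (@EFin_measurable R setT) (@measurable_indic _ _ R setT _ (@measurable_pivot_set _ _ m (lshift m 0%R)))).
have H0 x : 0 <= H x by rewrite !mule_ge0 ?flag_decay_ge0// lee_fin haar_weight_ge0.
rewrite [X in X < _](_ : _ = \int[lam mu (1 + m) (1 + m)]_x H x)//.
have [c0 hc] := @integral_block _ _ mu nabs L m.
have [hE c00] := hc H mH H0.
apply: (@lte_of_mull _ c0) => //; rewrite -hE {hE}.
pose Zf (h : mxb m m) : \bar R := (flag nabs (fun i => al (rshift 1 i) - 1) (h : 'M[K]_m) * decay N3 (h : 'M[K]_m))%:E%R * (haar_weight nabs (h : 'M[K]_m))%:E.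
have mZ : measurable_fun setT Zf.
  exact: (measurable_hint_integrand (@measurable_flag_decay R K mu nabs L m (fun i => al (rshift 1 i) - 1)%R N3)).
have Z0 h : 0 <= Zf h by rewrite mule_ge0 ?flag_decay_ge0// lee_fin haar_weight_ge0.
pose V := (disk_volume (mu := mu) ^+ (1 * m))%:E.
pose g1 (r : mxb 1 1) : \bar R := (nabs ((r : 'M[K]_1) 0 0) `^ (al (lshift m 0) - 1) * decay N1 (r : 'M[K]_1))%:E%R.
pose g2 (c : mxb m 1) : \bar R := (decay N2 (c : 'cV[K]_m))%:E.
have mg1 : measurable_fun setT g1.
  apply: measurable_EFin_fun; apply: measurable_funM; first exact: measurable_nabs_entry.
  exact (measurable_decay N1 (@measurable_id _ (mxb 1 1) setT)).
have mg2 : measurable_fun setT g2.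
  exact (measurable_EFin_fun (measurable_decay N2 (@measurable_id _ (mxb m 1) setT))).
have g10 r : 0 <= g1 r by rewrite lee_fin mulr_ge0 ?powR_ge0 ?decay_ge0.
have g20 c : 0 <= g2 c by rewrite lee_fin decay_ge0.
pose W := A%:E * (\int[lam mu m m]_h Zf h * V).
have V0 : 0 <= V by rewrite lee_fin exprn_ge0// ltW// disk_volume_gt0.
have IZ0 : 0 <= \int[lam mu m m]_h Zf h by exact: integral_ge0.
have W0 : 0 <= W by rewrite /W; apply: mule_ge0; [rewrite lee_fin ltW|exact: mule_ge0].
have inner (p : mxb (K := K) 1 1 * mxb (K := K) m 1) :
    \int[prodm (lam mu 1 m) (lam mu m m)]_q H (block_of (p, q)) <= W * (g1 p.1 * g2 p.2).
  case: p => r c /=.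
  rewrite (@integral_prodm _ _ _ _ _ (lam mu 1 m) (lam mu m m) (fun u h => H (block_of ((r, c), (u, h)))))//; last first.
    apply: (measurableT_comp mH); rewrite /block_of /=; apply: measurable_block_mx.
    - exact: measurable_cst.
    - exact: measurable_fst.
    - exact: measurable_cst.
    - exact: measurable_snd.
  (* If the pivot is 0, the whole first row vanishes on the pivot set; the matrix is singular and
     its Haar weight is 0. *)
  rewrite /block_of /=; have [r0|r0] := eqVneq ((r : 'M[K]_1) 0 0)%R 0%R.
    rewrite [leLHS](_ : _ = 0); first by rewrite mule_ge0// mule_ge0.
    apply: integral0_eq => u _; apply: integral0_eq => h _; rewrite /H.
    rewrite indicE; have [/set_mem hp|//] := boolP (_ \in pivot_set _); last by rewrite mule0 mul0e.
    rewrite haar_weight_sing ?mule0// unitmxE unitfE negbK.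
    set x := block_mx _ _ _ _ in hp *.
    have x0 k : x (lshift m 0%R) k = 0%R.
      apply/eqP; rewrite -absv_eq0 eq_le absv_ge0 andbT.
      by apply: le_trans (hp k) _; rewrite /x block_mxEul r0 absv0.
    rewrite (expand_det_row _ (lshift m 0)%R) big1// => k _.
    by rewrite x0 mul0r.
  pose Q := (A * (nabs ((r : 'M[K]_1) 0 0) `^ (al (lshift m 0) - 1) * decay N1 (r : 'M[K]_1) * decay N2 (c : 'cV[K]_m)))%R.
  have -> : W * (g1 r * g2 c) = Q%:E * \int[lam mu m m]_h Zf h * V.
    rewrite /Q /W /g1 /g2 -EFinM -!mulrA [in RHS]EFinM -!muleA; congr (_ * _).
    by rewrite muleA muleC.
  have Q0 : (0 <= Q)%R by rewrite /Q !mulr_ge0 ?powR_ge0 ?decay_ge0// ltW.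
  have QZ (u : mxb 1 m) (h : mxb m m) : 0 <= Q%:E * (cube_ind u * Zf h).
    by apply: mule_ge0; [rewrite lee_fin|apply: mule_ge0; [exact: cube_ind_ge0|exact: Z0]].
  apply: zeta_inner => //.
  move=> u h; set rho := (r : 'M[K]_1) 0%R 0%R in r0 *.
  set x := block_mx _ _ _ _.
  have [hU|hU] := boolP (h \in unitmx); last first.
    rewrite /H (_ : haar_weight _ _ = 0%R) ?mule0; last first.
      apply: haar_weight_sing; move: hU; rewrite !unitmxE !unitfE !negbK => /eqP h0.
      have -> : x = (block_mx rho%:M 0 c h : 'M[K]_(1 + m)) *m block_mx 1%:M u 0 1%:M.
        by rewrite /x mulmx_block !(mulmx0, mul0mx, mulmx1, mul1mx, addr0, add0r) mul_scalar_mx.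
      by rewrite det_mulmx det_lblock h0 mulr0 mul0r.
    exact: QZ.
  have [hp|hp] := boolP ((x : mxb (1 + m) (1 + m)) \in pivot_set (lshift m 0%R)); last first.
    rewrite /H indicE (negbTE hp) mule0 mul0e mule0.
    exact: QZ.
  have u1 i : (absv (u 0%R i) <= 1)%R.
    move/set_mem: hp => /(_ (rshift 1 i)); rewrite /x block_mxEul block_mxEur !mxE eqxx mulr1n.
    by rewrite absvM ger_pMr// absv_gt0.
  rewrite /H indicE hp mule1 /cube_ind indicE mem_set ?mul1e; last by move=> i j; rewrite ord1.
  rewrite /Zf -!EFinM lee_fin.
  have rE : rho%:M = r :> 'M[K]_1 by rewrite [RHS]mx11_scalar.
  by have := hA _ _ _ _ x erefl r0 u1 hU; rewrite rE.
rewrite (@integral_prodm _ _ _ _ _ (prodm (lam mu 1 1) (lam mu m 1)) (prodm (lam mu 1 m) (lam mu m m)) (fun p q => H (block_of (p, q))))//; last first.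
  apply: (eq_measurable_fun (fun z => H (block_of z))); first by case.
  exact (measurableT_comp mH (@measurable_block_of _ _ m)).
apply: (@le_lt_trans _ _ (\int[prodm (lam mu 1 1) (lam mu m 1)]_p (W * (g1 p.1 * g2 p.2)))).
  apply: ge0_le_integral.
  - exact: measurableT.
  - by move=> p _; exact: integral_ge0.
  - apply: (@measurable_integral _ _ _ _ _ (prodm (lam mu 1 m) (lam mu m m)) (fun p q => H (block_of (p, q)))) => //.
    apply: (eq_measurable_fun (fun z => H (block_of z))); first by case.
    exact (measurableT_comp mH (@measurable_block_of _ _ m)).
  - apply: emeasurable_funM; first exact: measurable_cst.
    by apply: emeasurable_funM; [exact (measurableT_comp mg1 measurable_fst)|exact (measurableT_comp mg2 measurable_snd)].
  - by move=> p _; exact: inner.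
have mgg : measurable_fun setT (fun p : mxb (K := K) 1 1 * mxb (K := K) m 1 => g1 p.1 * g2 p.2).
  by apply: emeasurable_funM; [exact (measurableT_comp mg1 measurable_fst)|exact (measurableT_comp mg2 measurable_snd)].
rewrite ge0_integralZl//; last by move=> p _; rewrite mule_ge0.
rewrite (@integral_prodm _ _ _ _ _ (lam mu 1 1) (lam mu m 1) (fun r c => g1 r * g2 c))//; last by move=> r c; exact: mule_ge0.
have -> : \int[lam mu 1 1]_r \int[lam mu m 1]_c (g1 r * g2 c) =
    (\int[lam mu m 1]_c g2 c) * \int[lam mu 1 1]_r g1 r.
  have I2 : 0 <= \int[lam mu m 1]_c g2 c by exact: integral_ge0.
  rewrite -(ge0_integralZl (lam mu 1 1) measurableT mg1 (fun r _ => g10 r) I2).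
  apply: eq_integral => r _; rewrite (ge0_integralZl (lam mu m 1) measurableT mg2 (fun c _ => g20 c) (g10 r)).
  by rewrite muleC.
have finM (x y : \bar R) : 0 <= x -> x < +oo -> y < +oo -> x * y < +oo.
  by move=> x0 xf yf; rewrite lte_mul_pinfty// ge0_fin_numE.
apply: (finM) => //.
  apply: (finM); [by rewrite lee_fin ltW|exact: ltry|].

  by apply: (finM) => //; exact: ltry.
by apply: (finM) => //; exact: integral_ge0.
Qed.
End Zeta.

(** * Convolution and the Godement section *)

Section Convolution.
Context {R : realType} {K : absFieldType R}.
Context {mu : {sigma_finite_measure set (borel K) -> \bar R}} {nabs : K -> R}.
Context {L : local_haar mu nabs}.

Lemma bounded_gl_inv n (M : R) (x : 'M[K]_n) : bounded_gl M x -> bounded_gl M (invmx x).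
Proof. by move=> [xU h1 h2]; split; rewrite ?unitmx_inv ?invmxK. Qed.

Lemma nabs_det_gt0 n (x : 'M[K]_n) : x \in unitmx -> 0 < nabs (\det x).
Proof. by rewrite unitmxE unitfE; exact: nabs_gt0. Qed.

Lemma nabs_detM_powR n (x y : 'M[K]_n) (s : R) :
  nabs (\det (x *m y)) `^ s = nabs (\det x) `^ s * nabs (\det y) `^ s.
Proof. by rewrite det_mulmx nabsM powRM ?nabs_ge0. Qed.

Lemma flag_shift_ge n (al : 'I_n -> R) (s : R) : exists2 C, 0 < C & forall x : 'M[K]_n,
  x \in unitmx -> flag nabs (fun i => al i + s) x <= C * (flag nabs al x * nabs (\det x) `^ s).
Proof.
have [C C0 hC] := @flag_shift_le _ _ mu nabs L n (fun i => al i + s) (- s).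
exists C => // x xU; have := hC x xU.
rewrite (_ : flag nabs (fun i => al i + s - s) x = flag nabs al x); last first.
  by apply: eq_bigr => i _; rewrite addrK.
have d0 : 0 < nabs (\det x) `^ s by rewrite powR_gt0// nabs_det_gt0.
by rewrite powRN ler_pdivrMr// mulrA.
Qed.

Local Open Scope ereal_scope.

Lemma measurable_nabs_det d (X : measurableType d) n (f : X -> mxb n n) (s : R) :
  measurable_fun setT f -> measurable_fun setT (fun x => nabs (\det (f x : 'M[K]_n)) `^ s)%R.
Proof.
move=> mf; exact (measurableT_comp (measurable_powR s) (measurable_nabs (measurable_det mf))).
Qed.

(** For x = b k, left translation by [k] removes it from the flag function and moves it to the
    decaying factor, which changes boundedly; the character of [b] comes out. What remains is the
    Godement-Jacquet integral, independent of [x]. *)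
Lemma flag_conv n (al : 'I_n -> R) : (forall i : 'I_n, ((i : nat)%:R < al i)%R) ->
  exists N (C : R), (0 < C)%R /\ forall x : 'M[K]_n, x \in unitmx ->
  hint mu nabs (fun y => (flag nabs al (x *m y) * decay N y)%:E) <= (C * flag nabs al x)%:E.
Proof.
move=> /(@zeta_lty _ _ mu nabs L)[N hN]; exists N.
set Z := hint mu nabs _ in hN.
have Z0 : 0 <= Z by apply: hint_ge0 => x; exact: flag_decay_ge0.
have Zf : Z \is a fin_num by rewrite ge0_fin_numE.
have [M hM] := @iwasawa R K n; have [c c0 hc] := @flag_ge _ _ mu nabs L n al M.
pose D := ((1 + `|M|) ^+ N)%R; have D0 : (0 < D)%R by rewrite exprn_gt0// ltr_pwDl.
exists (D * (fine Z + 1) / c)%R; split.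
  by rewrite divr_gt0// mulr_gt0// ltr_wpDl// fine_ge0.
move=> x xU; have [b [k [bT bU bk xE]]] := hM x xU.
have kU : k \in unitmx by case: bk.
pose be := (\prod_i nabs (b i i) `^ al i)%R.
have be0 : (0 <= be)%R by apply: prodr_ge0 => i _; exact: powR_ge0.
pose F (y : mxb n n) : \bar R := (be * (flag nabs al (y : 'M[K]_n) * decay N (invmx k *m (y : 'M[K]_n))))%:E%R.
have mF : measurable_fun setT F.
  apply: measurable_EFin_fun; apply: measurable_funM; first exact: measurable_cst.
  apply: measurable_funM; first exact (measurable_flag al (@measurable_id _ (mxb n n) setT)).
  apply: measurable_decay; apply: measurable_mulmx; [exact: measurable_cst|exact: measurable_id].
have F0 y : 0 <= F y by rewrite lee_fin mulr_ge0// mulr_ge0 ?flag_ge0 ?decay_ge0.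
have mfd := @measurable_flag_decay R K mu nabs L n al N.
rewrite [leLHS](_ : _ = hint mu nabs (fun y => F (k *m y))); last first.
  apply: eq_hint => y yU; rewrite /F mulKmx// xE -mulmxA flag_trig_mul ?unitmx_mul ?kU//.
  by rewrite mulrA.
rewrite hint_mull//.
apply: (@le_trans _ _ (hint mu nabs (fun y => (be * D)%:E * (flag nabs al y * decay N y)%:E))).
  apply: le_hint => //.
    by apply: emeasurable_funM => //; exact: measurable_cst.
  move=> y yU; rewrite /F -EFinM lee_fin -!mulrA ler_wpM2l// mulrCA ler_wpM2l ?flag_ge0//.
  exact: decay_mull (bounded_gl_inv bk).
rewrite hintZl//; last first.
- by move=> y; exact: flag_decay_ge0.
- by rewrite lee_fin mulr_ge0// ltW.
rewrite -/Z -(fineK Zf) -EFinM lee_fin xE flag_trig_mul// -/be.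
have hk := hc k bk; have fZ : (0 <= fine Z)%R by rewrite fine_ge0.
have -> : (D * (fine Z + 1) / c * (be * flag nabs al k) = be * D * ((fine Z + 1) * (flag nabs al k / c)))%R by ring.
apply: ler_wpM2l; first by rewrite mulr_ge0// ltW.
apply: (@le_trans _ _ (fine Z + 1)%R); first by rewrite lerDl.
by rewrite ler_peMr ?addr_ge0// ler_pdivlMr// mul1r.
Qed.

(** [flag_conv] for the exponents al + s; the power of the determinant is moved into the exponents
    before the integration and out of them afterwards. *)
Lemma flag_det_conv n (al : 'I_n -> R) (s : R) : (forall i : 'I_n, ((i : nat)%:R < al i + s)%R) ->
  exists N (C : R), (0 < C)%R /\ forall x : 'M[K]_n, x \in unitmx ->
  hint mu nabs (fun y => (flag nabs al (x *m y) * nabs (\det (x *m y)) `^ s * decay N y)%:E) <=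
  (C * (flag nabs al x * nabs (\det x) `^ s))%:E.
Proof.
move=> /flag_conv[N [C [C0 hC]]]; exists N.
have [C1 C10 h1] := @flag_shift_le _ _ mu nabs L n al s.
have [C2 C20 h2] := flag_shift_ge al s.
exists (C1 * (C * C2))%R; split=> [|x xU]; first by rewrite !mulr_gt0.
pose al' i := (al i + s)%R.
have mx : measurable_fun setT (fun y : mxb n n => x *m (y : 'M[K]_n) : mxb n n).
  by apply: measurable_mulmx; [exact: measurable_cst|exact: measurable_id].
have mfx (be : 'I_n -> R) := @measurable_flag _ _ mu nabs L _ _ n be _ mx.
have md : measurable_fun setT (fun y : mxb n n => decay N (y : 'M[K]_n)).
  exact (measurable_decay N (@measurable_id _ (mxb n n) setT)).
have mh : measurable_fun setT (fun y : mxb n n => (flag nabs al' (x *m (y : 'M[K]_n)) * decay N (y : 'M[K]_n))%:E%R : \bar R).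
  by apply: measurable_EFin_fun; apply: measurable_funM.
apply: (@le_trans _ _ (hint mu nabs (fun y => C1%:E * (flag nabs al' (x *m y) * decay N y)%:E%R))).
  apply: le_hint.
  - apply: measurable_EFin_fun; apply: measurable_funM => //; apply: measurable_funM => //.
    exact: measurable_nabs_det.
  - by apply: emeasurable_funM => //; exact: measurable_cst.
  - by move=> y; rewrite lee_fin mulr_ge0 ?mulr_ge0 ?flag_ge0 ?powR_ge0 ?decay_ge0.
  move=> y yU; rewrite -EFinM lee_fin mulrA ler_wpM2r ?decay_ge0//.
  by apply: h1; rewrite unitmx_mul xU.
rewrite hintZl//; last first.
- by move=> y; rewrite lee_fin mulr_ge0 ?flag_ge0 ?decay_ge0.
- by rewrite lee_fin ltW.
rewrite -mulrA EFinM; apply: lee_wpmul2l; first by rewrite lee_fin ltW.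
apply: le_trans (hC x xU) _; rewrite lee_fin -mulrA ler_wpM2l ?(ltW C0)//.
exact: h2.
Qed.


Definition up n (g : 'M[K]_n.+1) : 'M[K]_(n, n.+1) := rowsub (widen_ord (leqnSn n)) g.

Lemma up_trig_mul n (b x : 'M[K]_n.+1) : is_trig_mx b ->
  up (b *m x) = mxsub (widen_ord (leqnSn n)) (widen_ord (leqnSn n)) b *m up x.
Proof.
move=> /is_trig_mxP bT; apply/matrixP => i j; rewrite !mxE big_ord_recr/=.
by rewrite bT//= mul0r addr0; apply: eq_bigr => l _; rewrite !mxE.
Qed.

Lemma mx_size_up n (g : 'M[K]_n.+1) : (mx_size (up g) <= mx_size g)%R.
Proof.
rewrite /mx_size big_ord_recr/= -[leLHS]addr0; apply: lerD.
  by apply: ler_sum => i _; apply: ler_sum => j _; rewrite mxE.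
by apply: sumr_ge0 => j _; exact: absv_ge0.
Qed.

Lemma measurable_up d (X : measurableType d) n (f : X -> mxb n.+1 n.+1) :
  measurable_fun setT f -> measurable_fun setT (fun x => up (f x : 'M[K]_n.+1) : mxb n n.+1).
Proof. by move=> mf; exact: measurable_mxsub. Qed.

(** The integrand of Godement's section. The exponents are relative to the last one, which is
    carried by the power of |det g| in [godement]. *)
Definition god n (be : 'I_n.+1 -> R) N (g : 'M[K]_n.+1) (k : 'M[K]_n) : R :=
  (decay N (invmx k *m up g) * flag nabs (fun i => be (widen_ord (leqnSn n) i) - be ord_max) k)%R.

(* Both sides transform in the same way under lower triangular matrices. *)
Lemma godement n (be : 'I_n.+1 -> R) N : exists2 C : R, (0 < C)%R &
  forall g : 'M[K]_n.+1, g \in unitmx ->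
  (flag nabs be g)%:E <= (C * nabs (\det g) `^ be ord_max)%:E * hint mu nabs (fun k => (god be N g k)%:E).
Proof.
have [M hM] := @iwasawa R K n.+1.
have [C1 C10 h1] := @flag_le _ _ mu nabs L n.+1 be M.
have [C2 C20 h2] := @nabs_det_bounded _ _ mu nabs L n.+1 M (- be ord_max).
pose ga (i : 'I_n) := (be (widen_ord (leqnSn n) i) - be ord_max)%R.
pose D := ((1 + `|M|) ^+ N)%R; have D0 : (0 < D)%R by rewrite exprn_gt0// ltr_pwDl.
pose J := hint mu nabs (fun k : 'M[K]_n => (decay N (invmx k) * flag nabs ga k)%:E).
have mJ : measurable_fun setT (fun k : mxb n n => (decay N (invmx (k : 'M[K]_n)) * flag nabs ga (k : 'M[K]_n))%:E : \bar R).
  apply: measurable_EFin_fun; apply: measurable_funM; last exact (measurable_flag ga (@measurable_id _ (mxb n n) setT)).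
  exact (measurable_decay N (measurable_invmx (@measurable_id _ (mxb n n) setT))).
have J0 : 0 < J.
  apply: hint_gt0 => // k; first by rewrite lee_fin mulr_ge0 ?decay_ge0 ?flag_ge0.
  by move=> kU; rewrite lte_fin mulr_gt0 ?decay_gt0 ?flag_gt0.
(* [J] may be infinite; only a positive real below it is wanted. *)
have [j j0 hj] : exists2 j : R, (0 < j)%R & j%:E <= J.
  move: J0; case: J => [r r0|_|//]; first by exists r.
  by exists 1%R => //; rewrite leey.
exists (C1 * C2 * D / j)%R => [|g gU]; first by rewrite divr_gt0// !mulr_gt0.
have [b [k [bT bU bk gE]]] := hM g gU; have kU : k \in unitmx by case: bk.
pose b' := mxsub (widen_ord (leqnSn n)) (widen_ord (leqnSn n)) b.
have b'T : is_trig_mx b' by apply/is_trig_mxP => p q pq; rewrite mxE; exact: (is_trig_mxP bT).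
have b'U : b' \in unitmx.
  rewrite unitmxE unitfE det_trig//; apply/prodf_neq0 => i _; rewrite mxE.
  exact: trig_diag_neq0.
pose P := (\prod_i nabs (b' i i) `^ ga i)%R.
have P0 : (0 <= P)%R by apply: prodr_ge0 => i _; exact: powR_ge0.
have mgod (y : 'M[K]_n.+1) : measurable_fun setT (fun k : mxb n n => (god be N y k)%:E).
  apply: measurable_EFin_fun; apply: measurable_funM; last exact (measurable_flag ga (@measurable_id _ (mxb n n) setT)).
  apply: measurable_decay; apply: measurable_mulmx; last exact: measurable_cst.
  exact (measurable_invmx (@measurable_id _ (mxb n n) setT)).
have god0 (y : 'M[K]_n.+1) k' : 0 <= (god be N y k')%:E.
  by rewrite lee_fin mulr_ge0 ?decay_ge0 ?flag_ge0.
have PJ : (P / D)%:E * J <= hint mu nabs (fun k => (god be N g k)%:E).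
  have JE : (P / D)%:E * J = hint mu nabs (fun k : 'M[K]_n => (P / D)%:E * (decay N (invmx k) * flag nabs ga k)%:E).
    apply/esym/(@hintZl _ _ mu nabs L n (P / D)%:E _ _ mJ); first by rewrite lee_fin divr_ge0// ltW.
    by move=> x; rewrite lee_fin mulr_ge0 ?decay_ge0 ?flag_ge0.
  (* The first rows of b k are b' (first rows of k). Replacing the integration variable by b' times
     itself cancels [b'] inside the decay and extracts its character [P]. *)
  rewrite JE; have <- := @hint_mull _ _ mu nabs L n b' _ b'U (mgod g) (god0 g).
  apply: le_hint.
  - by apply: emeasurable_funM => //; exact: measurable_cst.
  - apply: (measurableT_comp (mgod g)); apply: measurable_mulmx; [exact: measurable_cst|exact: measurable_id].
  - by move=> x; rewrite -EFinM lee_fin mulr_ge0 ?divr_ge0 ?mulr_ge0 ?decay_ge0 ?flag_ge0// ltW.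
  move=> y yU; rewrite -EFinM lee_fin /god gE up_trig_mul// -/b'.
  rewrite invmx_mulmx// -mulmxA (mulmxA (invmx b')) mulVmx// mul1mx flag_trig_mul// -/ga -/P.
  rewrite !mulrA; apply: ler_wpM2r; first exact: flag_ge0.
  rewrite [leRHS]mulrC -mulrA; apply: ler_wpM2l => //.
  rewrite ler_pdivrMl//; apply: decay_scale; first by rewrite ltr_pwDl.
  have s1 : (mx_size (invmx y *m up k) <= mx_size (invmx y) * `|M|)%R.
    apply: le_trans (mx_sizeM _ _) _; apply: ler_wpM2l; first exact: mx_size_ge0.
    apply: le_trans (mx_size_up _) _; case: bk => _ + _.
    by move=> /le_trans; apply; exact: ler_norm.
  have := mx_size_ge0 (invmx y); have : (0 <= `|M|)%R by [].
  by move: s1; nra.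
apply: (@le_trans _ _ ((C1 * C2 * D / j * nabs (\det g) `^ be ord_max)%:E * ((P / D)%:E * j%:E))); last first.
  apply: lee_wpmul2l.
    by rewrite lee_fin !mulr_ge0 ?powR_ge0 ?invr_ge0 ?mulr_ge0 ?ltW.
  apply: le_trans PJ; apply: lee_wpmul2l => //.
  by rewrite lee_fin divr_ge0// ltW.
rewrite -!EFinM lee_fin gE flag_trig_mul// nabs_detM_powR.
pose Q := (\prod_i nabs (b i i) `^ be i)%R.
have Q0 : (0 <= Q)%R by apply: prodr_ge0 => i _; exact: powR_ge0.
(* The characters agree: for the first [n] diagonal entries the last exponent cancels in the sum,
   and the last diagonal entry occurs only in det b. *)
have QE : (nabs (\det b) `^ be ord_max * P = Q)%R.
  rewrite /Q big_ord_recr/= /P det_trig//.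
  have pr m (F : 'I_m -> K) s : (nabs (\prod_i F i) `^ s = \prod_i nabs (F i) `^ s)%R.
    elim/big_rec2: _ => [|i u v _ <-]; first by rewrite nabs1 powR1.
    by rewrite nabsM powRM ?nabs_ge0.
  rewrite pr big_ord_recr/= mulrAC -big_split/=; congr (_ * _)%R.
  apply: eq_bigr => i _; rewrite mxE -powRD; first by rewrite /ga addrC subrK.
  by rewrite (gt_eqF (nabs_gt0 _)) ?implybT// trig_diag_neq0.
have D0' : D != 0%R by rewrite gt_eqF.
have j0' : j != 0%R by rewrite gt_eqF.
have -> : (C1 * C2 * D / j * (nabs (\det b) `^ be ord_max * nabs (\det k) `^ be ord_max) * (P / D * j) =
  (nabs (\det b) `^ be ord_max * P) * (C1 * (C2 * nabs (\det k) `^ be ord_max)))%R.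
  by field; rewrite D0' j0'.
rewrite QE -/Q; apply: ler_wpM2l => //; apply: le_trans (h1 k bk) _.
have := h2 k bk; rewrite powRN => hk; rewrite ler_peMr ?(ltW C10)//.
have dk : (0 < nabs (\det k) `^ be ord_max)%R by rewrite powR_gt0// nabs_det_gt0.
by move: hk; rewrite invf_ple ?posrE// -ler_pdivrMl// mulr1.
Qed.

End Convolution.
Arguments god {R K} nabs {n} be N g k.

(** * The matrices z *)

Section ZAlgebra.
Variable F : fieldType.

Lemma ord_lastP n (i : 'I_n.+1) : (exists j : 'I_n, i = widen_ord (leqnSn n) j) \/ i = ord_max.
Proof.
have [in_|ni] := ltnP i n; first by left; exists (Ordinal in_); apply/val_inj.
by right; apply/val_inj/eqP; rewrite eqn_leq ni -ltnS ltn_ord.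
Qed.

Lemma cast_lshift n (i : 'I_n) :
  cast_ord (esym (addn1 n)) (widen_ord (leqnSn n) i) = lshift 1 i.
Proof. exact/val_inj. Qed.

Lemma cast_rshift n : cast_ord (esym (addn1 n)) ord_max = rshift n (0 : 'I_1).
Proof. by apply/val_inj; rewrite /= addn0. Qed.

Lemma castmx_block p q (A : 'M[F]_(p, q)) (B : 'M[F]_(p, 1)) (C : 'M[F]_(1, q)) (D : 'M[F]_1)
    (M := castmx (addn1 p, addn1 q) (block_mx A B C D)) :
  [/\ forall i j, M (widen_ord (leqnSn p) i) (widen_ord (leqnSn q) j) = A i j,
      forall i, M (widen_ord (leqnSn p) i) ord_max = B i 0,
      forall j, M ord_max (widen_ord (leqnSn q) j) = C 0 j &
      M ord_max ord_max = D 0 0].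
Proof.
by split=> *; rewrite castmxE /= ?cast_lshift ?cast_rshift
  ?(block_mxEul, block_mxEur, block_mxEdl, block_mxEdr).
Qed.

Lemma bordered_mulmx n (A B : 'M[F]_n) : bordered A *m bordered B = bordered (A *m B).
Proof.
rewrite /bordered; set e := addn1 n.
have -> : forall m (e : (n + 1 = m)%N) (X Y : 'M[F]_(n + 1)),
    castmx (e, e) X *m castmx (e, e) Y = castmx (e, e) (X *m Y).
  by move=> m e'; case: m / e'.
by rewrite mulmx_block !(mulmx0, mul0mx, mulmx1, addr0, add0r).
Qed.

Lemma bordered1 n : bordered (1%:M : 'M[F]_n) = 1%:M.
Proof.
rewrite /bordered -scalar_mx_block; set e := addn1 n.
by have -> : forall m (e : (n + 1 = m)%N), castmx (e, e) (1%:M : 'M[F]_(n + 1)) = 1%:M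
  by move=> m e'; case: m / e'.
Qed.

Lemma det_castmx n m (e : n = m) (A : 'M[F]_n) : \det (castmx (e, e) A) = \det A.
Proof. by case: m / e. Qed.

Lemma det_bordered n (A : 'M[F]_n) : \det (bordered A) = \det A.
Proof. by rewrite /bordered det_castmx det_lblock det1 mulr1. Qed.

Lemma bordered_unit n (A : 'M[F]_n) : (bordered A \in unitmx) = (A \in unitmx).
Proof. by rewrite !unitmxE det_bordered. Qed.

Lemma bordered_inv n (A : 'M[F]_n) : A \in unitmx -> invmx (bordered A) = bordered (invmx A).
Proof.
move=> AU; have bU : bordered A \in unitmx by rewrite bordered_unit.
by apply: (can_inj (mulKmx bU)); rewrite mulmxV// bordered_mulmx mulmxV// bordered1.
Qed.

Lemma trmx_bordered n (A : 'M[F]_n) : (bordered A)^T = bordered A^T.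
Proof.
rewrite /bordered trmx_cast tr_block_mx !trmx0 trmx1.
by congr (castmx _ _); congr (_, _); exact: eq_irrelevance.
Qed.

Lemma iota_mxM n (A B : 'M[F]_n) : A \in unitmx -> B \in unitmx ->
  iota_mx (A *m B) = iota_mx A *m iota_mx B.
Proof. by move=> AU BU; rewrite /iota_mx invmx_mulmx// trmx_mul. Qed.

Lemma iota_mx_unit n (A : 'M[F]_n) : (iota_mx A \in unitmx) = (A \in unitmx).
Proof. by rewrite /iota_mx unitmx_tr unitmx_inv. Qed.

Lemma iota_bordered n (A : 'M[F]_n) : A \in unitmx -> iota_mx (bordered A) = bordered (iota_mx A).
Proof. by move=> AU; rewrite /iota_mx bordered_inv// trmx_bordered. Qed.

Lemma antidiag_mul n : antidiag F n *m antidiag F n = 1%:M.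
Proof.
apply/matrixP => i j; rewrite !mxE (bigD1 (rev_ord i))//= !mxE eqxx mul1r rev_ordK.
by rewrite big1 ?addr0 1?eq_sym// => k ki; rewrite mxE (negbTE ki) mul0r.
Qed.

Lemma antidiag_unit n : antidiag F n \in unitmx.
Proof. by have [] := mulmx1_unit (antidiag_mul n). Qed.

Lemma invmx_antidiag n : invmx (antidiag F n) = antidiag F n.
Proof. by apply: (can_inj (mulKmx (antidiag_unit n))); rewrite mulmxV ?antidiag_unit// antidiag_mul. Qed.

Lemma antidiagE n m (A : 'M[F]_(n, m)) i j : (antidiag F n *m A) i j = A (rev_ord i) j.
Proof.
rewrite mxE (bigD1 (rev_ord i))//= mxE eqxx mul1r big1 ?addr0// => k ki.
by rewrite mxE (negbTE ki) mul0r.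
Qed.

Lemma antidiagEr n m (A : 'M[F]_(m, n)) i j : (A *m antidiag F n) i j = A i (rev_ord j).
Proof.
rewrite mxE (bigD1 (rev_ord j))//= mxE rev_ordK eqxx mulr1 big1 ?addr0// => k ki.
by rewrite mxE -(inj_eq rev_ord_inj) rev_ordK eq_sym (negbTE ki) mulr0.
Qed.

(** The shape of the last factor in the recursion for z. *)
Definition cornered k (X : 'M[F]_k) : 'M[F]_k.+1 :=
  castmx (addn1 k, addn1 k) (block_mx X (last_row F k)^T 0 1%:M).

Lemma cornered_bordered k (X h : 'M[F]_k) : cornered X *m bordered h = cornered (X *m h).
Proof.
rewrite /bordered /cornered; set e := addn1 k.
have -> : forall m (e : (k + 1 = m)%N) (X Y : 'M[F]_(k + 1)),
    castmx (e, e) X *m castmx (e, e) Y = castmx (e, e) (X *m Y).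
  by move=> m e'; case: m / e'.
by rewrite mulmx_block !(mulmx0, mul0mx, mulmx1, addr0, add0r).
Qed.

Lemma det_cornered k (X : 'M[F]_k) : \det (cornered X) = \det X.
Proof. by rewrite /cornered det_castmx det_ublock det1 mulr1. Qed.

Lemma bordered_bordered k (B : 'M[F]_k) :
  castmx (addn2 k, addn2 k) (block_mx B 0 0 1%:M) = bordered (bordered B).
Proof.
apply/matrixP => i j.
have [E1 E2 E3 E4] := castmx_block B 0 0 1%:M.
have [E5 E6 E7 E8] := castmx_block (bordered B) 0 0 1%:M.
have w2 (l : 'I_k) : cast_ord (esym (addn2 k)) (widen_ord (leqnSn _) (widen_ord (leqnSn _) l)) = lshift 2 l.
  exact/val_inj.
have w1 : cast_ord (esym (addn2 k)) (widen_ord (leqnSn _) ord_max) = rshift k (0 : 'I_2).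
  by apply/val_inj; rewrite /= addn0.
have w0 : cast_ord (esym (addn2 k)) ord_max = rshift k (1 : 'I_2).
  by apply/val_inj; rewrite /= addn1.
rewrite castmxE /=.
have [[i' ->]|->] := ord_lastP i; have [[j' ->]|->] := ord_lastP j.
- rewrite [RHS]E5.
  have [[i1 ->]|->] := ord_lastP i'; have [[j1 ->]|->] := ord_lastP j'; rewrite ?w2 ?w1.
  + by rewrite block_mxEul [RHS]E1.
  + by rewrite block_mxEur [RHS]E2 !mxE.
  + by rewrite block_mxEdl [RHS]E3 !mxE.
  + by rewrite block_mxEdr [RHS]E4 !mxE.
- rewrite [RHS]E6; have [[i1 ->]|->] := ord_lastP i'; rewrite ?w2 ?w1 ?w0.
  + by rewrite block_mxEur !mxE.
  + by rewrite block_mxEdr !mxE.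
- rewrite [RHS]E7; have [[j1 ->]|->] := ord_lastP j'; rewrite ?w2 ?w1 ?w0.
  + by rewrite block_mxEdl !mxE.
  + by rewrite block_mxEdr !mxE.
- by rewrite [RHS]E8 w0 block_mxEdr !mxE.
Qed.

(** The first two factors of the recursion act on all rows but the last. Grouped into one [bordered]
    factor, they can be absorbed by the integration variable of Godement's section. *)
Lemma z_mx_step k (X := (z_mx F k.+1)^T *m antidiag F k.+1 *m z_mx F k.+1) :
  z_mx F k.+2 = bordered (antidiag F k.+1 *m bordered (iota_mx (z_mx F k))) *m cornered X.
Proof. by rewrite z_mxSS /z_step bordered_bordered bordered_mulmx. Qed.

Lemma z_mx_unit k : z_mx F k \in unitmx.
Proof.
suff : z_mx F k \in unitmx /\ z_mx F k.+1 \in unitmx by case.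
elim: k => [|k [h0 h1]]; first by rewrite z_mx0 z_mx1 !unitmx1.
split=> //; rewrite z_mx_step unitmx_mul bordered_unit unitmx_mul antidiag_unit.
rewrite bordered_unit iota_mx_unit h0 unitmxE det_cornered -unitmxE !unitmx_mul.
by rewrite unitmx_tr h1 antidiag_unit.
Qed.

End ZAlgebra.

Section ZSize.
Context {R : realType} {K : absFieldType R}.

Lemma last_rowE n (g : 'M[K]_n.+1) j : (last_row K n.+1 *m g) 0 j = g ord_max j.
Proof.
rewrite mxE (bigD1 ord_max)//= mxE eqxx mul1r big1 ?addr0// => i im.
rewrite mxE eqSS (_ : (i == n :> nat) = false) ?mul0r//.
by apply/negbTE; apply: contraNneq im => h; apply/eqP/val_inj.
Qed.

Lemma mx_size_last n (g : 'M[K]_n.+1) : mx_size g = mx_size (up g) + mx_size (last_row K n.+1 *m g).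
Proof.
rewrite /mx_size big_ord_recr/= big_ord1; congr (_ + _).
  by apply: eq_bigr => i _; apply: eq_bigr => j _; rewrite mxE.
by apply: eq_bigr => j _; rewrite last_rowE.
Qed.

Lemma up_bordered n (k : 'M[K]_n) (g : 'M[K]_n.+1) : up (bordered k *m g) = k *m up g.
Proof.
have [E1 E2 E3 E4] := castmx_block k 0 0 1%:M.
apply/matrixP => i j; rewrite !mxE big_ord_recr/= E2 mxE mul0r addr0.
by apply: eq_bigr => l _; rewrite E1 mxE.
Qed.

Lemma last_bordered n (k : 'M[K]_n) (g : 'M[K]_n.+1) :
  last_row K n.+1 *m (bordered k *m g) = last_row K n.+1 *m g.
Proof.
have [E1 E2 E3 E4] := castmx_block k 0 0 1%:M.
apply/matrixP => i j; rewrite ord1 !last_rowE mxE big_ord_recr/= E4 mxE mul1r big1 ?add0r// => l _.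
by rewrite E3 mxE mul0r.
Qed.

(** The upper rows of [cornered X] are [X | e^t]. Decay in this product thus pays both for an
    integral over X and for a decay in y e^t, which survives as the Schwartz factor of lower
    rank. *)
Lemma mx_size_mul_up_cornered k p (y : 'M[K]_(p, k)) (X : 'M[K]_k) :
  mx_size (y *m up (cornered X)) = mx_size (y *m X) + mx_size (y *m (last_row K k)^T).
Proof.
have [E1 E2 E3 E4] := castmx_block X (last_row K k)^T 0 1%:M.
have mE i j : (y *m up (cornered X)) i (widen_ord (leqnSn k) j) = (y *m X) i j.
  by rewrite !mxE; apply: eq_bigr => l _; rewrite mxE; congr (_ * _); exact: E1.
have mE' i : (y *m up (cornered X)) i ord_max = (y *m (last_row K k)^T) i 0.
  by rewrite !mxE; apply: eq_bigr => l _; rewrite mxE; congr (_ * _); exact: E2.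
rewrite /mx_size -big_split/=; apply: eq_bigr => i _.
rewrite big_ord_recr/= big_ord1 mE'; congr (_ + _).
by apply: eq_bigr => j _; rewrite mE.
Qed.

End ZSize.

(** * Flag functions under inverse transpose *)

Section FlagDual.
Context {R : realType} {K : absFieldType R}.
Context {mu : {sigma_finite_measure set (borel K) -> \bar R}} {nabs : K -> R}.
Context {L : local_haar mu nabs}.

Lemma invmx_trig n (b : 'M[K]_n) : is_trig_mx b -> b \in unitmx ->
  is_trig_mx (invmx b) /\ forall i, invmx b i i = (b i i)^-1.
Proof.
move=> bT bU; have d0 i := trig_diag_neq0 i bT bU; move/is_trig_mxP: bT => bT.
have mE i j : \sum_l b i l * invmx b l j = (i == j)%:R by have := congr1 (fun m : 'M[K]_n => m i j) (mulmxV bU); rewrite !mxE.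
(* Forward substitution: once the rows above row i are known to be triangular, row i of b b^-1 = 1
   determines the next one. *)
have vT' k : forall i j : 'I_n, (i < k)%N -> (i < j)%N -> invmx b i j = 0.
  elim: k => [//|k IH] i j ik ij.
  have := mE i j; rewrite (bigD1 i)//= big1 => [|l li].
    rewrite addr0 (_ : (i == j) = false); last by apply/negbTE/eqP => h; rewrite h ltnn in ij.
    by move/eqP; rewrite mulf_eq0 (negbTE (d0 i)) => /eqP.
  have [lti|] := ltnP l i; first by rewrite IH ?mulr0//; lia.
  rewrite leq_eqVlt => /orP[/eqP h|/bT ->]; last by rewrite mul0r.
  by move: li; rewrite -(inj_eq val_inj)/= h eqxx.
have vT (i j : 'I_n) : (i < j)%N -> invmx b i j = 0 by exact: vT' (leqnn _).
split=> [|i]; first exact/is_trig_mxP.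
apply: (mulfI (d0 i)); rewrite mulfV ?d0//; have := mE i i.
rewrite (bigD1 i)//= big1 ?addr0 ?eqxx// => l li.
have [lti|] := ltnP l i; first by rewrite vT ?mulr0.
rewrite leq_eqVlt => /orP[/eqP h|/bT ->]; last by rewrite mul0r.
by move: li; rewrite -(inj_eq val_inj)/= h eqxx.
Qed.

(** Conjugating the inverse transpose of a lower triangular matrix by the antidiagonal gives a lower
    triangular matrix with the inverse diagonal in reversed order. *)
Lemma flag_dual n (al : 'I_n -> R) : exists2 C, 0 < C & forall g : 'M[K]_n, g \in unitmx ->
  flag nabs al (antidiag K n *m iota_mx g) <= C * flag nabs (fun i => - al (rev_ord i)) g.
Proof.
apply: (@flag_dominates _ _ mu nabs L n (fun i => - al (rev_ord i))
  (fun g => flag nabs al (antidiag K n *m iota_mx g))) => M.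
pose w := antidiag K n; have wU : w \in unitmx := antidiag_unit _ n.
have [M' bw] := bounded_gl_ex wU.
have [C C0 hC] := @flag_le _ _ mu nabs L n al (M' * M).
exists C => // b k bT bU bk; have kU : k \in unitmx by case: bk.
have [vT vd] := invmx_trig bT bU.
pose b' := w *m iota_mx b *m w.
have b'E i j : b' i j = invmx b (rev_ord j) (rev_ord i).
  by rewrite /b' antidiagEr antidiagE mxE.
have b'T : is_trig_mx b'.
  apply/is_trig_mxP => i j ij; rewrite b'E; apply: (is_trig_mxP vT) => /=.
  by have := ltn_ord j; lia.
have b'U : b' \in unitmx by rewrite !unitmx_mul wU iota_mx_unit bU.
have -> : antidiag K n *m iota_mx (b *m k) = b' *m (w *m iota_mx k).
  by rewrite iota_mxM// /b' -!mulmxA (mulmxA w w) antidiag_mul mul1mx.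
rewrite flag_trig_mul// ?unitmx_mul ?wU ?iota_mx_unit// mulrC.
have -> : \prod_i nabs (b' i i) `^ al i = \prod_i nabs (b i i) `^ (- al (rev_ord i)).
  rewrite (reindex_inj rev_ord_inj)/=; apply: eq_bigr => i _.
  rewrite b'E rev_ordK vd powRN.
  have d0 := trig_diag_neq0 i bT bU.
  have p0 : nabs (b i i) `^ al (rev_ord i) != 0 by rewrite gt_eqF// powR_gt0// nabs_gt0.
  apply: (mulIf p0); rewrite mulVf// -powRM ?nabs_ge0// -nabsM mulVf//.
  by rewrite nabs1 powR1.
apply: ler_wpM2r; first by apply: prodr_ge0 => i _; exact: powR_ge0.
by apply: hC; apply: bounded_glM => //; exact: bounded_gl_iota.
Qed.

End FlagDual.

(** * Recursion on the rank *)

Section Recursion.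
Context {R : realType} {K : absFieldType R}.
Context {mu : {sigma_finite_measure set (borel K) -> \bar R}} {nabs : K -> R}.
Context {L : local_haar mu nabs}.
Local Open Scope ereal_scope.

Lemma measurable_bordered d (X : measurableType d) n (f : X -> mxb n n) :
  measurable_fun setT f ->
  measurable_fun setT (fun x => bordered (f x : 'M[K]_n) : mxb n.+1 n.+1).
Proof.
move=> mf; apply/measurable_mxbP => i j.
have E A := castmx_block (A : 'M[K]_n) 0 0 1%:M.
have [[i' ->]|->] := ord_lastP i; have [[j' ->]|->] := ord_lastP j.
- apply: (eq_measurable_fun (fun x => (f x : 'M[K]_n) i' j' : borel K)).
    by move=> x _; have [-> _ _ _] := E (f x).
  exact: measurable_entries.
- apply: (eq_measurable_fun (fun=> 0%R : borel K)); last exact: measurable_cst.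
  by move=> x _; have [_ -> _ _] := E (f x); rewrite mxE.
- apply: (eq_measurable_fun (fun=> 0%R : borel K)); last exact: measurable_cst.
  by move=> x _; have [_ _ -> _] := E (f x); rewrite mxE.
- apply: (eq_measurable_fun (fun=> 1%R : borel K)); last exact: measurable_cst.
  by move=> x _; have [_ _ _ ->] := E (f x); rewrite mxE.
Qed.

Lemma measurable_god d (X : measurableType d) n (be : 'I_n.+1 -> R) N
    (f : X -> mxb n.+1 n.+1) (k : X -> mxb n n) :
  measurable_fun setT f -> measurable_fun setT k ->
  measurable_fun setT (fun x => god nabs be N (f x : 'M[K]_n.+1) (k x : 'M[K]_n)).
Proof.
move=> mf mk; apply: measurable_funM; last exact: measurable_flag.
apply: measurable_decay; apply: measurable_mulmx; first exact: measurable_invmx.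
exact: measurable_up.
Qed.

Lemma god_ge0 n (be : 'I_n.+1 -> R) N (g : 'M[K]_n.+1) k : (0 <= god nabs be N g k)%R.
Proof. by rewrite mulr_ge0 ?decay_ge0 ?flag_ge0. Qed.

(** The common skeleton of both recursion steps: the Godement section of one flag function is
    inserted, the integrals are exchanged and [k] is translated by [k0]. Only the bound of the inner
    integral is left to the caller. *)
Lemma godement_swap n (be : 'I_n.+1 -> R) N : exists2 C : R, (0 < C)%R &
  forall m (y : mxb (K := K) m m -> mxb (K := K) n.+1 n.+1) (u : mxb (K := K) m m -> R)
    (k0 : 'M[K]_n) (c : R) (H : mxb (K := K) n n -> R),
  measurable_fun setT y -> (forall g : 'M[K]_m, g \in unitmx -> (y g : 'M[K]_n.+1) \in unitmx) ->
  measurable_fun setT u -> (forall g, 0 <= u g)%R -> k0 \in unitmx -> (0 <= c)%R ->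
  measurable_fun setT H -> (forall k, 0 <= H k)%R ->
  (forall k : 'M[K]_n, k \in unitmx ->
     hint mu nabs (fun g : 'M[K]_m => (nabs (\det (y g : 'M[K]_n.+1)) `^ be ord_max * u g *
       god nabs be N (y g) (k0 *m k))%:E%R) <= (c * H k)%:E) ->
  hint mu nabs (fun g : 'M[K]_m => (u g * flag nabs be (y g : 'M[K]_n.+1))%:E) <=
    (C * c)%:E * hint mu nabs (fun k => (H k)%:E).
Proof.
have [C C0 hC] := @godement _ _ mu nabs L n be N.
exists C => // m y u k0 c H my yU mu0 u0 k0U c0 mH H0 hk.
pose Q (g : mxb (K := K) m m) (k : mxb (K := K) n n) : R := (nabs (\det (y g : 'M[K]_n.+1)) `^ be ord_max * u g *
       god nabs be N (y g : 'M[K]_n.+1) (k : 'M[K]_n))%R.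
have mQ : measurable_fun setT (fun z : mxb (K := K) m m * mxb (K := K) n n => Q z.1 z.2).
  have my1 : measurable_fun setT (fun z : mxb (K := K) m m * mxb (K := K) n n => y z.1).
    exact (measurableT_comp my measurable_fst).
  apply: measurable_funM; last exact (measurable_god be N my1 measurable_snd).
  apply: measurable_funM; first exact (measurable_nabs_det _ my1).
  exact (measurableT_comp mu0 measurable_fst).
have Q0 g k : (0 <= Q g k)%R by rewrite !mulr_ge0 ?powR_ge0 ?decay_ge0 ?flag_ge0.
have mQE : measurable_fun setT (fun z : mxb (K := K) m m * mxb (K := K) n n => (Q z.1 z.2)%:E) := measurable_EFin_fun mQ.
have QE0 g k : 0 <= (Q g k)%:E by rewrite lee_fin.
have mQs : measurable_fun setT (fun z : mxb (K := K) n n * mxb (K := K) m m => (Q z.2 z.1)%:E).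
  exact (measurableT_comp mQE (measurable_fun_pair measurable_snd measurable_fst)).
have mI1 : measurable_fun setT (fun g : mxb (K := K) m m => hint mu nabs (fun k : 'M[K]_n => (Q g k)%:E)).
  exact: (@measurable_hint _ _ mu nabs L _ _ _ (fun g k => (Q g k)%:E) mQE QE0).
have mI2 : measurable_fun setT (fun k : mxb (K := K) n n => hint mu nabs (fun g : 'M[K]_m => (Q g k)%:E)).
  exact: (@measurable_hint _ _ mu nabs L _ _ _ (fun k g => (Q g k)%:E) mQs (fun k g => QE0 g k)).
have mQg (g : mxb m m) : measurable_fun setT (fun k : mxb (K := K) n n => (god nabs be N (y g) (k : 'M[K]_n))%:E).
  by apply: measurable_EFin_fun; apply: measurable_god; [exact: measurable_cst|exact: measurable_id].
apply: (@le_trans _ _ (hint mu nabs (fun g : 'M[K]_m => C%:E * hint mu nabs (fun k : 'M[K]_n => (Q g k)%:E)))).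
  apply: le_hint.
  - by apply: measurable_EFin_fun; apply: measurable_funM => //; exact: measurable_flag.
  - by apply: emeasurable_funM => //; exact: measurable_cst.
  - by move=> g; rewrite lee_fin mulr_ge0 ?flag_ge0.
  move=> g gU; have := hC (y g) (yU g gU).
  set I := hint mu nabs _ => hg.
  have -> : hint mu nabs (fun k : 'M[K]_n => (Q g k)%:E) = (nabs (\det (y g : 'M[K]_n.+1)) `^ be ord_max * u g)%:E%R * I.
    rewrite -(@hintZl _ _ mu nabs L n _ (fun k : mxb n n => (god nabs be N (y g) (k : 'M[K]_n))%:E)).
    - by apply: eq_hint => k _; rewrite -EFinM.
    - by rewrite lee_fin mulr_ge0 ?powR_ge0.
    - exact: mQg.
    - by move=> x; rewrite lee_fin god_ge0.
  set t := (nabs _ `^ _)%R in hg *.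
  have -> : C%:E * ((t * u g)%:E%R * I) = (u g)%:E * ((C * t)%:E%R * I).
    by rewrite !muleA -!EFinM; congr (_%:E * _); ring.
  rewrite EFinM.
  by apply: lee_wpmul2l => //; rewrite lee_fin.
have CE0 : 0 <= C%:E by rewrite lee_fin ltW.
rewrite (@hintZl _ _ mu nabs L m C%:E _ CE0 mI1); last by move=> g; exact: hint_ge0.
rewrite EFinM -muleA; apply: lee_wpmul2l; first by rewrite lee_fin ltW.
rewrite (@hint_swap _ _ mu nabs L m n (fun g k => (Q g k)%:E) mQE QE0).
rewrite -(@hint_mull _ _ mu nabs L n _ _ k0U mI2); last by move=> k; exact: hint_ge0.
rewrite -(@hintZl _ _ mu nabs L n c%:E (fun k => (H k)%:E)).
- apply: le_hint.
  + apply: (measurableT_comp mI2); apply: measurable_mulmx; [exact: measurable_cst|exact: measurable_id].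
  + by apply: emeasurable_funM; [exact: measurable_cst|exact: measurable_EFin_fun].
  + by move=> k; exact: hint_ge0.
  + by move=> k kU; rewrite -EFinM; exact: hk.
- by rewrite lee_fin.
- exact: measurable_EFin_fun.
- by move=> k; rewrite lee_fin.
Qed.

End Recursion.

(** * Flag integrals in the strip *)

Section StripIntegrals.
Context {R : realType} {K : absFieldType R}.
Context {mu : {sigma_finite_measure set (borel K) -> \bar R}} {nabs : K -> R}.
Context {L : local_haar mu nabs}.

(** The weight i - n/2 is that of rank n+1 counted from 0. In rank n the weight is i - n/2 + 1/2,
    and the factor |det|^(-1/2) of the corank-one integral removes the 1/2; hence one [n] serves
    both ranks. *)
Definition shifted n m (a : 'I_m -> R) (i : 'I_m) : R := a i + (i : nat)%:R - n%:R / 2.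

(** Indices start at 0 and [s] is absorbed in [a]: the condition (i+1) + (j+1) <= n+1 reads i + j <
    n. *)
Definition strip n m (a : 'I_n.+1 -> R) (b : 'I_m -> R) := forall (i : 'I_n.+1) (j : 'I_m),
  ((i + j < n)%N -> a i + b j < 1) /\ ((n <= i + j)%N -> 0 < a i + b j).

Definition equal_rank_integrand n (a b : 'I_n.+1 -> R) N (g : 'M[K]_n.+1) : R :=
  flag nabs (shifted n a) (z_mx K n.+1 *m g) *
  flag nabs (shifted n b) (bordered (z_mx K n) *m g) * decay N (last_row K n.+1 *m g).

Definition corank_one_integrand n (a : 'I_n.+1 -> R) (b : 'I_n -> R) (h : 'M[K]_n) : R :=
  flag nabs (shifted n a) (z_mx K n.+1 *m bordered h) * flag nabs (shifted n b) (z_mx K n *m h).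

Local Open Scope ereal_scope.

Lemma measurable_mulmxl p q r (A : 'M[K]_(p, q)) d (X : measurableType d) (f : X -> mxb q r) :
  measurable_fun setT f -> measurable_fun setT (fun x => A *m (f x : 'M[K]_(q, r)) : mxb p r).
Proof. by move=> mf; apply: measurable_mulmx; [exact: measurable_cst|]. Qed.

Lemma measurable_corank_one n a b : measurable_fun setT (@corank_one_integrand n a b : mxb n n -> R).
Proof.
apply: measurable_funM; apply: measurable_flag; apply: measurable_mulmxl; last exact: measurable_id.
exact (measurable_bordered (@measurable_id _ (mxb n n) setT)).
Qed.

Lemma corank_one_ge0 n a b (h : 'M[K]_n) : (0 <= corank_one_integrand a b h)%R.
Proof. by rewrite mulr_ge0 ?flag_ge0. Qed.

Lemma measurable_equal_rank n a b N :
  measurable_fun setT (@equal_rank_integrand n a b N : mxb n.+1 n.+1 -> R).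
Proof.
apply: measurable_funM; last first.
  exact (measurable_decay N (measurable_mulmxl _ (@measurable_id _ (mxb n.+1 n.+1) setT))).
by apply: measurable_funM; apply: measurable_flag; apply: measurable_mulmxl; exact: measurable_id.
Qed.

Lemma equal_rank_ge0 n a b N (g : 'M[K]_n.+1) : (0 <= equal_rank_integrand a b N g)%R.
Proof. by rewrite mulr_ge0 ?decay_ge0// mulr_ge0 ?flag_ge0. Qed.

Lemma hint_lty_le m (f g : mxb (K := K) m m -> R) (C : R) :
  measurable_fun setT f -> measurable_fun setT g -> (forall x, 0 <= f x)%R -> (forall x, 0 <= g x)%R ->
  (0 <= C)%R -> (forall x : 'M[K]_m, x \in unitmx -> f x <= C * g x)%R ->
  hint mu nabs (fun x => (g x)%:E) < +oo -> hint mu nabs (fun x => (f x)%:E) < +oo.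
Proof.
move=> mf mg f0 g0 C0 fg hg.
apply: (@le_lt_trans _ _ (hint mu nabs (fun x => C%:E * (g x)%:E))).
  apply: le_hint; [exact: measurable_EFin_fun| |by move=> x; rewrite lee_fin|].
    by apply: emeasurable_funM; [exact: measurable_cst|exact: measurable_EFin_fun].
  by move=> x xU; rewrite -EFinM lee_fin; exact: fg.
have CE0 : 0 <= C%:E by rewrite lee_fin.
rewrite (@hintZl _ _ mu nabs L m C%:E _ CE0 (measurable_EFin_fun mg)); last by move=> x; rewrite lee_fin.
by rewrite lte_mul_pinfty.
Qed.

Lemma equal_rank_of_corank_one n (a b : 'I_n.+1 -> R) : strip a b ->
  hint mu nabs (fun h => (corank_one_integrand a (fun i => b (widen_ord (leqnSn n) i)) h)%:E) < +oo ->
  exists N, hint mu nabs (fun g => (equal_rank_integrand a b N g)%:E) < +oo.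
Proof.
move=> hab hB; pose al := shifted n a; pose be := shifted n b; pose s := be ord_max.
pose Z := z_mx K n.+1; pose z := z_mx K n.
have ZU : Z \in unitmx := z_mx_unit _ _; have zU : z \in unitmx := z_mx_unit _ _.
have BzU : bordered z \in unitmx by rewrite bordered_unit.
(* Here al_i + s = a_i + b_n + i, so the positivity of a_i + b_n is precisely the hypothesis of the
   convolution estimate. *)
have cond (i : 'I_n.+1) : ((i : nat)%:R < al i + s)%R.
  have [_ h] := hab i ord_max; have := h (leq_addl _ _).
  by rewrite /al /s /be /shifted /=; lra.
have [N [C1 [C10 hconv]]] := @flag_det_conv _ _ mu nabs L _ al s cond.
exists N; have [C2 C20 hswap] := @godement_swap _ _ mu nabs L n be N.
pose ga i := (be (widen_ord (leqnSn n) i) - be ord_max)%R.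
have [C3 C30 hC3] := @flag_shift_le _ _ mu nabs L n ga s.
pose y (g : mxb (K := K) n.+1 n.+1) : mxb n.+1 n.+1 := bordered z *m (g : 'M[K]_n.+1).
pose u (g : mxb (K := K) n.+1 n.+1) : R :=
  (flag nabs al (Z *m (g : 'M[K]_n.+1)) * decay N (last_row K n.+1 *m (g : 'M[K]_n.+1)))%R.
have my : measurable_fun setT y by apply: measurable_mulmxl; exact: measurable_id.
have mu0 : measurable_fun setT u.
  apply: measurable_funM; first by apply: measurable_flag; apply: measurable_mulmxl; exact: measurable_id.
  exact (measurable_decay N (measurable_mulmxl _ (@measurable_id _ (mxb n.+1 n.+1) setT))).
have u0 g : (0 <= u g)%R by rewrite mulr_ge0 ?flag_ge0 ?decay_ge0.
have yU (g : 'M[K]_n.+1) : g \in unitmx -> (y g : 'M[K]_n.+1) \in unitmx.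
  by move=> gU; rewrite /y unitmx_mul BzU.
pose b' i := b (widen_ord (leqnSn n) i).
pose H := @corank_one_integrand n a b'.
pose c := (C1 * C3)%R; have c0 : (0 <= c)%R by rewrite mulr_ge0// ltW.
have key (k : 'M[K]_n) : k \in unitmx ->
     hint mu nabs (fun g : 'M[K]_n.+1 => (nabs (\det (y g : 'M[K]_n.+1)) `^ be ord_max * u g *
       god nabs be N (y g) (z *m k))%:E%R) <= (c * H k)%:E.
  move=> kU; have BkU : bordered k \in unitmx by rewrite bordered_unit.
  pose x := Z *m bordered k; have xU : x \in unitmx by rewrite unitmx_mul ZU.
  pose Q (g : mxb n.+1 n.+1) : \bar R := (nabs (\det (y g : 'M[K]_n.+1)) `^ be ord_max * u g *
       god nabs be N (y g) (z *m k))%:E%R.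
  have mQ : measurable_fun setT Q.
    apply: measurable_EFin_fun; apply: measurable_funM; first by apply: measurable_funM => //; exact: measurable_nabs_det.
    by apply: measurable_god => //; exact: measurable_cst.
  have Q0 g : 0 <= Q g by rewrite lee_fin !mulr_ge0 ?powR_ge0 ?flag_ge0 ?decay_ge0.
  rewrite -[leLHS](@hint_mull _ _ mu nabs L n.+1 _ Q BkU mQ Q0).
  pose rz := (nabs (\det z) `^ s)%R; pose rZ := (nabs (\det Z) `^ s)%R; pose rk := (nabs (\det k) `^ s)%R.
  have rz0 : (0 < rz)%R by rewrite powR_gt0// nabs_det_gt0.
  have rZ0 : (0 < rZ)%R by rewrite powR_gt0// nabs_det_gt0.
  have rk0 : (0 < rk)%R by rewrite powR_gt0// nabs_det_gt0.
  pose A := (rz / rZ * flag nabs ga (z *m k))%R.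
  have A0 : (0 <= A)%R by rewrite !mulr_ge0 ?invr_ge0 ?flag_ge0// ltW.
  have AE0 : 0 <= A%:E by rewrite lee_fin.
  pose P (g : mxb n.+1 n.+1) : R := (flag nabs al (x *m (g : 'M[K]_n.+1)) * nabs (\det (x *m (g : 'M[K]_n.+1))) `^ s * decay N (g : 'M[K]_n.+1))%R.
  have mP : measurable_fun setT P.
    have mx : measurable_fun setT (fun g : mxb n.+1 n.+1 => x *m (g : 'M[K]_n.+1) : mxb n.+1 n.+1).
      by apply: measurable_mulmxl; exact: measurable_id.
    apply: measurable_funM; last exact (measurable_decay N (@measurable_id _ (mxb n.+1 n.+1) setT)).
    by apply: measurable_funM; [exact: measurable_flag|exact: measurable_nabs_det].
  have P0 g : (0 <= P g)%R by rewrite !mulr_ge0 ?powR_ge0 ?flag_ge0 ?decay_ge0.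
  apply: (@le_trans _ _ (hint mu nabs (fun g => A%:E * (P g)%:E))).
    apply: le_hint.
    - by apply: (measurableT_comp mQ); apply: measurable_mulmxl; exact: measurable_id.
    - by apply: emeasurable_funM; [exact: measurable_cst|exact: measurable_EFin_fun].
    - by move=> g; exact: Q0.
    (* After [g] is replaced by [bordered k *m g], the block z k cancels in the Godement factor,
       which becomes the decay in the upper rows of [g], while the last row of [g] is unchanged. *)
    move=> g gU; rewrite -EFinM /Q lee_fin /y /u /god up_bordered up_bordered last_bordered.
    rewrite invmx_mulmx// -!mulmxA (mulmxA (invmx z)) mulVmx// mul1mx (mulmxA (invmx k)) mulVmx// mul1mx.
    rewrite /P /x -!mulmxA !nabs_detM_powR !det_bordered -/s -/rz -/rZ -/rk -/ga /A.
    set f1 := flag _ _ _; set f2 := flag _ _ _; set d1 := decay _ _; set d2 := decay _ _; set d3 := decay _ _.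
    set rg := (nabs _ `^ _)%R.
    have -> : (rz / rZ * f2 * (f1 * (rZ * (rk * rg)) * d3) = (rz * rk * rg * f1 * f2) * d3)%R.
      by field; rewrite gt_eqF.
    have -> : (rz * (rk * rg) * (f1 * d1) * (d2 * f2) = (rz * rk * rg * f1 * f2) * (d2 * d1))%R by ring.
    apply: ler_wpM2l.
      by rewrite !mulr_ge0 ?powR_ge0 ?flag_ge0.
    (* (1 + upper)(1 + last) >= 1 + |g|: the Godement factor and the decay in the last row together
       give decay in all of [g]. *)
    rewrite /d1 /d2 /d3 /decay -invfM -exprMn lef_pV2 ?posrE ?exprn_gt0 ?mulr_gt0 ?ltr_wpDr ?mx_size_ge0//.
    have h1 := mx_size_ge0 (up g); have h2 := mx_size_ge0 (last_row K n.+1 *m g).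
    apply: lerXn2r; rewrite ?nnegrE ?mulr_ge0 ?addr_ge0 ?mx_size_ge0//.
    by rewrite mx_size_last; nra.
  rewrite (@hintZl _ _ mu nabs L n.+1 A%:E _ AE0 (measurable_EFin_fun mP)); last by move=> g; rewrite lee_fin.
  apply: (@le_trans _ _ (A%:E * (C1 * (flag nabs al x * nabs (\det x) `^ s))%:E%R)).
    by apply: lee_wpmul2l => //; exact: hconv.
  rewrite -EFinM lee_fin /H /corank_one_integrand -/al -/Z -/x -/z /A /c.
  have zkU : z *m k \in unitmx by rewrite unitmx_mul zU.
  have h3 := hC3 (z *m k) zkU.
  rewrite nabs_detM_powR -/rz -/rk in h3.
  rewrite /x nabs_detM_powR det_bordered -/rZ -/rk -/x.
  set f1 := flag _ _ _ in h3 *; set f2 := flag _ _ _.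
  have -> : (rz / rZ * f1 * (C1 * (f2 * (rZ * rk))) = C1 * f2 * (f1 * (rz * rk)))%R.
    by field; rewrite gt_eqF.
  have -> : flag nabs (shifted n b') (z *m k) = flag nabs (fun i => ga i + s)%R (z *m k).
    by apply: eq_bigr => i _; rewrite /ga /s subrK.
  have -> : forall t : R, (C1 * C3 * (f2 * t) = C1 * f2 * (C3 * t))%R by move=> t; ring.
  by apply: ler_wpM2l => //; rewrite mulr_ge0 ?flag_ge0// ltW.
have := hswap _ y u z c H my yU mu0 u0 zU c0 (measurable_corank_one a b') (corank_one_ge0 a b') key.
rewrite [X in hint mu nabs X <= _](_ : _ = (fun g => (equal_rank_integrand a b N g)%:E)); last first.
  by apply/funext => g; rewrite /u /equal_rank_integrand -/al -/be; congr (_%:E); rewrite mulrAC.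
move=> /le_lt_trans; apply; apply: lte_mul_pinfty => //.
by rewrite lee_fin mulr_ge0// ltW.
Qed.

End StripIntegrals.
Arguments equal_rank_integrand {R K} nabs {n} a b N g.
Arguments corank_one_integrand {R K} nabs {n} a b h.

Section CorankOneStep.
Context {R : realType} {K : absFieldType R}.
Context {mu : {sigma_finite_measure set (borel K) -> \bar R}} {nabs : K -> R}.
Context {L : local_haar mu nabs}.

(** The source of the 1/2: negating and reversing the weights of rank n+2 gives those of rank n+1
    with [c] replaced by 1/2 - c. *)
Lemma shifted_dual n (c : 'I_n.+1 -> R) (i : 'I_n.+1) :
  - (c (rev_ord i) + (rev_ord i : nat)%:R - n.+1%:R / 2) =
  (2^-1 - c (rev_ord i)) + (i : nat)%:R - n%:R / 2.
Proof.
have -> : (rev_ord i : nat)%:R = n%:R - (i : nat)%:R :> R.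
  by rewrite /= subSS natrB// -ltnS.
have -> : n.+1%:R = n%:R + 1 :> R by rewrite natr1.
by move: (c _) (n%:R) ((i : nat)%:R) => p q r; field.
Qed.

Local Open Scope ereal_scope.

Lemma corank_one_of_equal_rank n (a : 'I_n.+2 -> R) (b : 'I_n.+1 -> R) N2
    (a' := fun i => (2^-1 - a (widen_ord (leqnSn n.+1) (rev_ord i)))%R)
    (b' := fun i => (2^-1 - b (rev_ord i))%R) : strip a b ->
  hint mu nabs (fun g => (equal_rank_integrand nabs b' a' N2 g)%:E) < +oo ->
  hint mu nabs (fun h => (corank_one_integrand nabs a b h)%:E) < +oo.
Proof.
move=> hab hA; pose al := shifted n.+1 a; pose be := shifted n.+1 b; pose s := al ord_max.
pose z := z_mx K n.+1; pose w := antidiag K n.+1; pose D := bordered (iota_mx (z_mx K n)).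
have zU : z \in unitmx := z_mx_unit _ _; have wU : w \in unitmx := antidiag_unit _ _.
have z'U : z_mx K n \in unitmx := z_mx_unit _ _.
have DU : D \in unitmx by rewrite bordered_unit iota_mx_unit.
pose X := z^T *m w *m z; have zTU : z^T \in unitmx by rewrite unitmx_tr.
have XU : X \in unitmx by rewrite !unitmx_mul zTU wU.
pose wD := w *m D; have wDU : wD \in unitmx by rewrite unitmx_mul wU.
have bwDU : bordered wD \in unitmx by rewrite bordered_unit.
pose X' := invmx X; have X'U : X' \in unitmx by rewrite unitmx_inv.
(* X = z^t w z, so z X^-1 = w z^(-t): the middle block of the recursion is designed to turn the
   second flag function into a function of the inverse transpose. *)
have zX' : z *m X' = w *m iota_mx z.
  rewrite /X' /X invmx_mulmx ?unitmx_mul ?zTU// invmx_mulmx// (mulmxA z) mulmxV// mul1mx.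
  by rewrite invmx_antidiag /iota_mx trmx_inv.
have zX'U : z *m X' \in unitmx by rewrite unitmx_mul zU.
(* be_i + s is b_i plus the last exponent of [a] plus i, so only the positivity conditions with that
   last exponent enter. *)
have cond (i : 'I_n.+1) : ((i : nat)%:R < be i + s)%R.
  have [_ h] := hab ord_max i; have := h (leq_addr _ _).
  by rewrite /s /al /be /shifted /=; lra.
have [N1 [C1 [C10 hconv]]] := @flag_det_conv _ _ mu nabs L _ be s cond.
(* The order of decay is split: [N1] is spent on the inner convolution, [N2] is handed down to the
   equal-rank integral. *)
have [C2 C20 hswap] := @godement_swap _ _ mu nabs L n.+1 al (N1 + N2).
pose al' i := al (widen_ord (leqnSn n.+1) i).
pose ga i := (al (widen_ord (leqnSn n.+1) i) - al ord_max)%R.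
have [C3 C30 hC3] := @flag_shift_le _ _ mu nabs L n.+1 ga s.
have [C5 C50 hC5] := @flag_dual _ _ mu nabs L n.+1 al'.
have [C6 C60 hC6] := @flag_dual _ _ mu nabs L n.+1 be.
pose y (h : mxb (K := K) n.+1 n.+1) : mxb n.+2 n.+2 := z_mx K n.+2 *m bordered (h : 'M[K]_n.+1).
pose u (h : mxb (K := K) n.+1 n.+1) : R := flag nabs be (z *m (h : 'M[K]_n.+1)).
have yE (h : 'M[K]_n.+1) : y h = bordered wD *m cornered (X *m h).
  by rewrite /y z_mx_step -mulmxA cornered_bordered.
have my : measurable_fun setT y.
  by apply: measurable_mulmxl; exact (measurable_bordered (@measurable_id _ (mxb n.+1 n.+1) setT)).
have mu0 : measurable_fun setT u.
  by apply: measurable_flag; apply: measurable_mulmxl; exact: measurable_id.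
have u0 g : (0 <= u g)%R by exact: flag_ge0.
have yU (g : 'M[K]_n.+1) : g \in unitmx -> (y g : 'M[K]_n.+2) \in unitmx.
  by move=> gU; rewrite /y unitmx_mul bordered_unit gU andbT z_mx_unit.
pose H (k : mxb (K := K) n.+1 n.+1) : R := (flag nabs al' (wD *m (k : 'M[K]_n.+1)) *
  flag nabs be (z *m X' *m (k : 'M[K]_n.+1)) * decay N2 (invmx (k : 'M[K]_n.+1) *m (last_row K n.+1)^T))%R.
have mH : measurable_fun setT H.
  apply: measurable_funM; last first.
    apply: measurable_decay; apply: measurable_mulmx; last exact: measurable_cst.
    exact (measurable_invmx (@measurable_id _ (mxb n.+1 n.+1) setT)).
  by apply: measurable_funM; apply: measurable_flag; apply: measurable_mulmxl; exact: measurable_id.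
have H0 k : (0 <= H k)%R by rewrite !mulr_ge0 ?flag_ge0 ?decay_ge0.
have mHE : measurable_fun setT (fun k => (H k)%:E) := measurable_EFin_fun mH.
have HE0 k : 0 <= (H k)%:E by rewrite lee_fin.
pose r1 := (nabs (\det wD) `^ s)%R; pose r2 := (nabs (\det (z *m X')) `^ s)%R.
have r10 : (0 < r1)%R by rewrite powR_gt0// nabs_det_gt0.
have r20 : (0 < r2)%R by rewrite powR_gt0// nabs_det_gt0.
pose c := (C1 * C3)%R; have c0 : (0 <= c)%R by rewrite mulr_ge0// ltW.
have key (k : 'M[K]_n.+1) : k \in unitmx ->
     hint mu nabs (fun g : 'M[K]_n.+1 => (nabs (\det (y g : 'M[K]_n.+2)) `^ al ord_max * u g *
       god nabs al (N1 + N2) (y g) (wD *m k))%:E%R) <= (c * H k)%:E.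
  move=> kU; have X'kU : X' *m k \in unitmx by rewrite unitmx_mul X'U.
  pose x := z *m X' *m k; have xU : x \in unitmx by rewrite unitmx_mul zX'U.
  pose Q (g : mxb n.+1 n.+1) : \bar R := (nabs (\det (y g : 'M[K]_n.+2)) `^ al ord_max * u g *
       god nabs al (N1 + N2) (y g) (wD *m k))%:E%R.
  have mQ : measurable_fun setT Q.
    apply: measurable_EFin_fun; apply: measurable_funM; first by apply: measurable_funM => //; exact: measurable_nabs_det.
    by apply: measurable_god => //; exact: measurable_cst.
  have Q0 g : 0 <= Q g by rewrite lee_fin !mulr_ge0 ?powR_ge0 ?flag_ge0 ?decay_ge0.
  rewrite -[leLHS](@hint_mull _ _ mu nabs L n.+1 _ Q X'kU mQ Q0).
  pose rk := (nabs (\det k) `^ s)%R.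
  have rk0 : (0 < rk)%R by rewrite powR_gt0// nabs_det_gt0.
  pose d2 := decay N2 (invmx k *m (last_row K n.+1)^T).
  pose A := (r1 / r2 * flag nabs ga (wD *m k) * d2)%R.
  have d20 : (0 <= d2)%R by exact: decay_ge0.
  have A0 : (0 <= A)%R by exact: (mulr_ge0 (mulr_ge0 (divr_ge0 (ltW r10) (ltW r20)) (flag_ge0 _ _)) d20).
  have AE0 : 0 <= A%:E by rewrite lee_fin.
  pose P (g : mxb n.+1 n.+1) : R := (flag nabs be (x *m (g : 'M[K]_n.+1)) * nabs (\det (x *m (g : 'M[K]_n.+1))) `^ s * decay N1 (g : 'M[K]_n.+1))%R.
  have mP : measurable_fun setT P.
    have mx : measurable_fun setT (fun g : mxb n.+1 n.+1 => x *m (g : 'M[K]_n.+1) : mxb n.+1 n.+1).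
      by apply: measurable_mulmxl; exact: measurable_id.
    apply: measurable_funM; last exact (measurable_decay N1 (@measurable_id _ (mxb n.+1 n.+1) setT)).
    by apply: measurable_funM; [exact: measurable_flag|exact: measurable_nabs_det].
  have P0 g : (0 <= P g)%R by rewrite !mulr_ge0 ?powR_ge0 ?flag_ge0 ?decay_ge0.
  apply: (@le_trans _ _ (hint mu nabs (fun g => A%:E * (P g)%:E))).
    apply: le_hint.
    - by apply: (measurableT_comp mQ); apply: measurable_mulmxl; exact: measurable_id.
    - by apply: emeasurable_funM; [exact: measurable_cst|exact: measurable_EFin_fun].
    - by move=> g; exact: Q0.
    move=> g gU; rewrite -EFinM /Q lee_fin yE /u /god up_bordered.
    have -> : X *m (X' *m k *m g) = k *m g by rewrite -mulmxA mulKVmx.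
    have -> : z *m (X' *m k *m g) = x *m g by rewrite /x !mulmxA.
    have -> : invmx (wD *m k) *m (wD *m up (cornered (k *m g))) = invmx k *m up (cornered (k *m g)).
      by rewrite invmx_mulmx// -mulmxA (mulmxA (invmx wD)) mulVmx// mul1mx.
    rewrite /P /A nabs_detM_powR det_bordered det_cornered -/s -/r1 -/ga decayD.
    have -> : (nabs (\det (x *m g)) `^ s = r2 * nabs (\det (k *m g)) `^ s)%R.
      have -> : x *m g = (z *m X') *m (k *m g) by rewrite /x !mulmxA.
      exact: nabs_detM_powR.
    set v := invmx k *m up _.
    have vE : (mx_size v = mx_size g + mx_size (invmx k *m (last_row K n.+1)^T))%R.
      by rewrite /v mx_size_mul_up_cornered mulmxA mulVmx// mul1mx.
    have h1 : (decay N1 v <= decay N1 g)%R by apply: decay_le => //; rewrite vE lerDl mx_size_ge0.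
    have h2 : (decay N2 v <= d2)%R by apply: decay_le => //; rewrite vE lerDr mx_size_ge0.
    set f1 := flag _ _ _; set f2 := flag _ _ _; set rg := (nabs _ `^ _)%R.
    have -> : (r1 / r2 * f2 * d2 * (f1 * (r2 * rg) * decay N1 g) = (r1 * rg * f1 * f2) * (decay N1 g * d2))%R.
      by field; rewrite gt_eqF.
    have e0 : (0 <= decay N1 v /\ 0 <= decay N2 v)%R by split; exact: decay_ge0.
    move: e0 h1 h2; move: (decay N1 v) (decay N2 v) => e1 e2 [e10 e20] h1 h2.
    apply: (@le_trans _ _ ((r1 * rg * f1 * f2) * (e1 * e2))%R).
      by rewrite le_eqVlt; apply/orP; left; apply/eqP; ring.
    apply: ler_wpM2l; first by rewrite !mulr_ge0 ?powR_ge0 ?flag_ge0.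
    exact: ler_pM.
  rewrite (@hintZl _ _ mu nabs L n.+1 A%:E _ AE0 (measurable_EFin_fun mP)); last by move=> g; rewrite lee_fin.
  apply: (@le_trans _ _ (A%:E * (C1 * (flag nabs be x * nabs (\det x) `^ s))%:E%R)).
    by apply: lee_wpmul2l => //; exact: hconv.
  rewrite -EFinM lee_fin /H -/x -/d2 /A /c.
  have wDkU : wD *m k \in unitmx by rewrite unitmx_mul wDU.
  have h3 := hC3 (wD *m k) wDkU.
  rewrite nabs_detM_powR -/r1 -/rk in h3.
  rewrite {2}/x nabs_detM_powR -/r2 -/rk.
  have -> : flag nabs al' (wD *m k) = flag nabs (fun i => ga i + s)%R (wD *m k).
    by apply: eq_bigr => i _; rewrite /ga /s subrK.
  set f1 := flag _ _ _ in h3 *; set f2 := flag _ _ _; set f3 := flag _ _ _ in h3 *.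
  have -> : (r1 / r2 * f1 * d2 * (C1 * (f2 * (r2 * rk))) = C1 * f2 * d2 * (f1 * (r1 * rk)))%R.
    by field; rewrite gt_eqF.
  have -> : (C1 * C3 * (f3 * f2 * d2) = C1 * f2 * d2 * (C3 * f3))%R by ring.
  apply: ler_wpM2l; last exact: h3.
  exact: (mulr_ge0 (mulr_ge0 (ltW C10) (flag_ge0 _ _)) d20).
have := hswap _ y u wD c H my yU mu0 u0 wDU c0 mH H0 key.
rewrite [X in hint mu nabs X <= _](_ : _ = (fun g => (corank_one_integrand nabs a b g)%:E)); last first.
  by apply/funext => g; rewrite /u /corank_one_integrand -/al -/be mulrC.
move=> /le_lt_trans; apply; apply: lte_mul_pinfty => //.
  by rewrite lee_fin mulr_ge0// ltW.
(* Substituting the inverse transpose for [k] puts both flag arguments in the form w (...)^iota, to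
   which [flag_dual] applies; the roles of [a] and [b] are exchanged. *)
rewrite -(@hint_iota _ _ mu nabs L n.+1 _ mHE HE0).
have mi : measurable_fun setT (fun g : mxb n.+1 n.+1 => iota_mx (g : 'M[K]_n.+1) : mxb n.+1 n.+1).
  exact (measurable_iota (@measurable_id _ (mxb n.+1 n.+1) setT)).
apply: (@hint_lty_le _ _ mu nabs L n.+1 (fun g => H (iota_mx g)) (equal_rank_integrand nabs b' a' N2) (C5 * C6)%R) => //.
- exact (measurableT_comp mH mi).
- exact: measurable_equal_rank.
- exact: equal_rank_ge0.
- by rewrite mulr_ge0// ltW.
move=> g gU; rewrite /H /equal_rank_integrand.
have e1 : wD *m iota_mx g = w *m iota_mx (bordered (z_mx K n) *m g).
  by rewrite iota_mxM ?bordered_unit// iota_bordered// mulmxA.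
have e2 : z *m X' *m iota_mx g = w *m iota_mx (z *m g) by rewrite zX' iota_mxM// mulmxA.
have e3 : decay N2 (invmx (iota_mx g) *m (last_row K n.+1)^T) = decay N2 (last_row K n.+1 *m g).
  by rewrite /iota_mx -trmx_inv invmxK -trmx_mul /decay mx_sizeT.
rewrite e1 e2 e3 mulrA; apply: ler_wpM2r; first exact: decay_ge0.
have g1U : bordered (z_mx K n) *m g \in unitmx by rewrite unitmx_mul bordered_unit z'U.
have g2U : z *m g \in unitmx by rewrite unitmx_mul zU.
have h5 := hC5 _ g1U; have h6 := hC6 _ g2U.
have fa x : flag nabs (fun i => - al' (rev_ord i))%R x = flag nabs (shifted n a') x.
  apply: eq_bigr => i _; congr (_ `^ (_ * _))%R.
  exact: (shifted_dual (fun i => a (widen_ord (leqnSn n.+1) i))).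
have fb x : flag nabs (fun i => - be (rev_ord i))%R x = flag nabs (shifted n b') x.
  by apply: eq_bigr => i _; congr (_ `^ (_ * _))%R; exact: shifted_dual.
rewrite fa in h5; rewrite fb in h6.
apply: (le_trans (ler_pM (flag_ge0 _ _) (flag_ge0 _ _) h5 h6)).
by rewrite mulrACA [X in (_ * X <= _)%R]mulrC.
Qed.

End CorankOneStep.

Section StripConvergence.
Context {R : realType} {K : absFieldType R}.
Context {mu : {sigma_finite_measure set (borel K) -> \bar R}} {nabs : K -> R}.
Context {L : local_haar mu nabs}.
Local Open Scope ereal_scope.

(** GL_0 is a point, so the integrand is a constant; the finite mass of the point comes from
    [integral_decay_lty] in size 0. *)
Lemma corank_one_lty0 (a : 'I_1 -> R) (b : 'I_0 -> R) :
  hint mu nabs (fun h => (corank_one_integrand nabs a b h)%:E) < +oo.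
Proof.
have [N hN] := @integral_decay_lty _ _ mu nabs L 0 0.
apply: (@hint_lty_le _ _ mu nabs L 0 (corank_one_integrand nabs a b)
  (fun x => decay N (x : 'M[K]_0)) (corank_one_integrand nabs a b (0%R : 'M[K]_0))).
- exact: measurable_corank_one.
- exact (measurable_decay N (@measurable_id _ (mxb 0 0) setT)).
- exact: corank_one_ge0.
- by move=> x; exact: decay_ge0.
- exact: corank_one_ge0.
- move=> x _; rewrite [x]flatmx0 (_ : decay N _ = 1%R) ?mulr1//.
  by rewrite /decay mx_size0 addr0 expr1n invr1.
rewrite /hint; under eq_integral do rewrite /haar_weight expr0 invr1 mule1.
exact: hN.
Qed.

Lemma corank_one_lty n (a : 'I_n.+1 -> R) (b : 'I_n -> R) : strip a b ->
  hint mu nabs (fun h => (corank_one_integrand nabs a b h)%:E) < +oo.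
Proof.
elim: n a b => [|n IH] a b hab; first exact: corank_one_lty0.
pose a' := fun i : 'I_n.+1 => (2^-1 - a (widen_ord (leqnSn n.+1) (rev_ord i)))%R.
pose b' := fun i : 'I_n.+1 => (2^-1 - b (rev_ord i))%R.
(* b'_i + a'_j is 1 minus a sum of entries of [a] and [b] with reversed indices. The reflection
   exchanges the bounds 0 and 1, and the reversal exchanges the two ranges of i + j. *)
have hab' : strip b' a'.
  move=> i j; have hi := ltn_ord i; have hj := ltn_ord j.
  have [h1 h2] := hab (widen_ord (leqnSn n.+1) (rev_ord j)) (rev_ord i).
  split=> ij.
    have : (0 < a (widen_ord (leqnSn n.+1) (rev_ord j)) + b (rev_ord i))%R by apply: h2 => /=; lia.
    by rewrite /a' /b'; lra.
  have : (a (widen_ord (leqnSn n.+1) (rev_ord j)) + b (rev_ord i) < 1)%R by apply: h1 => /=; lia.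
  by rewrite /a' /b'; lra.
have [|N hN] := @equal_rank_of_corank_one _ _ mu nabs L n b' a' hab'.
  apply: IH => i j; have [h1 h2] := hab' i (widen_ord (leqnSn n) j); split; first exact: h1.
  exact: h2.
exact: (corank_one_of_equal_rank hab hN).
Qed.

Lemma equal_rank_lty n (a b : 'I_n.+1 -> R) : strip a b ->
  exists N, hint mu nabs (fun g => (equal_rank_integrand nabs a b N g)%:E) < +oo.
Proof.
move=> hab; apply: equal_rank_of_corank_one => //; apply: corank_one_lty => i j.
by have [h1 h2] := hab i (widen_ord (leqnSn n) j); split; [exact: h1|exact: h2].
Qed.

End StripConvergence.

(** * Reduction to flag functions *)

Section TestFunctions.
Context {R : realType} {K : absFieldType R}.

Lemma smooth_GL_cvg k (f : 'M[K]_k -> R[i]) : smooth_GL f ->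
  forall x : 'M[K]_k, x \in unitmx -> (f y : R[i]^o) @[y --> x] --> (f x : R[i]^o).
Proof.
move=> [fn fa] x xU; have [na|na] := pselect (nonarchimedean K); last first.
  (* The empty list of derivatives gives the continuity of [f] itself. *)
  have [io _ hf] := fa na; have [h _] := hf [::] x xU; exact: h.
have [U [oU UGL U1 UM UV] hU] := fn na.
have cx : (fun y : 'M[K]_k => invmx x *m y) @ x --> (1%:M : 'M[K]_k).
  rewrite -(mulVmx xU).
  by apply: (@cvg_mulmx _ _ _ (nbhs x)); [exact: cvg_cst|exact: cvg_id].
have nU : nbhs (1%:M : 'M[K]_k) U by apply: open_nbhs_nbhs.
have h : \forall y \near x, U (invmx x *m y) := cx _ nU.
have fE (y : 'M[K]_k) : U (invmx x *m y) -> f y = f x.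
  by move=> Uy; rewrite -(hU x _ xU Uy) mulKVmx.
apply: cvg_near_cst; first [exact (nbhs_filter x)|exact (@filterS _ (nbhs x) _ _ _ fE h)].
Qed.

Lemma schwartz_cvg p q (f : 'M[K]_(p, q) -> R[i]) : schwartz f ->
  forall x : 'M[K]_(p, q), (f y : R[i]^o) @[y --> x] --> (f x : R[i]^o).
Proof.
move=> [fn fa] x; have [na|na] := pselect (nonarchimedean K); last first.
  have [io [_ hf _]] := fa na; have [h _] := hf [::] x I; exact: h.
have [lf _] := fn na; apply: cvg_near_cst; first [exact (nbhs_filter x)|exact (lf x)].
Qed.

(** Over an archimedean field this is rapid decrease with no derivative taken; otherwise it is
    continuity on a compact support. *)
Lemma schwartz_decay p q (f : 'M[K]_(p, q) -> R[i]) N : schwartz f ->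
  exists2 C, 0 < C & forall x, Normc.normc (f x) <= C * decay N x.
Proof.
move=> hf; have := hf => -[fn fa].
suff [C hC] : exists C, forall x : 'M[K]_(p, q), (1 + mx_size x) ^+ N * Normc.normc (f x) <= C.
  exists (`|C| + 1) => [|x]; first by rewrite ltr_wpDl.
  have x0 : 0 < (1 + mx_size x) ^+ N by rewrite exprn_gt0// ltr_wpDr// mx_size_ge0.
  rewrite /decay ler_pdivlMr// mulrC (le_trans (hC x))// (le_trans (ler_norm _))//.
  by rewrite lerDl.
have [na|na] := pselect (nonarchimedean K); last first.
  by have [io [_ _ hr]] := fa na; have [C hC] := hr [::] N; exists C.
have [_ [A cA hA]] := fn na.
have [|C C0 hC] := compact_bounded_fun (f := fun x : 'M[K]_(p, q) => (1 + mx_size x) ^+ N * Normc.normc (f x)) cA.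
  move=> x _; have FF := nbhs_filter x.
  have c1 : (1 + mx_size y) @[y --> x] --> 1 + mx_size x.
    by apply: (@cvgD _ _ _ (nbhs x)); [exact: cvg_cst|exact: mx_size_cvg].
  have c2 m : (1 + mx_size y) ^+ m @[y --> x] --> (1 + mx_size x) ^+ m.
    elim: m => [|m IH]; first by under eq_fun do rewrite expr0; rewrite expr0; exact: cvg_cst.
    by under eq_fun do rewrite exprS; rewrite exprS; exact: (@cvgM _ _ (nbhs x)).
  by apply: (@cvgM _ _ (nbhs x)) => //; exact: (@cvg_normc _ _ (nbhs x) _ _ _ (schwartz_cvg hf (x := x))).
exists C => x; have [Ax|Ax] := pselect (A x).
  by apply: le_trans (hC x Ax); exact: ler_norm.
by rewrite hA// Normc.normc0 mulr0 ltW.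
Qed.

End TestFunctions.

Section PrincipalSeriesBound.
Context {R : realType} {K : absFieldType R}.
Context {mu : {sigma_finite_measure set (borel K) -> \bar R}} {nabs : K -> R}.
Context {L : local_haar mu nabs}.

Lemma normc_real (r : R) : Normc.normc r%:C%C = `|r|.
Proof. by rewrite /Normc.normc/= expr0n/= addr0 sqrtr_sqr. Qed.

Lemma principal_series_bound n (nu : 'I_n -> quasi_character K) f : principal_series nabs nu f ->
  exists2 C, 0 < C & forall x : 'M[K]_n, x \in unitmx -> Normc.normc (f x) <=
    C * flag nabs (fun i => exponent nabs (nu i) + ((i.*2.+1)%:R - n%:R) / 2) x.
Proof.
move=> [sf hf]; apply: (@flag_dominates _ _ mu nabs L n
  (fun i => exponent nabs (nu i) + ((i.*2.+1)%:R - n%:R) / 2) (fun x => Normc.normc (f x))) => M.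
have [C C0 hC] := @bounded_gl_fun R K (@haar_local_field _ _ _ _ L) n M (fun x => Normc.normc (f x))
  (fun x xU => @cvg_normc _ _ (nbhs x) _ _ _ (smooth_GL_cvg sf xU)).
exists C => // b k bT bU bk; have kU : k \in unitmx by case: bk.
rewrite hf// !Normc.normcM normc_real mulrC; apply: ler_pM; rewrite ?mulr_ge0 ?normc_ge0//.
  by apply: le_trans (hC k bk); exact: ler_norm.
rewrite (big_morph _ (@Normc.normcM R) (@Normc.normc1 R)) ger0_norm; last first.
  by apply: prodr_ge0 => i _; exact: powR_ge0.
rewrite /rho_bar -big_split/=; apply: ler_prod => i _.
have d0 := trig_diag_neq0 i bT bU.
rewrite mulr_ge0 ?normc_ge0 ?powR_ge0//= (@exponentP _ _ mu nabs L)// powRD//.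
by rewrite (gt_eqF (nabs_gt0 _)) ?implybT.
Qed.

End PrincipalSeriesBound.

Section ComplexMeasurable.
Context {R : realType} d (X : measurableType d) (D : set X).
Hypothesis mD : measurable D.

Definition cmeasurable (g : X -> R[i]) : Prop :=
  measurable_fun D (fun x => complex.Re (g x)) /\ measurable_fun D (fun x => complex.Im (g x)).

Lemma cmeasurableM g h : cmeasurable g -> cmeasurable h -> cmeasurable (fun x => g x * h x).
Proof.
move=> [g1 g2] [h1 h2]; split.
  apply: (eq_measurable_fun (fun x => complex.Re (g x) * complex.Re (h x) - complex.Im (g x) * complex.Im (h x))).
    by move=> x _; case: (g x) => a b; case: (h x).
  by apply: measurable_funB; exact: measurable_funM.
apply: (eq_measurable_fun (fun x => complex.Re (g x) * complex.Im (h x) + complex.Im (g x) * complex.Re (h x))).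
  by move=> x _; case: (g x) => a b; case: (h x).
by apply: measurable_funD; exact: measurable_funM.
Qed.

Lemma cmeasurable_real (g : X -> R) : measurable_fun D g -> cmeasurable (fun x => (g x)%:C%C).
Proof. by move=> mg; split => //=; exact: measurable_cst. Qed.

Lemma cmeasurable_cpow (g : X -> R) s : measurable_fun D g -> cmeasurable (fun x => cpow (g x) s).
Proof.
move=> mg; apply: cmeasurableM.
  by apply: cmeasurable_real; exact (measurableT_comp (measurable_powR _) mg).
have ml : measurable_fun D (fun x => complex.Im s * ln (g x)).
  by apply: measurable_funM; [exact: measurable_cst|exact (measurableT_comp (@measurable_ln R) mg)].
split => /=.
  exact (measurableT_comp (continuous_measurable_fun (@continuous_cos R)) ml).
exact (measurableT_comp (continuous_measurable_fun (@continuous_sin R)) ml).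
Qed.

Lemma measurable_normc g : cmeasurable g -> measurable_fun D (fun x => Normc.normc (g x)).
Proof.
move=> [g1 g2]; pose h x := complex.Re (g x) ^+ 2 + complex.Im (g x) ^+ 2.
apply: (eq_measurable_fun (fun x => h x `^ 2^-1)).
  move=> x _; rewrite powR12_sqrt ?addr_ge0 ?sqr_ge0//.
  by rewrite /h /Normc.normc; case: (g x).
have mh : measurable_fun D h by apply: measurable_funD; exact: measurable_funX.
exact (measurableT_comp (measurable_powR _) mh).
Qed.

End ComplexMeasurable.

(** * From flag integrals to absolute convergence *)

Section Convergence.
Context {R : realType} {K : absFieldType R}.
Context {mu : {sigma_finite_measure set (borel K) -> \bar R}} {nabs : K -> R}.
Context {L : local_haar mu nabs}.

Lemma cmeasurable_GL p q r (h : 'M[K]_p -> 'M[K]_(q, r)) (f : 'M[K]_(q, r) -> R[i]) :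
  (forall x : 'M[K]_p, x \in unitmx -> h y @[y --> x] --> h x) ->
  (forall x : 'M[K]_p, x \in unitmx -> (f y : R[i]^o) @[y --> h x] --> (f (h x) : R[i]^o)) ->
  cmeasurable (@GL R K p : set (mxb p p)) (fun x : mxb p p => f (h (x : 'M[K]_p))).
Proof.
move=> ch cf.
have cfh (x : 'M[K]_p) : x \in unitmx -> (f (h y) : R[i]^o) @[y --> x] --> (f (h x) : R[i]^o).
  move=> xU; have H := cf x xU; have H' := ch x xU; exact (cvg_comp _ _ H' H).
have Kl : is_local_field K := @haar_local_field _ _ _ _ L.
split; apply: (@measurable_GL_continuous R K Kl p) => x xU.
  exact: (@cvg_Re _ _ (nbhs x) _ _ _ (cfh x xU)).
exact: (@cvg_Im _ _ (nbhs x) _ _ _ (cfh x xU)).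
Qed.

Lemma cvg_mulmxl p q r (A : 'M[K]_(p, q)) (x : 'M[K]_(q, r)) : A *m y @[y --> x] --> A *m x.
Proof. by apply: (@cvg_mulmx _ _ _ (nbhs x)); [exact: cvg_cst|exact: cvg_id]. Qed.

Lemma cvg_bordered n (x : 'M[K]_n) : bordered y @[y --> x] --> bordered x.
Proof.
apply/(@cvg_mxP _ _ _ (nbhs x)) => i j.
have E (A : 'M[K]_n) := castmx_block A 0 0 1%:M.
have [[i' ->]|->] := ord_lastP i; have [[j' ->]|->] := ord_lastP j.
- have [e _ _ _] := E x; rewrite /bordered e.
  rewrite (_ : (fun t : 'M[K]_n => _) = (fun t : 'M[K]_n => t i' j')).
    exact: mx_entry_cvg.
  by apply/funext => t; have [-> _ _ _] := E t.
- have [_ e _ _] := E x; rewrite /bordered e.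
  rewrite (_ : (fun t : 'M[K]_n => _) = cst ((0 : 'M[K]_(n, 1)) i' 0)); first exact: cvg_cst.
  by apply/funext => t; have [_ -> _ _] := E t.
- have [_ _ e _] := E x; rewrite /bordered e.
  rewrite (_ : (fun t : 'M[K]_n => _) = cst ((0 : 'M[K]_(1, n)) 0 j')); first exact: cvg_cst.
  by apply/funext => t; have [_ _ -> _] := E t.
- have [_ _ _ e] := E x; rewrite /bordered e.
  rewrite (_ : (fun t : 'M[K]_n => _) = cst ((1%:M : 'M[K]_1) 0 0)); first exact: cvg_cst.
  by apply/funext => t; have [_ _ _ ->] := E t.
Qed.

Lemma normc_cpow (a : R) s : Normc.normc (cpow a s) = a `^ complex.Re s.
Proof.
rewrite /cpow Normc.normcM normc_real ger0_norm ?powR_ge0//.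
by rewrite /Normc.normc cos2Dsin2 sqrtr1 mulr1.
Qed.

(** Domination, then passage from tuples to matrices; the restriction to GL is dropped from the
    majorant, which is nonnegative. *)
Lemma GL_absolutely_convergent_bound k (F : 'M[K]_k -> R[i]) (B : mxb (K := K) k k -> R) (C : R) :
  cmeasurable (@GL R K k : set (mxb k k)) (F : mxb k k -> R[i]) ->
  measurable_fun setT B -> (forall x, 0 <= B x) -> 0 <= C ->
  (forall x : 'M[K]_k, x \in unitmx -> Normc.normc (F x) <= C * B x) ->
  (hint mu nabs (fun x => (B x)%:E) < +oo)%E -> GL_absolutely_convergent mu nabs F.
Proof.
move=> mF mB B0 C0 FB hB.
have Kl : is_local_field K := @haar_local_field _ _ _ _ L.
pose G (x : mxb (K := K) k k) : R[i] := F x * (haar_weight nabs (x : 'M[K]_k))%:C%C.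
have mGL : measurable (@GL R K k : set (mxb k k)) := @measurable_GL R K Kl k.
have mw : measurable_fun setT (fun x : mxb k k => haar_weight nabs (x : 'M[K]_k)).
  exact (measurable_haar_weight (@measurable_id _ (mxb k k) setT)).
have mG : cmeasurable (@GL R K k : set (mxb k k)) G.
  apply: cmeasurableM => //; apply: cmeasurable_real; exact: measurable_funTS.
pose D := [set t : (k * k).-tuple (borel K) | GL (mx_of_tuple (t : (k * k).-tuple K))].
have mt : measurable_fun setT (fun t : (k * k).-tuple (borel K) => @mxt R K k k t : mxb k k).
  exact: measurable_mxt.
have mD : measurable D.
  by have := mt measurableT _ mGL; rewrite setTI.
have mGt (h : R[i] -> R) : measurable_fun (@GL R K k : set (mxb k k)) (h \o G) ->
    measurable_fun D (fun t => h (G (@mxt R K k k t))).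
  move=> mh; apply: (measurable_comp mGL _ mh).
    by move=> _ [t Dt <-].
  exact: measurable_funTS.
have [mG1 mG2] := mG.
split.
- exact (mGt (@complex.Re R) mG1).
- exact (mGt (@complex.Im R) mG2).
pose b (x : mxb (K := K) k k) : \bar R := (C%:E * (B x)%:E * (haar_weight nabs (x : 'M[K]_k))%:E)%E.
have mBE : measurable_fun setT (fun x => (B x)%:E : \bar R).
  exact (measurableT_comp (@EFin_measurable R setT) mB).
have mCB : measurable_fun setT (fun x => (C%:E * (B x)%:E)%E : \bar R).
  by apply: emeasurable_funM => //; exact: measurable_cst.
have mb : measurable_fun setT b := @measurable_hint_integrand _ _ mu nabs L k _ mCB.
have b0 x : (0 <= b x)%E by rewrite !mule_ge0 ?lee_fin ?haar_weight_ge0.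
have mbt : measurable_fun setT (fun t : (k * k).-tuple (borel K) => b (@mxt R K k k t)) := measurableT_comp mb mt.
apply: (@le_lt_trans _ _ (\int[power_measure mu (k * k)]_(t in D) b (@mxt R K k k t))%E).
  apply: ge0_le_integral => //.
  - by move=> t _; rewrite lee_fin normc_ge0.
  - have := mGt (@Normc.normc R) (measurable_normc mG).
    by move=> mn; exact (measurableT_comp (@EFin_measurable R setT) mn).
  - exact: measurable_funTS.
  move=> t Dt; have xU : @mxt R K k k t \in unitmx by exact: Dt.
  rewrite /b -!EFinM lee_fin Normc.normcM normc_real ger0_norm ?haar_weight_ge0//.
  by apply: ler_wpM2r; [exact: haar_weight_ge0|exact: FB].
apply: (@le_lt_trans _ _ (\int[power_measure mu (k * k)]_t b (@mxt R K k k t))%E).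
  by apply: ge0_subset_integral.
rewrite -(@integral_lam R K mu k k b mb b0).
have CE0 : (0 <= C%:E)%E by rewrite lee_fin.
have := @hintZl _ _ mu nabs L k C%:E _ CE0 mBE (fun x => _).
rewrite /hint /b => ->; last by move=> x; rewrite lee_fin.
by rewrite lte_mul_pinfty.
Qed.

End Convergence.

Local Open Scope complex_scope.

Theorem proposition1p4 (R : realType) (K : absFieldType R)
    (Klocal : is_local_field K)
    (psi : K -> R[i]) (psi_unitary : unitary_character psi)
    (psi_nontrivial : exists x, psi x != 1)
    (mu : {sigma_finite_measure set (borel K) -> \bar R})
    (mu_haar : is_haar mu) (mu_self_dual : self_dual mu psi)
    (nabs : K -> R) (nabs_normalized : normalized_abs mu nabs)
    (n : nat) (nu : 'I_n.+1 -> quasi_character K)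
    (f : 'M[K]_n.+1 -> R[i]) (hf : principal_series nabs nu f)
    (s : R[i]) :
  (* n' = n *)
  (forall (nu' : 'I_n.+1 -> quasi_character K) (f' : 'M[K]_n.+1 -> R[i])
          (phi : 'rV[K]_n.+1 -> R[i]),
     principal_series nabs nu' f' -> schwartz phi ->
     in_strip nabs nu nu' s ->
     GL_absolutely_convergent mu nabs (fun g : 'M[K]_n.+1 =>
       f (z_mx K n.+1 *m g) * f' (bordered (z_mx K n) *m g)
       * phi (last_row K n.+1 *m g) * cpow (nabs (\det g)) s)) /\
  (* n' = n - 1 *)
  (forall (nu' : 'I_n -> quasi_character K) (f' : 'M[K]_n -> R[i]),
     principal_series nabs nu' f' ->
     in_strip nabs nu nu' s ->
     GL_absolutely_convergent mu nabs (fun h : 'M[K]_n =>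
       f (z_mx K n.+1 *m bordered h) * f' (z_mx K n *m h)
       * cpow (nabs (\det h)) (s - 2^-1))).
Proof.
have L : local_haar mu nabs by split.
pose sr := complex.Re s; pose Z := z_mx K n.+1; pose z := z_mx K n.
have ZU : Z \in unitmx := z_mx_unit _ _; have zU : z \in unitmx := z_mx_unit _ _.
have [C1 C10 hC1] := @principal_series_bound _ _ mu nabs L _ nu f hf.
(* The real part of [s] is attributed entirely to the first family of exponents. *)
pose a i := exponent nabs (nu i) + sr.
have [C4 C40 hC4] := @flag_shift_le _ _ mu nabs L n.+1
  (fun i => exponent nabs (nu i) + ((i.*2.+1)%:R - n.+1%:R) / 2) sr.
pose rZ := nabs (\det Z) `^ sr.
have rZ0 : 0 < rZ by rewrite powR_gt0// nabs_det_gt0.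
have idx2 (i : nat) : (i.*2.+1)%:R = 2 * i%:R + 1 :> R by rewrite -natr1 -muln2 natrM mulrC.
(* The power of |det x| is that of |det (Z x)| up to the constant [rZ], so it can be absorbed in the
   flag function evaluated at Z x. *)
have fbound (x : 'M[K]_n.+1) : x \in unitmx ->
    Normc.normc (f (Z *m x)) * nabs (\det x) `^ sr <= C1 * C4 / rZ * flag nabs (shifted n a) (Z *m x).
  move=> xU; have ZxU : Z *m x \in unitmx by rewrite unitmx_mul ZU.
  have h1 := hC1 _ ZxU; have h4 := hC4 _ ZxU; rewrite nabs_detM_powR -/rZ in h4.
  have -> : flag nabs (shifted n a) (Z *m x) = flag nabs (fun i => exponent nabs (nu i) +
      ((i.*2.+1)%:R - n.+1%:R) / 2 + sr) (Z *m x).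
    apply: eq_bigr => i _; congr (_ `^ (_ * _)).
    by rewrite /shifted /a idx2 -natr1; field.
  set fl := flag _ _ _ in h1 h4 *; set fl' := flag _ _ _ in h4 *; set d := nabs _ `^ _ in h4 *.
  have d0 : 0 <= d by exact: powR_ge0.
  apply: (@le_trans _ _ (C1 * fl * d)); first exact: ler_wpM2r.
  rewrite -!mulrA; apply: ler_wpM2l; first exact: ltW.
  have -> : C4 * (rZ^-1 * fl') = rZ^-1 * (C4 * fl') by ring.
  by rewrite ler_pdivlMl// mulrCA.
have cZ (x : 'M[K]_n.+1) : x \in unitmx -> Z *m x \in unitmx by move=> xU; rewrite unitmx_mul ZU.
have mdet k s' : cmeasurable (@GL R K k : set (mxb k k)) (fun g : mxb k k => cpow (nabs (\det (g : 'M[K]_k))) s').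
  apply: cmeasurable_cpow; apply: measurable_funTS.
  exact (measurable_nabs (measurable_det (@measurable_id _ (mxb k k) setT))).
split.
  move=> nu' f' phi hf' hphi hs; pose b i := exponent nabs (nu' i).
  have Bz : bordered z \in unitmx by rewrite bordered_unit.
  have hab : strip a b.
    move=> i j; have [h1 h2] := hs i j; rewrite /a /b -/sr in h1 h2 *; split=> ij.
      have : exponent nabs (nu i) + exponent nabs (nu' j) + sr < 1 by apply: h1; lia.
      by lra.
    have : 0 < exponent nabs (nu i) + exponent nabs (nu' j) + sr by apply: h2; lia.
    by lra.
  have [N hN] := @equal_rank_lty _ _ mu nabs L n a b hab.
  have [C2 C20 hC2] := @principal_series_bound _ _ mu nabs L _ nu' f' hf'.
  have [C3 C30 hC3] := schwartz_decay N hphi.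
  apply: (@GL_absolutely_convergent_bound _ _ mu nabs L n.+1 _ (equal_rank_integrand nabs a b N)
    (C1 * C4 / rZ * C2 * C3)) => //.
  - apply: cmeasurableM; last exact: mdet.
    apply: cmeasurableM.
      apply: cmeasurableM.
        apply: (@cmeasurable_GL _ _ mu nabs L _ _ _ (fun g => Z *m g)) => x xU; first exact: cvg_mulmxl.
        exact: (smooth_GL_cvg hf.1 (cZ x xU)).
      apply: (@cmeasurable_GL _ _ mu nabs L _ _ _ (fun g => bordered z *m g)) => x xU; first exact: cvg_mulmxl.
      by apply: (smooth_GL_cvg hf'.1); rewrite unitmx_mul Bz.
    apply: (@cmeasurable_GL _ _ mu nabs L _ _ _ (fun g => last_row K n.+1 *m g)) => x xU; first exact: cvg_mulmxl.
    exact: schwartz_cvg.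
  - exact: measurable_equal_rank.
  - exact: equal_rank_ge0.
  - by rewrite !mulr_ge0 ?invr_ge0// ltW.
  move=> x xU; rewrite 3!Normc.normcM normc_cpow -/sr.
  have BxU : bordered z *m x \in unitmx by rewrite unitmx_mul Bz.
  have h1 := fbound x xU; have h2 := hC2 _ BxU; have h3 := hC3 (last_row K n.+1 *m x).
  have e2 : flag nabs (shifted n b) (bordered z *m x) = flag nabs (fun i => exponent nabs (nu' i) +
      ((i.*2.+1)%:R - n.+1%:R) / 2) (bordered z *m x).
    apply: eq_bigr => i _; congr (_ `^ (_ * _)).
    by rewrite /shifted /b idx2 -natr1; field.
  rewrite /equal_rank_integrand -/Z -/z e2.
  move: h1 h2 h3.
  move: (flag_ge0 (nabs := nabs) (shifted n a) (Z *m x)); set fl1 := flag _ _ _ => fl10.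
  set fl2 := flag _ _ _ => h1 h2; set dc := decay _ _ => h3.
  move: h1 h2 h3; set u1 := Normc.normc (f _); set u2 := Normc.normc (f' _); set u3 := Normc.normc (phi _).
  set d := nabs _ `^ _ => h1 h2 h3.
  have -> : u1 * u2 * u3 * d = u1 * d * u2 * u3 by ring.
  have -> : C1 * C4 / rZ * C2 * C3 * (fl1 * fl2 * dc) = C1 * C4 / rZ * fl1 * (C2 * fl2) * (C3 * dc) by ring.
  have u10 : 0 <= u1 by exact: normc_ge0.
  have u20 : 0 <= u2 by exact: normc_ge0.
  have u30 : 0 <= u3 by exact: normc_ge0.
  have d0 : 0 <= d by exact: powR_ge0.
  apply: ler_pM => //; first exact: mulr_ge0 (mulr_ge0 u10 d0) u20.
  by apply: ler_pM => //; exact: mulr_ge0.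
move=> nu' f' hf' hs; pose b i := exponent nabs (nu' i).
have hab : strip a b.
  move=> i j; have [h1 h2] := hs i j; rewrite /a /b -/sr in h1 h2 *; split=> ij.
    have : exponent nabs (nu i) + exponent nabs (nu' j) + sr < 1 by apply: h1; lia.
    by lra.
  have : 0 < exponent nabs (nu i) + exponent nabs (nu' j) + sr by apply: h2; lia.
  by lra.
have hN := @corank_one_lty _ _ mu nabs L n a b hab.
have [C2 C20 hC2] := @principal_series_bound _ _ mu nabs L _ nu' f' hf'.
(* The remaining factor |det|^(-1/2) goes to f': (2i + 1 - n)/2 - 1/2 = i - n/2, the weight in
   [shifted n]. *)
have [C3 C30 hC3] := @flag_shift_le _ _ mu nabs L n
  (fun i => exponent nabs (nu' i) + ((i.*2.+1)%:R - n%:R) / 2) (- 2^-1).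
pose rz := nabs (\det z) `^ (- 2^-1).
have rz0 : 0 < rz by rewrite powR_gt0// nabs_det_gt0.
apply: (@GL_absolutely_convergent_bound _ _ mu nabs L n _ (corank_one_integrand nabs a b)
  (C1 * C4 / rZ * (C2 * C3 / rz))) => //.
- apply: cmeasurableM; last exact: mdet.
  apply: cmeasurableM.
    apply: (@cmeasurable_GL _ _ mu nabs L _ _ _ (fun h => Z *m bordered h)) => x xU.
      apply: (@cvg_mulmx _ _ _ (nbhs x)); [exact: cvg_cst|exact: cvg_bordered].
    by apply: (smooth_GL_cvg hf.1); apply: cZ; rewrite bordered_unit.
  apply: (@cmeasurable_GL _ _ mu nabs L _ _ _ (fun h => z *m h)) => x xU; first exact: cvg_mulmxl.
  by apply: (smooth_GL_cvg hf'.1); rewrite unitmx_mul zU.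
- exact: measurable_corank_one.
- exact: corank_one_ge0.
- by rewrite !mulr_ge0 ?invr_ge0 ?mulr_ge0 ?invr_ge0// ltW.
move=> x xU; rewrite 2!Normc.normcM normc_cpow.
have BxU : bordered x \in unitmx by rewrite bordered_unit.
have zxU : z *m x \in unitmx by rewrite unitmx_mul zU.
have -> : complex.Re (s - 2^-1) = sr - 2^-1.
  have -> : (2^-1 : R[i]) = (2^-1)%:C by rewrite fmorphV rmorph_nat.
  by rewrite /sr; case: (s).
have dx0 := @nabs_det_gt0 _ _ mu nabs L _ x xU.
rewrite powRD; last by rewrite (gt_eqF dx0) implybT.
have h1 := fbound _ BxU; rewrite det_bordered in h1.
have h2 := hC2 _ zxU; have h3 := hC3 _ zxU; rewrite nabs_detM_powR -/rz in h3.
have e2 : flag nabs (shifted n b) (z *m x) = flag nabs (fun i => exponent nabs (nu' i) +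
    ((i.*2.+1)%:R - n%:R) / 2 - 2^-1) (z *m x).
  by apply: eq_bigr => i _; congr (_ `^ (_ * _)); rewrite /shifted /b idx2; field.
rewrite /corank_one_integrand -/Z -/z e2.
move: h1 h2 h3.
set fl1 := flag _ _ _ => h1; set fl2 := flag _ _ _ => h2; set fl3 := flag _ _ _.
move: h1 h2; set u1 := Normc.normc (f _); set u2 := Normc.normc (f' _).
set d := nabs _ `^ _; set d' := nabs _ `^ _ => h1 h2 h3.
have u10 : 0 <= u1 by exact: normc_ge0.
have u20 : 0 <= u2 by exact: normc_ge0.
have d0 : 0 <= d by exact: powR_ge0.
have d'0 : 0 <= d' by exact: powR_ge0.
have -> : u1 * u2 * (d * d') = u1 * d * (u2 * d') by ring.
have -> : C1 * C4 / rZ * (C2 * C3 / rz) * (fl1 * fl3) = C1 * C4 / rZ * fl1 * (C2 * C3 / rz * fl3) by ring.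
apply: ler_pM => //; [exact: mulr_ge0|exact: mulr_ge0|].
apply: (@le_trans _ _ (C2 * fl2 * d')); first exact: ler_wpM2r.
rewrite -!mulrA; apply: ler_wpM2l; first exact: ltW.
have -> : C3 * (rz^-1 * fl3) = rz^-1 * (C3 * fl3) by ring.
by rewrite ler_pdivlMl// mulrCA.
Qed.
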